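(* Let $D$ be an arc-locally in-semicomplete digraph. If $D$ does not contain a blocking odd cycle as an induced subdigraph, then $D$ is BE-diperfect.
   Context: All digraphs are finite, without loops and without multiple edges (a pair of opposite edges $uv$, $vu$ is allowed). Two vertices $u,v$ are adjacent if $uv$ or $vu$ is an edge. The underlying graph $U(D)$ is the simple graph on $V(D)$ in which two vertices are joined exactly when they are adjacent in $D$. A source is a vertex with no in-neighbor, a sink is a vertex with no out-neighbor. A digraph $D$ is arc-locally in-semicomplete if for each edge $uv\in E(D)$, every in-neighbor of $u$ and every in-neighbor of $v$ are adjacent or are the same vertex. A digraph $C$ is a blocking odd cycle if $U(C)=x_1x_2\dots x_{2k+1}x_1$ is a cycle for some $k\ge 1$, $x_1$ is a source of $C$ and $x_2$ is a sink of $C$. A stable set is a set of pairwise non-adjacent vertices. A path is a directed path with distinct vertices (a single vertex is a path). A path partition of $D$ is a collection $\mathcal{P}$ of paths of $D$ such that every vertex of $D$ belongs to exactly one path of $\mathcal{P}$. For a stable set $S$ of $D$, an $S_{BE}$-path partition of $D$ is a path partition $\mathcal{P}$ such that $|V(P)\cap S|=1$ for every $P\in\mathcal{P}$ and every vertex of $S$ starts or ends a path of $\mathcal{P}$. A digraph satisfies the BE-property if for every maximum (i.e. maximum cardinality) stable set $S$ it has an $S_{BE}$-path partition. A digraph is BE-diperfect if every one of its induced subdigraphs satisfies the BE-property. *)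

(* Defs.v *)
(* A digraph is a finite vertex type T together with an edge
   relation D : rel T; there are no multiple edges by construction, and
   looplessness is the hypothesis [irreflexive D]. *)
From mathcomp Require Import all_boot.

Set Implicit Arguments.
Unset Strict Implicit.
Unset Printing Implicit Defensive.

(* The edge relation of the underlying graph U(D). *)
Definition adjacent (T : finType) (D : rel T) : rel T :=
  [rel u v | D u v || D v u].

Definition is_source (T : finType) (D : rel T) (v : T) : Prop :=
  forall u : T, ~~ D u v.

Definition is_sink (T : finType) (D : rel T) (v : T) : Prop :=
  forall u : T, ~~ D v u.

Definition induced (T : finType) (D : rel T) (A : {set T}) :
    rel {x : T | x \in A} :=
  fun x y => D (val x) (val y).
Arguments induced [T] D A.

Definition arc_locally_in_semicomplete (T : finType) (D : rel T) : Prop :=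
  forall u v : T, D u v ->
  forall x y : T, D x u -> D y v -> adjacent D x y \/ x = y.

(* The vertices x_1, ..., x_(2k+1) are x i for i : 'I_(2k+1), so x_1 is x ord0
   and x_2 is x (ordS ord0); ordS is the cyclic successor.  As x is bijective
   and adjacency is characterized exactly, U(D) has no other vertex and no
   chord. *)
Definition blocking_odd_cycle (T : finType) (D : rel T) : Prop :=
  exists (k : nat) (x : 'I_(k.*2.+1) -> T),
    [/\ 1 <= k,
        bijective x,
        forall i j, adjacent D (x i) (x j) = (j == ordS i) || (i == ordS j),
        is_source D (x ord0)
      & is_sink D (x (ordS ord0))].

Definition contains_induced_blocking_odd_cycle
    (T : finType) (D : rel T) : Prop :=
  exists A : {set T}, blocking_odd_cycle (induced D A).

Definition stable (T : finType) (D : rel T) (S : {set T}) : Prop :=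
  {in S &, forall u v, ~~ adjacent D u v}.

Definition maximum_stable (T : finType) (D : rel T) (S : {set T}) : Prop :=
  stable D S /\ forall S' : {set T}, stable D S' -> #|S'| <= #|S|.

(* A path is given by the sequence of its vertices. *)
Definition is_dipath (T : finType) (D : rel T) (p : seq T) : Prop :=
  [/\ p <> [::], uniq p & sorted D p].

Definition path_partition (T : finType) (D : rel T) (P : seq (seq T)) : Prop :=
  (forall p, p \in P -> is_dipath D p) /\
  (forall v : T, count (fun p : seq T => v \in p) P = 1).

Definition starts_or_ends (T : finType) (v : T) (p : seq T) : Prop :=
  (exists q, p = v :: q) \/ (exists q, p = rcons q v).

Definition BE_path_partition (T : finType) (D : rel T) (S : {set T})
    (P : seq (seq T)) : Prop :=
  [/\ path_partition D P,
      forall p, p \in P -> #|[set v in p] :&: S| = 1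
    & forall v, v \in S -> exists2 p, p \in P & starts_or_ends v p].

Definition BE_property (T : finType) (D : rel T) : Prop :=
  forall S : {set T}, maximum_stable D S ->
  exists P : seq (seq T), BE_path_partition D S P.

Definition BE_diperfect (T : finType) (D : rel T) : Prop :=
  forall A : {set T}, BE_property (induced D A).

(* Main.v *)
(* Only blocking triangles matter: by hypothesis, every transitive triangle of D
   has an edge whose reverse is also present.  Let D be a counterexample with as
   few vertices as possible, hence without clique cutset.  Deleting a suitable
   clique from D often leaves a bipartite graph; Hall's theorem then matches the
   remaining vertices into S, and the deleted clique is inserted into one of the
   paths.  Bipartiteness can only be obstructed by directed odd closed walks and
   by triangles made of a digon and a vertex that dominates it or is dominated by
   it.  All vertices of such obstructions belong to the set B of the vertices
   that reach every vertex, unless a vertex dominates a strong component that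
   contains a digon; in that exceptional case the component is a clique or is
   complete bipartite, and a cover is built directly.  Otherwise let k be the
   length of a shortest directed odd closed walk.  If k >= 5, then B is a cyclic
   blow-up of a directed k-cycle.  If k = 3, take a largest strong clique K
   inside B: either B = K, or |K| > 3 and B is obtained from K by adding
   nonadjacent copies of one vertex, or |K| = 3 and B is a blow-up of a directed
   triangle, up to some reverse edges. *)
Require Import Defs.
From Stdlib Require Import Classical.
From mathcomp Require Import all_boot zify.

Set Implicit Arguments.
Unset Strict Implicit.
Unset Printing Implicit Defensive.

(** * Hall's theorem *)

(** Two mechanisms recur. The defining condition is applied to patterns x -> u -> v <- y, where it
    makes x and y adjacent or equal: a vertex with an edge into a directed walk is adjacent to the
    vertex two steps earlier, unless it is that vertex. Adjacency thus travels backwards in steps of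
    two, which is why the parity of directed walks matters and why sets closed under in-neighbours
    appear everywhere. The other mechanism is counting: maximality of S bounds a stable set disjoint
    from S by its number of neighbours in S. In a bipartite graph containing S the bound extends to
    every set disjoint from S, because no vertex of S has neighbours in both colour classes; this is
    Hall's condition. Matched pairs start or end in S automatically. The obstacle is the paths with
    more vertices: what is inserted must leave the vertex of S at an end. Excluding blocking
    triangles helps, since it gives every clique a Hamiltonian path that starts or ends at any
    prescribed vertex. *)

Lemma hall (T : finType) (r : rel T) (A : {set T}) :
    (forall A' : {set T}, A' \subset A ->
       #|A'| <= #|[set y | [exists x in A', r x y]]|) ->
  exists f : T -> T, {in A, forall x, r x (f x)} /\ {in A &, injective f}.
Proof.
move: {2}_.+1 (ltnSn #|A|) => n; elim: n => // n IHn in r A * => cardA hallA.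
have [A0|[a aA]] := set_0Vmem A.
  by exists id; rewrite A0; split=> x; rewrite inE.
pose N (B : {set T}) := [set y | [exists x in B, r x y]].
(* A nonempty proper tight set splits the problem: [B] is matched into [N B], and the rest of [A]
   outside [N B]. *)
have [/existsP[B /and3P[B0 BA tightB]]|] := boolP [exists B : {set T},
    [&& B != set0, B \proper A & #|N B| <= #|B|]].
- have cB : #|B| < n by have := proper_card BA; lia.
  have sBA := proper_sub BA.
  have [|f [fr finj]] := IHn r B cB.
    by move=> A' sA'; apply: hallA; apply: subset_trans sBA.
  pose r' := [rel x y | r x y && (y \notin N B)].
  have cAB : #|A :\: B| < n.
    rewrite cardsD (setIidPr sBA).
    by have := subset_leq_card sBA; move: B0; rewrite -card_gt0; lia.
  have [|g [gr ginj]] := IHn r' (A :\: B) cAB.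
    move=> A' sA'.
    have dA'B : [disjoint A' & B].
      by apply/pred0P=> x /=; apply/andP=> -[/(subsetP sA')]; rewrite !inE => /andP[/negPf->].
    have := hallA (A' :|: B); rewrite subUset sBA andbT.
    move=> /(_ (subset_trans sA' (subsetDl _ _))).
    rewrite cardsU disjoint_setI0 // cards0 subn0.
    have -> : [set y | [exists x in A' :|: B, r x y]]
        = [set y | [exists x in A', r' x y]] :|: N B.
      apply/setP=> y; rewrite !inE; apply/idP/idP.
        case/existsP=> x; rewrite inE => /andP[/orP[xA'|xB] rxy]; last first.
          by apply/orP; right; apply/existsP; exists x; rewrite xB.
        have [yN|yN] := boolP (y \in N B); first by rewrite inE in yN; rewrite yN orbT.
        by apply/orP; left; apply/existsP; exists x; rewrite xA' /= rxy.
      case/orP=> /existsP[x /andP[xX rxy]]; apply/existsP; exists x; rewrite inE xX ?orbT //=.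
      by case/andP: rxy.
    have [le _] := leq_card_setU [set y | [exists x in A', r' x y]] (N B).
    move=> h; rewrite -(leq_add2r #|B|); apply: leq_trans h (leq_trans le _).
    by rewrite leq_add2l.
  exists (fun x => if x \in B then f x else g x); split.
    move=> x xA; case: ifP => xB; first exact: fr.
    by have /andP[] := gr x ltac:(by rewrite inE xB).
  have gN x : x \in A -> x \notin B -> g x \notin N B.
    by move=> xA xB; have /andP[] := gr x ltac:(by rewrite inE xB).
  have fN x : x \in B -> f x \in N B.
    by move=> xB; rewrite inE; apply/existsP; exists x; rewrite xB fr.
  move=> x y xA yA; case: ifP => xB; case: ifP => yB.
  + exact: finj.
  + by move=> e; have := gN y yA (negbT yB); rewrite -e fN.
  + by move=> e; have := gN x xA (negbT xB); rewrite e fN.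
  + by apply: ginj; rewrite inE ?xB ?yB.
(* Every nonempty proper subset has a surplus neighbour, so any edge from [a] to some [b] may be
   fixed and [b] withdrawn. *)
- rewrite negb_exists => /forallP noTight.
  have : 0 < #|N [set a]| by apply: leq_trans (hallA _ _); rewrite ?cards1 ?sub1set.
  case/card_gt0P=> b; rewrite inE => /existsP[a'] /andP[]; rewrite inE => /eqP-> rab {a'}.
  pose r' := [rel x y | r x y && (y != b)].
  have cAa : #|A :\ a| < n by have := cardsD1 a A; rewrite aA; lia.
  have [|g [gr ginj]] := IHn r' (A :\ a) cAa.
    move=> A' sA'.
    have [->|A'0] := eqVneq A' set0; first by rewrite cards0.
    have pA' : A' \proper A by apply: sub_proper_trans sA' _; rewrite properD1.
    have := noTight A'; rewrite A'0 pA' /= -ltnNge => lt.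
    have sub : N A' :\ b \subset [set y | [exists x in A', r' x y]].
      apply/subsetP=> y; rewrite !inE => /andP[yb /existsP[x /andP[xA' rxy]]].
      by apply/existsP; exists x; rewrite xA' /= rxy.
    rewrite (cardsD1 b (N A')) in lt; apply: leq_trans (subset_leq_card sub).
    by move: lt; case: (b \in _) => /=; rewrite ?add1n ?add0n // => /ltnW.
  have gb x : x \in A -> x != a -> r x (g x) && (g x != b).
    by move=> xA xa; apply: gr; rewrite !inE xa.
  exists (fun x => if x == a then b else g x); split.
    move=> x xA; case: eqP => [->//|/eqP xa].
    by case/andP: (gb x xA xa).
  move=> x y xA yA; case: eqP => [->|/eqP xa]; case: eqP => [->//|/eqP ya].
  + by move=> e; have := gb y yA ya; rewrite -e eqxx andbF.
  + by move=> e; have := gb x xA xa; rewrite e eqxx andbF.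
  + by apply: ginj; rewrite !inE ?xa ?ya.
Qed.

(** * Path covers and stability numbers *)

Section Covers.

Variables (T : finType) (D : rel T).
Hypothesis D_irr : irreflexive D.

Local Notation adj := (adjacent D).

Definition transitive_triangle_free : Prop :=
  forall a b c, D a b -> D b c -> D a c -> [|| D b a, D c b | D c a].

Definition clique (K : {set T}) : Prop := {in K &, forall x y, x != y -> adj x y}.

Definition stableb (S : {set T}) := [forall x in S, forall y in S, ~~ adj x y].

Definition alpha (W : {set T}) :=
  \max_(S : {set T} | (S \subset W) && stableb S) #|S|.

Definition max_stable (W S : {set T}) := [&& S \subset W, stableb S & #|S| == alpha W].

(* F is the vertex set of a path that starts or ends at s. *)
Definition rooted (F : {set T}) (s : T) : Prop :=
  exists l, [/\ uniq l, l =i F, sorted D l & starts_or_ends s l].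

(* h v is the vertex of S on the path through v. *)
Definition coverable (W S : {set T}) : Prop :=
  exists h : T -> T, {in W, forall v, h v \in S} /\
    {in S, forall s, rooted [set v in W | h v == s] s}.

Definition BEon (W : {set T}) : Prop := forall S, max_stable W S -> coverable W S.

Lemma adjC x y : adj x y = adj y x.
Proof. by rewrite /adjacent /= orbC. Qed.

Lemma adjxx x : adj x x = false.
Proof. by rewrite /adjacent /= D_irr. Qed.

Lemma stablebP S : reflect (stable D S) (stableb S).
Proof.
apply: (iffP forall_inP) => [st x y xS yS|st x xS]; first exact: (forall_inP (st x xS)).
by apply/forall_inP=> y yS; apply: st.
Qed.

Lemma stableW (S S' : {set T}) : S' \subset S -> stable D S -> stable D S'.
Proof. by move=> sS st x y /(subsetP sS) xS /(subsetP sS) yS; apply: st. Qed.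

Lemma alpha_ge (W S : {set T}) : S \subset W -> stable D S -> #|S| <= alpha W.
Proof.
by move=> sS /stablebP st; apply: (@leq_bigmax_cond _ _ (fun S : {set T} => #|S|)); rewrite sS.
Qed.

Lemma alpha_le (W : {set T}) n :
  (forall S : {set T}, S \subset W -> stable D S -> #|S| <= n) -> alpha W <= n.
Proof. by move=> h; apply/bigmax_leqP => S /andP[sS /stablebP st]; apply: h. Qed.

Lemma alpha_ex W : exists S, max_stable W S.
Proof.
have [|S /andP[sS st] e] := @eq_bigmax_cond {set T}
    [pred S : {set T} | (S \subset W) && stableb S] (fun S : {set T} => #|S|).
  apply/card_gt0P; exists set0; rewrite !inE sub0set /=.
  by apply/stablebP=> x y; rewrite inE.
by exists S; rewrite /max_stable sS st /= /alpha -e eqxx.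
Qed.

Lemma alphaS (W W' : {set T}) : W \subset W' -> alpha W <= alpha W'.
Proof. by move=> sW; apply: alpha_le => S sS; apply: alpha_ge; apply: subset_trans sW. Qed.

Lemma stable_clique_eq (S K : {set T}) x y : stable D S -> clique K ->
  x \in S -> y \in S -> x \in K -> y \in K -> x = y.
Proof.
move=> st cl xS yS xK yK; apply/eqP; apply: contraT => xy.
by have := st x y xS yS; rewrite cl.
Qed.

Lemma alpha_clique K : clique K -> alpha K <= 1.
Proof.
move=> cl; apply: alpha_le => S sS st.
by apply/card_le1_eqP => x y xS yS; apply: (stable_clique_eq st cl); rewrite ?(subsetP sS).
Qed.

Lemma coverableU (W1 W2 S1 S2 : {set T}) : [disjoint W1 & W2] ->
  S1 \subset W1 -> S2 \subset W2 ->
  coverable W1 S1 -> coverable W2 S2 -> coverable (W1 :|: W2) (S1 :|: S2).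
Proof.
move=> dW sS1 sS2 [h1 [h1S r1]] [h2 [h2S r2]].
have W21 v : v \in W2 -> v \in W1 = false by move=> vW; apply: (disjointFl dW).
exists (fun v => if v \in W1 then h1 v else h2 v); split.
  move=> v; rewrite !inE; case: ifP => [vW1 _|vW1 /= vW2]; first by rewrite h1S.
  by rewrite h2S ?orbT.
move=> s; rewrite inE => /orP[sS|sS].
  have -> : [set v in W1 :|: W2 | (if v \in W1 then h1 v else h2 v) == s]
      = [set v in W1 | h1 v == s].
    apply/setP=> v; rewrite !inE; case: ifP => //= vW1; apply/negP=> /andP[vW2 /eqP e].
    have := subsetP sS2 _ (h2S v vW2); rewrite e => /W21.
    by rewrite (subsetP sS1).
  exact: r1.
have -> : [set v in W1 :|: W2 | (if v \in W1 then h1 v else h2 v) == s]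
    = [set v in W2 | h2 v == s].
  apply/setP=> v; rewrite !inE; case: ifP => //= vW1; rewrite (disjointFr dW) //=.
  apply/negP=> /eqP e; have := subsetP sS1 _ (h1S v vW1); rewrite e.
  by rewrite (W21 s) // (subsetP sS2).
exact: r2.
Qed.

(** When the stability number is additive over a partition, a maximum stable set restricts to
    maximum stable sets of both sides, and the two covers are put side by side. *)
Lemma additive_BE (W : {set T}) : BEon W -> BEon (~: W) ->
  alpha W + alpha (~: W) <= alpha setT -> BEon setT.
Proof.
move=> B1 B2 le S /and3P[_ /stablebP st /eqP cS].
have s1 : stable D (S :&: W) by apply: stableW st; apply: subsetIl.
have s2 : stable D (S :&: ~: W) by apply: stableW st; apply: subsetIl.
have a1 := alpha_ge (subsetIr S W) s1.
have a2 := alpha_ge (subsetIr S (~: W)) s2.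
have e : #|S| = #|S :&: W| + #|S :&: ~: W|.
  by rewrite -setDE cardsID.
have -> : S = (S :&: W) :|: (S :&: ~: W) by rewrite -setIUr setUCr setIT.
rewrite -[X in coverable X _](setUCr W).
apply: coverableU; rewrite ?subsetIr //; first by rewrite disjoints_subset setCK.
  by apply: B1; apply/and3P; split; [exact: subsetIr|exact/stablebP|apply/eqP; lia].
by apply: B2; apply/and3P; split; [exact: subsetIr|exact/stablebP|apply/eqP; lia].
Qed.

Lemma sorted_cat_all (l1 l2 : seq T) x0 : sorted D l1 -> sorted D l2 ->
  {in l1, forall x, D x (head x0 l2)} -> sorted D (l1 ++ l2).
Proof.
case: l1 => // a l1 /=; rewrite cat_path => -> s2 h /=.
case: l2 s2 h => //= b l2 -> h; rewrite andbT; exact: h (mem_last _ _).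
Qed.

End Covers.

(** * Hamiltonian paths of cliques with a prescribed end *)

Section Hamiltonian.

Variables (T : finType).

(** [u] goes right after the last vertex with an edge to [u]; the next vertex has no edge to [u],
    hence receives one from it. The start [v] is never displaced. *)
Lemma path_insert (r : rel T) v p u : path r v p -> has (r ^~ u) (v :: p) ->
    {in v :: p, forall y, r y u || r u y} ->
  exists2 p', path r v p' & perm_eq p' (u :: p).
Proof.
elim: p v => [|b p IHp] v /=; first by rewrite orbF => _ vu _; exists [:: u]; rewrite //= vu.
move=> /andP[vb pb] hs all_adj.
have [hb|nb] := boolP (has (r ^~ u) (b :: p)).
  have [|p' pp' pe] := IHp b pb hb.
    by move=> y yp; apply: all_adj; rewrite inE yp orbT.
  exists (b :: p'); rewrite /= ?vb //.
  by rewrite -(perm_cons b) in pe; apply: perm_trans pe _; apply/permP=> a /=; rewrite addnCA.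
move: hs nb => /=; have := all_adj b ltac:(by rewrite !inE eqxx orbT).
case: (r b u) => //= ub; case: (has _ _) => //=; rewrite orbF => vu _.
by exists (u :: b :: p); rewrite //= vu ub.
Qed.

(** By [path_insert], a path that cannot be enlarged sends no edge to the vertices it misses. The
    relation is arbitrary, so that the reverse of [D] yields paths ending at [v]. *)
Lemma maximal_path (r : rel T) (K : {set T}) v : v \in K ->
    {in K &, forall x y, x != y -> r x y || r y x} ->
  exists p, [/\ path r v p, uniq (v :: p), {subset v :: p <= K} &
     {in v :: p, forall x, {in K, forall u, u \notin v :: p -> ~~ r x u}}].
Proof.
move=> vK cl.
suff H n p : #|K| - size p <= n -> path r v p -> uniq (v :: p) -> {subset v :: p <= K} ->
    exists p, [/\ path r v p, uniq (v :: p), {subset v :: p <= K} &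
     {in v :: p, forall x, {in K, forall u, u \notin v :: p -> ~~ r x u}}].
  by apply: (H _ [::] (leqnn _)) => // x; rewrite inE => /eqP->.
elim: n p => [|n IHn] p le pp up sp.
  exists p; split=> // x _ u uK /negP[].
  suff /subset_cardP : #|v :: p| = #|K| by move=> /(_ ltac:(exact/subsetP)) ->.
  by apply/eqP; rewrite eqn_leq subset_leq_card; [rewrite (card_uniqP up) /=; lia|exact/subsetP].
have [/existsP[u /and3P[uK up' hs]]|] :=
    boolP [exists u, [&& u \in K, u \notin v :: p & has (r ^~ u) (v :: p)]]; last first.
  rewrite negb_exists => /forallP nex; exists p; split=> // x xp u uK nu.
  by apply: contra (nex u) => xu; apply/and3P; split=> //; apply/hasP; exists x.
have [|p' pp' pe] := path_insert pp hs.
  by move=> y yp; apply: cl; [exact: sp|by []|apply: contraNneq up' => <-].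
have pe' : perm_eq (v :: p') (u :: v :: p).
  apply: (@perm_trans _ (v :: u :: p)); first by rewrite perm_cons.
  by apply/permP=> a /=; rewrite addnCA.
apply: (IHn p') => //.
- by rewrite (perm_size pe) /= subnS -subn1 leq_subLR add1n.
- by rewrite (perm_uniq pe') /= up'; move: up => /= ->.
- by move=> x; rewrite (perm_mem pe') inE => /orP[/eqP->|/sp].
Qed.

End Hamiltonian.

(** * Clique cutsets and matchings into a maximum stable set *)

Section CliqueCovers.

Variables (T : finType) (D : rel T).
Hypothesis D_irr : irreflexive D.
Hypothesis D_tt : transitive_triangle_free D.

Local Notation adj := (adjacent D).

(** If a maximal path from [v] misses [a] and a maximal path to [v] misses [b], then [D a v] and
    [D v b] hold without their reverses. As [b] lies on the first path it has no edge to [a], so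
    [D a b] holds, and a, v, b violate [D_tt]. *)
Lemma rooted_clique (K : {set T}) v : clique D K -> v \in K -> rooted D K v.
Proof.
move=> cl vK.
have [p1 [pp1 up1 sp1 mp1]] := maximal_path vK cl.
have [|p2 [pp2 up2 sp2 mp2]] := @maximal_path _ (fun x y => D y x) K v vK.
  by move=> x y xK yK xy; rewrite orbC; apply: cl.
have full p (x0 : T) : {subset v :: p <= K} -> ~~ [exists a in K, a \notin v :: p] -> v :: p =i K.
  move=> sp nex x; apply/idP/idP => [/sp //|xK].
  by apply: contraNT nex => nx; apply/existsP; exists x; rewrite xK.
have [/existsP[a /andP[aK ap]]|/(full _ v sp1) e1] := boolP [exists a in K, a \notin v :: p1]; last first.
  by exists (v :: p1); split=> //; left; exists p1.
have [/existsP[b /andP[bK bp]]|/(full _ v sp2) e2] := boolP [exists b in K, b \notin v :: p2]; last first.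
  exists (rev (v :: p2)); split; first by rewrite rev_uniq.
  - by move=> x; rewrite mem_rev.
  - by rewrite rev_sorted.
  - by right; exists (rev p2); rewrite rev_cons.
have vp1 : v \in v :: p1 by rewrite mem_head.
have vp2 : v \in v :: p2 by rewrite mem_head.
have nva := mp1 v vp1 a aK ap; have nbv := mp2 v vp2 b bK bp.
have av : D a v.
  have := cl a v aK vK ltac:(by apply: contraNneq ap => ->).
  by rewrite /adjacent /= (negPf nva) orbF.
have vb : D v b.
  have := cl v b vK bK ltac:(by apply: contraNneq bp => <-).
  by rewrite /adjacent /= (negPf nbv) orbF.
have bp1 : b \in v :: p1 by apply: contraT => nb; have := mp1 v vp1 b bK nb; rewrite vb.
have nba := mp1 b bp1 a aK ap.
have ab : D a b.
  have := cl a b aK bK ltac:(by apply: contraNneq ap => ->).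
  by rewrite /adjacent /= (negPf nba) orbF.
by have := D_tt av vb ab; rewrite (negPf nva) (negPf nbv) (negPf nba).
Qed.

Lemma eq_rooted (F F' : {set T}) s : F = F' -> rooted D F s -> rooted D F' s.
Proof. by move=> ->. Qed.

Lemma rooted_pair (F : {set T}) s : s \in F ->
    {in F, forall v, v = s \/ adj v s} ->
    {in F &, forall v w, v != s -> w != s -> v = w} -> rooted D F s.
Proof.
move=> sF h1 h2; apply: rooted_clique sF => x y xF yF xy.
have [ex|nx] := eqVneq x s.
  by rewrite ex; have [ey|] := h1 y yF; [rewrite ex ey eqxx in xy|rewrite adjC].
have [ey|ny] := eqVneq y s; first by rewrite ey; have [ex|//] := h1 x xF; rewrite ex eqxx in nx.
by rewrite (h2 x y) ?eqxx // in xy.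
Qed.

Lemma clique_BE : clique D setT -> BEon D setT.
Proof.
move=> cl S /and3P[_ /stablebP st /eqP cS].
have [e|[s sS]] := set_0Vmem S.
  exists id; split=> [v _|s]; last by rewrite e inE.
  have st1 : stable D [set v] by move=> x y; rewrite !inE => /eqP-> /eqP->; rewrite adjxx.
  by have := alpha_ge (subsetT _) st1; rewrite -cS e cards1 cards0.
exists (fun=> s); split=> // s' s'S.
rewrite (stable_clique_eq st cl s'S sS) ?inE //.
by apply: (@eq_rooted setT); [apply/setP=> x; rewrite !inE eqxx|apply: rooted_clique; rewrite ?inE].
Qed.

Lemma alphaU (W1 W2 : {set T}) : alpha D (W1 :|: W2) <= alpha D W1 + alpha D W2.
Proof.
apply: alpha_le => S sS st.
have e : S = (S :&: W1) :|: (S :&: W2) by rewrite -setIUr; apply/esym/setIidPl.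
rewrite e; apply: leq_trans (leq_card_setU _ _).1 _.
by apply: leq_add; apply: alpha_ge; rewrite ?subsetIr //; apply: stableW st; apply: subsetIl.
Qed.

Lemma alpha_nonadj (W1 W2 : {set T}) : [disjoint W1 & W2] ->
    {in W1 & W2, forall x y, ~~ adj x y} ->
  alpha D W1 + alpha D W2 <= alpha D (W1 :|: W2).
Proof.
move=> dW na.
have [S1 /and3P[s1 /stablebP st1 /eqP <-]] := alpha_ex D W1.
have [S2 /and3P[s2 /stablebP st2 /eqP <-]] := alpha_ex D W2.
have -> : #|S1| + #|S2| = #|S1 :|: S2|.
  rewrite cardsU disjoint_setI0 ?cards0 ?subn0 //.
  exact: disjointWl s1 (disjointWr s2 dW).
apply: alpha_ge; first exact: setUSS.
move=> x y; rewrite !inE => /orP[xS|xS] /orP[yS|yS]; [exact: st1| |rewrite adjC|exact: st2];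
  by apply: na; rewrite ?(subsetP s1) ?(subsetP s2).
Qed.

(* Split K according to whether x in K raises the stability number of M; the
   elements that do not join M, the others join the rest. *)
Lemma clique_cutset_BE (K M : {set T}) :
    (forall W : {set T}, W \proper setT -> BEon D W) ->
    clique D K -> M != set0 -> [disjoint K & M] -> K :|: M != setT ->
    (forall x y, x \in M -> y \notin K :|: M -> ~~ adj x y) -> BEon D setT.
Proof.
move=> IH clK M0 dKM nT na.
set M2 := ~: (K :|: M).
have M20 : M2 != set0 by apply: contraNneq nT => e; rewrite -[K :|: M]setCK -/M2 e setC0.
have dM : [disjoint M & M2] by rewrite disjoints_subset setCK subsetUr.
have dK2 : [disjoint K & M2] by rewrite disjoints_subset setCK subsetUl.
have naM : {in M & M2, forall x y, ~~ adj x y} by move=> x y xM; rewrite inE; apply: na.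
have leM : alpha D M + alpha D M2 <= alpha D (M :|: M2) by apply: alpha_nonadj.
have prW (W : {set T}) (x : T) : x \notin W -> W \proper setT.
  by move=> xW; rewrite properT; apply: contraNneq xW => ->.
have add (W : {set T}) (x y : T) : x \in W -> y \notin W ->
    alpha D W + alpha D (~: W) <= alpha D setT -> BEon D setT.
  move=> xW yW; apply: additive_BE; apply: IH; first exact: prW yW.
  by apply: (prW _ x); rewrite inE xW.
have [m mM] := set0Pn _ M0; have [m2 m2M] := set0Pn _ M20.
pose good (N : {set T}) x := alpha D (x |: N) == (alpha D N).+1.
have goodP (N : {set T}) x : alpha D (x |: N) <= (alpha D N).+1.
  apply: leq_trans (alphaU _ _) _; rewrite -add1n leq_add2r; apply: alpha_clique.
  by move=> a b; rewrite !inE => /eqP-> /eqP->; rewrite eqxx.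
have ngood (N : {set T}) x : ~~ good N x -> alpha D (x |: N) <= alpha D N.
  by move=> ng; have := goodP N x; rewrite leq_eqVlt ltnS => /orP[/eqP e|//]; rewrite /good e eqxx in ng.
have bound (N K' : {set T}) : K' \subset K -> {in K', forall x, ~~ good N x} ->
    alpha D (N :|: K') <= alpha D N.
  move=> sK ng; apply: alpha_le => S sS st.
  have [e|[x]] := set_0Vmem (S :&: K').
    apply: (alpha_ge _ st); apply/subsetP=> y yS; have := subsetP sS y yS; rewrite inE => /orP[//|yK].
    by have := in_set0 y; rewrite -e inE yS yK.
  rewrite inE => /andP[xS xK']; apply: leq_trans (ngood N x (ng x xK')).
  apply: (alpha_ge _ st); apply/subsetP=> y yS; have := subsetP sS y yS; rewrite !inE => /orP[->|yK'].
    by rewrite orbT.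
  by rewrite (stable_clique_eq st clK yS xS) ?eqxx ?(subsetP sK).
(* If [x] raises both sides, maximum stable sets of [x |: M] and [x |: M2] both contain [x] and meet
   only there. Their union has one vertex more than the two stability numbers together, so [K]
   splits off additively. *)
have [/existsP[x /and3P[xK g1 g2]]|] := boolP [exists x, [&& x \in K, good M x & good M2 x]].
  have eC : ~: K = M :|: M2.
    apply/setP=> y; rewrite !inE; case yM : (y \in M) => /=; last by rewrite orbF.
    by rewrite (disjointFl dKM yM).
  apply: (add K x m xK); first by rewrite (disjointFl dKM mM).
  rewrite eC; apply: leq_trans (leq_add (alpha_clique clK) (alphaU M M2)) _.
  have [S1 /and3P[s1 /stablebP st1 /eqP e1]] := alpha_ex D (x |: M).
  have [S2 /and3P[s2 /stablebP st2 /eqP e2]] := alpha_ex D (x |: M2).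
  have xS (N S : {set T}) : S \subset x |: N -> stable D S -> #|S| = alpha D (x |: N) ->
      good N x -> x \in S.
    move=> sS st e /eqP g; apply: contraT => nx.
    have sSN : S \subset N.
      by apply/subsetP=> y yS; have := subsetP sS y yS; rewrite !inE => /orP[/eqP yx|//]; rewrite -yx yS in nx.
    by have := alpha_ge sSN st; rewrite e g ltnn.
  have x1 := xS _ _ s1 st1 e1 g1; have x2 := xS _ _ s2 st2 e2 g2.
  have sub1 y : y \in S1 -> y != x -> y \in M.
    by move=> /(subsetP s1); rewrite !inE => /orP[->|].
  have sub2 y : y \in S2 -> y != x -> y \in M2.
    by move=> /(subsetP s2); rewrite in_setU1 => /orP[->|].
  have st : stable D (S1 :|: S2).
    move=> y z; rewrite !inE => /orP[yS|yS] /orP[zS|zS]; [exact: st1| | |exact: st2].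
      have [->|yx] := eqVneq y x; first exact: st2.
      have [->|zx] := eqVneq z x; first exact: st1.
      by apply: naM; [apply: sub1|apply: sub2].
    have [->|yx] := eqVneq y x; first exact: st1.
    have [->|zx] := eqVneq z x; first exact: st2.
    by rewrite adjC; apply: naM; [apply: sub1|apply: sub2].
  have := alpha_ge (subsetT _) st; rewrite cardsU.
  have -> : S1 :&: S2 = [set x].
    apply/setP=> y; rewrite !inE; have [->|yx] := eqVneq y x; first by rewrite x1 x2.
    by apply/negP=> /andP[/sub1/(_ yx) yM /sub2/(_ yx)]; rewrite (disjointFr dM).
  rewrite cards1 e1 e2 (eqP g1) (eqP g2) addSn addnS subn1 /= => le.
  by rewrite add1n.
rewrite negb_exists => /forallP ng.
pose K1 := [set x in K | ~~ good M x].
have eC : ~: (M :|: K1) = M2 :|: (K :\: K1).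
  apply/setP=> y; rewrite !inE; case yM : (y \in M) => /=.
    by rewrite orbT /= (disjointFl dKM yM) andbF.
  by case: (y \in K) => //=; rewrite ?andbT ?orbF.
apply: (add (M :|: K1) m m2); first by rewrite inE mM.
  by rewrite !inE (disjointFl dM m2M) (disjointFl dK2 m2M).
rewrite eC; apply: leq_trans (leq_add (bound _ _ _ _) (bound _ _ _ _)) _.
- by apply/subsetP=> x; rewrite inE => /andP[].
- by move=> x; rewrite inE => /andP[].
- exact: subsetDl.
- by move=> x; rewrite !inE => /andP[+ xK]; have := ng x; rewrite xK /=; case: (good M x).
- by apply: leq_trans leM (alphaS _ (subsetT _)).
Qed.

Definition bipartite (E : {set T}) : Prop :=
  exists col : T -> bool, {in E &, forall x y, adj x y -> col x != col y}.

Definition stable_nbrs (S A : {set T}) := [set y in S | [exists x in A, adj x y]].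

Section MaxStable.

Variable S : {set T}.
Hypothesis S_max : max_stable D setT S.

Lemma S_stable : stable D S.
Proof. by case/and3P: S_max => _ /stablebP. Qed.

(** Exchange: replacing the neighbours of [A] in [S] by [A] gives a stable set, which cannot be
    larger than [S]. *)
Lemma stable_nbr (A : {set T}) : stable D A -> [disjoint A & S] -> #|A| <= #|stable_nbrs S A|.
Proof.
move=> stA dA; have /and3P[_ _ /eqP cS] := S_max.
have st : stable D (A :|: (S :\: stable_nbrs S A)).
  move=> x y; rewrite !inE => /orP[xA|/andP[xN xS]] /orP[yA|/andP[yN yS]].
  - exact: stA.
  - apply: contra yN => xy; rewrite yS /=; apply/existsP; exists x; by rewrite xA.
  - apply: contra xN => xy; rewrite xS /=; apply/existsP; exists y; by rewrite yA adjC.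
  - exact: S_stable.
have := alpha_ge (subsetT _) st; rewrite -cS cardsU cardsD.
have -> : A :&: (S :\: stable_nbrs S A) = set0.
  by apply/disjoint_setI0; apply: disjointWr dA; apply: subsetDl.
have -> : S :&: stable_nbrs S A = stable_nbrs S A by apply/setIidPr/subsetP=> x; rewrite inE => /andP[].
have : #|stable_nbrs S A| <= #|S| by apply: subset_leq_card; apply/subsetP=> x; rewrite inE => /andP[].
by rewrite cards0; lia.
Qed.

(** [stable_nbr] applies to each colour class of [A]. A vertex of [S] adjacent to both classes lies
    outside [E], and the term [#|S :\: E|] pays for counting it twice. *)
Lemma bip_nbr (E A : {set T}) : bipartite E -> A \subset E -> [disjoint A & S] ->
  #|A| <= #|stable_nbrs S A| + #|S :\: E|.
Proof.
move=> [col colP] sA dA.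
pose Ac b := [set x in A | col x == b].
have Ac_sub b : Ac b \subset A by apply/subsetP=> x; rewrite inE => /andP[].
have leA b : #|Ac b| <= #|stable_nbrs S (Ac b)|.
  apply: stable_nbr; last by apply: disjointWl dA.
  move=> x y; rewrite !inE => /andP[xA /eqP cx] /andP[yA /eqP cy]; apply/negP=> xy.
  by have := colP x y (subsetP sA _ xA) (subsetP sA _ yA) xy; rewrite cx cy eqxx.
have cA : #|A| = #|Ac true| + #|Ac false|.
  rewrite -(cardsID [set x | col x] A); congr (_ + _); apply: eq_card => x; rewrite !inE.
    by rewrite eqb_id.
  by rewrite eqbF_neg andbC.
have sub : stable_nbrs S (Ac true) :|: stable_nbrs S (Ac false) \subset stable_nbrs S A.
  apply/subsetP=> y; rewrite !inE => /orP[] /andP[-> /existsP[x /andP[xA xy]]] /=;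
  by apply/existsP; exists x; rewrite xy andbT; apply: (subsetP (Ac_sub _)) xA.
have subI : stable_nbrs S (Ac true) :&: stable_nbrs S (Ac false) \subset S :\: E.
  apply/subsetP=> y; rewrite !inE => /andP[/andP[yS /existsP[x /andP[]]]].
  rewrite inE => /andP[xA /eqP cx] xy /andP[_ /existsP[x' /andP[]]].
  rewrite inE => /andP[xA' /eqP cx'] xy'; rewrite yS andbT; apply/negP=> yE.
  have := colP x y (subsetP sA _ xA) yE xy; have := colP x' y (subsetP sA _ xA') yE xy'.
  by rewrite cx cx'; case: (col y).
have := subset_leq_card sub; have := subset_leq_card subI; rewrite cardsU.
have := leA true; have := leA false.
have := subset_leq_card (subsetIl (stable_nbrs S (Ac true)) (stable_nbrs S (Ac false))).
by rewrite cA; lia.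
Qed.

Lemma bip_matching (E : {set T}) : bipartite E -> S \subset E ->
  exists f : T -> T, {in E :\: S, forall a, f a \in S /\ adj a (f a)} /\
    {in E :\: S &, injective f}.
Proof.
move=> bE sE; pose r := [rel a s | (s \in S) && adj a s].
have [|f [fr finj]] := @hall T r (E :\: S).
  move=> A sA.
  have -> : [set y | [exists x in A, r x y]] = stable_nbrs S A.
    apply/setP=> y; rewrite !inE; apply/existsP/andP=> [[x /and3P[xA yS xy]]|[yS /existsP[x /andP[xA xy]]]].
      by split=> //; apply/existsP; exists x; rewrite xA.
    by exists x; rewrite xA /= yS.
  have := @bip_nbr E A bE (subset_trans sA (subsetDl _ _)).
  have -> : S :\: E = set0 by apply/eqP; rewrite setD_eq0.
  rewrite cards0 addn0; apply; apply: disjointWl sA _.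
  by rewrite disjoints_subset setDE subsetIr.
by exists f; split=> // a aE; have /andP[] := fr a aE.
Qed.

End MaxStable.

End CliqueCovers.

(** * Covers built from matchings *)

Section DirectCovers.

Variables (T : finType) (D : rel T).
Hypothesis D_tt : transitive_triangle_free D.

Local Notation adj := (adjacent D).

Lemma bip_BE : bipartite D setT -> BEon D setT.
Proof.
move=> bT S S_max; have [f [fS finj]] := bip_matching S_max bT (subsetT S).
have fP v : v \notin S -> f v \in S /\ adj v (f v) by move=> vS; apply: fS; rewrite !inE vS.
exists (fun v => if v \in S then v else f v); split.
  by move=> v _; case: ifP => // /negbT /fP[].
move=> s sS; apply: (rooted_pair D_tt).
- by rewrite !inE sS eqxx.
- move=> v; rewrite !inE /=; case: ifP => [_ /eqP->|/negbT vS /eqP<-]; first by left.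
  by right; have [] := fP v vS.
- move=> v w; rewrite !inE /=; case: ifP => [_ /eqP->|/negbT vS /eqP e]; first by rewrite eqxx.
  case: ifP => [_ /eqP->|/negbT wS /eqP e' _ _]; first by rewrite eqxx.
  by apply: finj; rewrite ?inE ?vS ?wS // e.
Qed.

(* The vertices of K which are not in S are all inserted at one place of a
   matching of the remaining vertices into S. *)
Lemma chain_BE (K : {set T}) : clique D K ->
    (forall k, k \in K -> bipartite D (~: (K :\ k))) ->
    (exists2 k, k \in K & forall s, s \notin K -> adj k s -> rooted D (s |: K) s) ->
    (forall k0, k0 \in K ->
       rooted D K k0 /\ (forall a, a \notin K -> adj a k0 -> rooted D (a |: K) k0)
       \/ exists t, [/\ t \notin K, adj t k0, rooted D (t |: K) k0 &
         forall s, s \notin K -> adj t s -> rooted D (s |: (t |: (K :\ k0))) s]) ->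
  BEon D setT.
Proof.
move=> clK hb [k kK h0] h1 S S_max.
have st := S_stable S_max.
(* If [S] misses [K], the vertex [k] stays in the bipartite graph and is matched to [f k]; all of
   [K] then joins the path of [f k]. *)
have [SK|[k0]] := set_0Vmem (S :&: K).
  have nSK v : v \in K -> v \notin S.
    by move=> vK; apply: contraT; rewrite negbK => vS; have := in_set0 v; rewrite -SK inE vS vK.
  have sSE : S \subset ~: (K :\ k).
    apply/subsetP=> v vS; rewrite !inE negb_and negbK; apply/orP; right.
    by apply: contraL vS; apply: nSK.
  have [f [fS finj]] := bip_matching S_max (hb k kK) sSE.
  have inE' v : v \notin S -> (v \notin K) || (v == k) -> v \in ~: (K :\ k) :\: S.
    by rewrite !inE negb_and negbK orbC => -> ->.
  have fP v : v \notin S -> (v \notin K) || (v == k) -> f v \in S /\ adj v (f v).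
    by move=> vS vK; apply: fS; apply: inE'.
  have kS := nSK k kK.
  have [fkS adjk] := fP k kS ltac:(by rewrite eqxx orbT).
  have fkK : f k \notin K by apply: contraL fkS; apply: nSK.
  exists (fun v => if v \in S then v else if v \in K then f k else f v); split.
    move=> v _; case: ifP => // /negbT vS; case: ifP => // /negbT vK.
    by have [] := fP v vS ltac:(by rewrite vK).
  move=> s sS; have [-> {s sS}|sk] := eqVneq s (f k).
    apply: eq_rooted (h0 _ fkK adjk); apply/setP=> v; rewrite !inE /=.
    case: ifP => vS.
      case vK: (v \in K) => //=; last by rewrite orbF.
      by have := nSK v vK; rewrite vS.
    case: ifP => vK; first by rewrite orbT eqxx.
    rewrite orbF; have -> : (v == f k) = false by apply: contraFF vS => /eqP->.
    apply/esym/negP=> /eqP e; have : v = k; last by move=> e'; rewrite e' kK in vK.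
    by apply: finj => //; apply: inE'; rewrite ?vS ?vK ?kS ?eqxx ?orbT.
  apply: (rooted_pair D_tt); first by rewrite !inE sS eqxx.
    move=> v; rewrite !inE /=; case: ifP => [_ /eqP->|/negbT vS]; first by left.
    case: ifP => [_ /eqP e|/negbT vK /eqP<-]; first by rewrite e eqxx in sk.
    by right; have [] := fP v vS ltac:(by rewrite vK).
  move=> v w; rewrite !inE /=; case: ifP => [_ /eqP->|/negbT vS]; first by rewrite eqxx.
  case: ifP => [_ /eqP e|/negbT vK /eqP e]; first by rewrite e eqxx in sk.
  case: ifP => [_ /eqP->|/negbT wS]; first by rewrite eqxx.
  case: ifP => [_ /eqP e'|/negbT wK /eqP e' _ _]; first by rewrite e' eqxx in sk.
  by apply: finj; rewrite ?e //; apply: inE'; rewrite ?vK ?wK.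
rewrite inE => /andP[kS k0K].
have SK v : v \in S -> v \in K -> v = k0.
  by move=> vS vK; apply: (stable_clique_eq st clK).
have sSE : S \subset ~: (K :\ k0).
  apply/subsetP=> v vS; rewrite !inE negb_and negbK.
  by case vK: (v \in K); rewrite ?orbT // (SK v) ?eqxx.
have [f [fS finj]] := bip_matching S_max (hb k0 k0K) sSE.
have inE' v : v \notin S -> v \notin K -> v \in ~: (K :\ k0) :\: S.
  by rewrite !inE => -> /negPf->; rewrite andbF.
have fP v : v \notin S -> v \notin K -> f v \in S /\ adj v (f v).
  by move=> vS vK; apply: fS; apply: inE'.
have pair (s : T) (W : {set T}) : s \in S ->
    (forall v, (v \in W) = (v == s) || [&& v \notin S, v \notin K & f v == s]) ->
    rooted D W s.
  move=> sS eW; apply: (rooted_pair D_tt); first by rewrite eW eqxx.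
    move=> v; rewrite eW => /orP[/eqP->|/and3P[vS vK /eqP<-]]; [by left|right].
    by have [] := fP v vS vK.
  move=> v v'; rewrite !eW => /orP[->//|/and3P[vS vK /eqP e]].
  case/orP=> [->//|/and3P[v'S v'K /eqP e'] _ _].
  by apply: finj; rewrite ?e //; apply: inE'.
have nsplit (s : T) : s \in S -> s != k0 -> s \notin K.
  by move=> sS; apply: contraNN => sK; rewrite (SK s).
have base : rooted D [set v | (v \in K) || [&& v \notin S, v \notin K & f v == k0]] k0 ->
    coverable D setT S.
  move=> hr; exists (fun v => if v \in S then v else if v \in K then k0 else f v); split.
    move=> v _; case: ifP => // /negbT vS; case: ifP => // /negbT vK.
    by have [] := fP v vS vK.
  move=> s sS; have [-> {s sS}|sk] := eqVneq s k0.
    apply: eq_rooted hr; apply/setP=> v; rewrite !inE /=.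
    case vS: (v \in S) => /=; last by case: (v \in K) => //=; rewrite eqxx.
    rewrite orbF; apply/idP/eqP=> [vK|->//]; exact: SK.
  apply: pair (sS) _ => v; rewrite !inE /=.
  case vS: (v \in S) => /=; first by rewrite orbF.
  have -> : (v == s) = false by apply: contraFF vS => /eqP->.
  by case: (v \in K) => //=; rewrite eq_sym (negPf sk).
case: (h1 k0 k0K) => [[hK ha]|[t [tK tk ht hs]]].
  have [/existsP[a /and3P[aS aK /eqP fa]]|] :=
      boolP [exists a, [&& a \notin S, a \notin K & f a == k0]]; last first.
    rewrite negb_exists => /forallP nex; apply: base; apply: eq_rooted hK.
    by apply/setP=> v; rewrite !inE (negPf (nex v)) orbF.
  apply: base; apply: eq_rooted (ha a aK _); last by rewrite -fa; have [] := fP a aS aK.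
  apply/setP=> v; rewrite !inE orbC; congr (_ || _); apply/eqP/and3P=> [->|[vS vK /eqP fv]].
    by split=> //; apply/eqP.
  by apply: finj; rewrite ?fv //; apply: inE'.
(* Second alternative of [h1]. If [t] is matched to [k0], all of [K] joins that path; otherwise
   [K :\ k0] joins the path of [t], and [k0] keeps at most its own partner. *)
have tS : t \notin S by apply/negP=> tS; have := st t k0 tS kS; rewrite tk.
have [ftS adjt] := fP t tS tK.
have ft_inj v : v \notin S -> v \notin K -> f v = f t -> v = t.
  by move=> vS vK; apply: finj; apply: inE'.
have [ftk|ftk] := eqVneq (f t) k0.
  apply: base; apply: eq_rooted ht.
  apply/setP=> v; rewrite !inE orbC; congr (_ || _); apply/eqP/and3P=> [->|[vS vK /eqP fv]].
    by split=> //; apply/eqP.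
  by apply: ft_inj; rewrite ?fv.
have ftK := nsplit _ ftS ftk.
exists (fun v => if v \in S then v else if v \in K then f t else f v); split.
  move=> v _; case: ifP => // /negbT vS; case: ifP => // /negbT vK.
  by have [] := fP v vS vK.
move=> s sS; have [-> {s sS}|sk] := eqVneq s (f t).
  apply: eq_rooted (hs _ ftK adjt); apply/setP=> v; rewrite !inE /=.
  case vS: (v \in S) => /=.
    have -> : (v == t) = false by apply: contraTF vS => /eqP->.
    case: (v == f t) => //=; case vK: (v \in K) => /=; last by rewrite andbF.
    by rewrite (SK v) ?eqxx.
  have -> : (v == f t) = false by apply: contraFF vS => /eqP->.
  case vK: (v \in K) => /=.
    rewrite eqxx andbT; apply/orP; right; apply: contraFneq vS => ->; exact: kS.
  by rewrite andbF orbF; apply/eqP/eqP=> [->//|]; apply: ft_inj; rewrite ?vS ?vK.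
apply: pair (sS) _ => v; rewrite !inE /=.
case vS: (v \in S) => /=; first by rewrite orbF.
have -> : (v == s) = false by apply: contraFF vS => /eqP->.
by case: (v \in K) => //=; rewrite eq_sym (negPf sk).
Qed.

(* Each vertex of X is either matched into S or inserted in front of a vertex
   of Y; Hall's condition for this combines the two matchings given by the
   bipartite graphs outside X and outside Y. *)
Lemma two_level_cover (S X Y : {set T}) : max_stable D setT S ->
    [disjoint X & S] -> [disjoint Y & S] -> [disjoint X & Y] ->
    {in X & Y, forall x y, D x y} ->
    {in Y & S, forall y s, adj y s -> D y s} ->
    bipartite D (~: X) -> bipartite D (~: Y) -> coverable D setT S.
Proof.
move=> S_max dXS dYS dXY XY YS bX bY.
have sSX : S \subset ~: X by rewrite -disjoints_subset disjoint_sym.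
have sSY : S \subset ~: Y by rewrite -disjoints_subset disjoint_sym.
pose r := [rel a t | ((t \in S) && adj a t) || ((a \in X) && (t \in Y))].
have D0 (A B : {set T}) : A \subset B -> #|A :\: B| = 0.
  by rewrite -setD_eq0 => /eqP->; rewrite cards0.
have [|f [fr finj]] := @hall T r (~: S).
  move=> A sA; have dA : [disjoint A & S] by rewrite disjoints_subset.
  have [e|[a]] := set_0Vmem (A :&: X).
    have := bip_nbr S_max bX _ dA; rewrite (D0 S) // addn0 => le.
    apply: leq_trans (le _) _; first by rewrite -disjoints_subset -setI_eq0 e.
    apply: subset_leq_card; apply/subsetP=> y; rewrite !inE => /andP[yS /existsP[x /andP[xA xy]]].
    by apply/existsP; exists x; rewrite xA /= yS xy.
  rewrite inE => /andP[aA aX].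
  (* The vertex [a] of [X] makes all of [Y] available as targets, which pays for the part of [A] in
     [Y]; the rest of [A] is counted in the bipartite graph outside [Y]. *)
  have dAY : [disjoint A :\: Y & S] by apply: disjointWl dA; apply: subsetDl.
  have := bip_nbr S_max bY _ dAY; rewrite (D0 S) // addn0 setDE subsetIr => /(_ isT) le.
  have le2 : #|A| <= #|stable_nbrs D S (A :&: ~: Y)| + #|Y|.
    rewrite -(cardsID Y A) addnC setDE; apply: leq_add le _.
    exact: subset_leq_card (subsetIr _ _).
  apply: leq_trans le2 _.
  have dN : [disjoint stable_nbrs D S (A :&: ~: Y) & Y].
    rewrite disjoint_sym; apply: disjointWr dYS.
    by apply/subsetP=> x; rewrite inE => /andP[].
  have [/= le3 /esym] := leq_card_setU (stable_nbrs D S (A :&: ~: Y)) Y; rewrite dN => /esym/eqP <-.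
  apply: subset_leq_card; apply/subsetP=> y; rewrite !inE => /orP[/andP[yS /existsP[x /andP[]]]|yY].
    by rewrite !inE => /andP[xA _] xy; apply/existsP; exists x; rewrite xA /= yS xy.
  by apply/existsP; exists a; rewrite aA aX yY orbT.
have fP v : v \notin S -> f v \in S /\ adj v (f v) \/ v \in X /\ f v \in Y.
  move=> vS; have := fr v; rewrite inE vS => /(_ isT) /orP[] /andP[]; [by left|by right].
have f_inj v w : v \notin S -> w \notin S -> f v = f w -> v = w.
  by move=> vS wS; apply: finj; rewrite inE.
have YnS y : y \in Y -> y \notin S by move=> yY; rewrite (disjointFr dYS).
have fY y : y \in Y -> f y \in S /\ adj y (f y).
  move=> yY; have [//|[yX _]] := fP y (YnS y yY).
  by rewrite (disjointFr dXY yX) in yY.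
(* A target in [Y] is itself matched into [S], so two applications of [f] reach [S]; the longest
   possible path is x, y, s. *)
exists (fun v => if v \in S then v else if f v \in S then f v else f (f v)); split.
  move=> v _; case: ifP => // /negbT vS; case: ifP => // /negbT fvS.
  by case: (fP v vS) => [[fv]|[_ /fY[]//]]; rewrite fv in fvS.
move=> s sS; set F := [set v in _ | _].
have inF v : (v \in F) = (v == s) || (v \notin S) && ((f v == s) || (f v \notin S) && (f (f v) == s)).
  rewrite !inE /=; case vS: (v \in S) => /=; first by rewrite orbF.
  have -> : (v == s) = false by apply: contraFF vS => /eqP->.
  case fS: (f v \in S) => /=; first by rewrite orbF.
  by have -> : (f v == s) = false by apply: contraFF fS => /eqP->.
have [/existsP[y /and3P[yS /eqP fy /existsP[x /andP[xS /eqP fx]]]]|] :=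
    boolP [exists y, [&& y \notin S, f y == s & [exists x, (x \notin S) && (f x == y)]]].
  have [xX yY] : x \in X /\ y \in Y.
    by case: (fP x xS) => [[]|]; rewrite fx // (negPf yS).
  have [_ ys] := fY y yY; rewrite fy in ys.
  have nxs : x != s by apply: contraNneq xS => ->.
  have nys : y != s by apply: contraNneq yS => ->.
  have nxy : x != y by apply: contraTneq xX => ->; rewrite (disjointFl dXY yY).
  exists [:: x; y; s]; split.
  - by rewrite /= !inE negb_or nxy nxs nys.
  - move=> v; rewrite inF !inE; apply/or3P/orP=> [[/eqP->|/eqP->|->]|[->|/andP[vS]]].
    + by right; rewrite xS fx yS fy eqxx orbT.
    + by right; rewrite yS fy eqxx.
    + by left.
    + exact: Or33.
    + case/orP=> [/eqP e|/andP[fvS /eqP e]].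
        by apply: Or32; apply/eqP/f_inj; rewrite ?fy.
      have e' : f v = y by apply: f_inj; rewrite ?fy.
      by apply: Or31; apply/eqP/f_inj; rewrite ?fx.
  - by rewrite /= XY //= YS.
  - by right; exists [:: x; y].
rewrite negb_exists => /forallP nex.
have inF2 v : v \in F -> v = s \/ v \notin S /\ f v = s.
  rewrite inF => /orP[/eqP->|/andP[vS /orP[/eqP|/andP[fvS e]]]]; [by left|by right|].
  have := nex (f v); rewrite fvS e /= => /negP[].
  by apply/existsP; exists v; rewrite vS eqxx.
apply: (rooted_pair D_tt); first by rewrite inF eqxx.
  move=> v /inF2[->|[vS fv]]; [by left|right].
  case: (fP v vS) => [[_]|[_ /YnS]]; by rewrite fv // sS.
move=> v w /inF2[->|[vS fv]]; first by rewrite eqxx.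
move=> /inF2[->|[wS fw]] _; first by rewrite eqxx.
by move=> _; apply: f_inj; rewrite ?fv.
Qed.

End DirectCovers.

(** * Directed walks and bipartiteness *)

Section Walks.

Variables (T : finType).
Implicit Type r : rel T.

Fixpoint walk r n x y : bool :=
  if n is m.+1 then [exists u, walk r m x u && r u y] else x == y.

Lemma walkSr r n x u y : walk r n x u -> r u y -> walk r n.+1 x y.
Proof. by move=> xu uy; apply/existsP; exists u; apply/andP. Qed.

Lemma walk1 r x y : r x y -> walk r 1 x y.
Proof. by apply: walkSr; rewrite /= eqxx. Qed.

Lemma walkD r m n x y z : walk r m x y -> walk r n y z -> walk r (m + n) x z.
Proof.
move=> xy; elim: n z => [|n IHn] z; first by move=> /eqP<-; rewrite addn0.
by move=> /existsP[u /andP[yu uz]]; rewrite addnS; apply: walkSr uz; apply: IHn.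
Qed.

Lemma walkSl r n x u y : r x u -> walk r n u y -> walk r n.+1 x y.
Proof. by move=> xu uy; rewrite -add1n; apply: walkD uy; apply: walk1. Qed.

Lemma walkS_inv r n x y : walk r n.+1 x y -> exists2 u, r x u & walk r n u y.
Proof.
elim: n y => [|n IHn] y /existsP[u /andP[xu uy]].
  by exists y; rewrite /= ?eqxx // (eqP xu).
have [w xw wu] := IHn _ xu; exists w => //; exact: walkSr uy.
Qed.

Lemma walk_connect r n x y : walk r n x y -> connect r x y.
Proof.
elim: n y => [|n IHn] y; first by move=> /eqP->.
by move=> /existsP[u /andP[/IHn xu /connect1]]; apply: connect_trans.
Qed.

Lemma connect_walk r x y : connect r x y -> exists n, walk r n x y.
Proof.
move=> /connectP[p pp ->]; elim: p x pp => [|a p IHp] x /=; first by exists 0; rewrite /=.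
by move=> /andP[xa /IHp[n an]]; exists n.+1; apply: walkSl an.
Qed.

Lemma sub_walk r r' n x y : subrel r r' -> walk r n x y -> walk r' n x y.
Proof.
move=> s; elim: n y => [|n IHn] y //= /existsP[u /andP[/IHn xu /s uy]].
by apply/existsP; exists u; apply/andP.
Qed.

Lemma walk_fun r n x y : walk r n x y ->
  exists z : nat -> T, [/\ z 0 = x, z n = y & forall i, i < n -> r (z i) (z i.+1)].
Proof.
elim: n y => [|n IHn] y; first by move=> /eqP->; exists (fun=> y).
move=> /existsP[u /andP[/IHn[z [z0 zn zr]] uy]].
exists (fun i => if i <= n then z i else y); split=> //; first by rewrite ltnn.
move=> i; rewrite ltnS => le; rewrite le; case: (ltngtP i n) le => // [lt|->] _; first exact: zr.
by rewrite zn.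
Qed.

(** The periodic extension to all natural numbers removes wrap-around cases from index arguments. *)
Lemma closed_walk_fun r n x : 0 < n -> walk r n x x ->
  exists z : nat -> T, [/\ z 0 = x, forall i, r (z i) (z i.+1) & forall i, z (i + n) = z i].
Proof.
move=> n0 /walk_fun[z [z0 zn zr]]; exists (fun i => z (i %% n)); split.
- by rewrite mod0n.
- move=> i; have lt := ltn_pmod i n0; have := zr _ lt.
  have -> : i.+1 %% n = (i %% n).+1 %% n by rewrite -(addn1 i) -modnDml addn1.
  case: (ltngtP (i %% n).+1 n) lt => // [lt _|-> _].
    by rewrite [(i %% n).+1 %% n]modn_small.
  by rewrite modnn z0 zn.
- by move=> i; rewrite modnDr.
Qed.

Lemma fun_walk r (z : nat -> T) i m :
  (forall j, i <= j -> j < i + m -> r (z j) (z j.+1)) -> walk r m (z i) (z (i + m)).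
Proof.
elim: m => [|m IHm] h; first by rewrite addn0 /=.
rewrite addnS; apply: (walkSr (IHm _)); first by move=> j le lt; apply: h; lia.
by apply: h; lia.
Qed.

End Walks.

(** * A bipartiteness criterion *)

Section Criterion.

Variables (T : finType) (D : rel T).
Hypothesis D_irr : irreflexive D.
Hypothesis D_tt : transitive_triangle_free D.
Hypothesis D_alis : arc_locally_in_semicomplete D.

Local Notation adj := (adjacent D).

Lemma alis u v x y : D x u -> D u v -> D y v -> adj x y \/ x = y.
Proof. by move=> xu uv yv; apply: (D_alis uv). Qed.

Definition restr (E : {set T}) : rel T := [rel x y | [&& x \in E, y \in E & D x y]].

(** Take a shortest odd closed walk of the underlying graph. The hypotheses and [D_tt] exclude
    length three. For length at least five, two consecutive edges in one direction force a
    neighbouring edge into the same direction, since otherwise the defining condition yields a chord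
    that shortens the walk by two; the whole walk would then be directed. So directions alternate,
    which is impossible for odd length. *)
Lemma bip_criterion (E : {set T}) :
    (forall n x, odd n -> ~~ walk (restr E) n x x) ->
    (forall u w z, u \in E -> w \in E -> z \in E -> D u w -> D w u ->
       ~~ (D z u && D z w) && ~~ (D u z && D w z)) ->
  bipartite D E.
Proof.
move=> noodd notri.
pose r := [rel x y | [&& x \in E, y \in E & adj x y]].
have r_sym : symmetric r by move=> x y; rewrite /= adjC andbCA.
have tri a b c : a \in E -> b \in E -> c \in E -> adj a b -> adj b c -> adj c a -> False.
  move=> aE bE cE ab bc ca.
  have cyc x y z : x \in E -> y \in E -> z \in E -> ~~ [&& D x y, D y z & D z x].
    move=> xE yE zE; apply/negP=> /and3P[xy yz zx]; have := noodd 3 x isT.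
    suff -> : walk (restr E) 3 x x by [].
    by apply: (@walkSl _ _ _ _ y); last (apply: (@walkSl _ _ _ _ z); last apply: walk1);
      rewrite /restr /= ?xE ?yE ?zE.
  have ttf x y z : [&& D x y, D y z & D x z] ==> [|| D y x, D z y | D z x].
    by apply/implyP=> /and3P[xy yz]; apply: D_tt.
  have dg x y z : x \in E -> y \in E -> z \in E -> (D x y && D y x) ==>
      ~~ (D z x && D z y) && ~~ (D x z && D y z).
    by move=> xE yE zE; apply/implyP=> /andP[]; apply: notri.
  move: (cyc a b c aE bE cE) (cyc a c b aE cE bE).
  move: (dg a b c aE bE cE) (dg b c a bE cE aE) (dg c a b cE aE bE).
  move: (ttf a b c) (ttf b c a) (ttf c a b) (ttf a c b) (ttf c b a) (ttf b a c).
  move: ab bc ca; rewrite /adjacent /=.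
  by case: (D a b); case: (D b a); case: (D b c); case: (D c b); case: (D c a); case: (D a c).
have noodd_adj n : odd n -> forall x, ~~ walk r n x x.
  elim/ltn_ind: n => n IHn on x; apply/negP=> wx.
  have n0 : 0 < n by case: n on {IHn wx}.
  have [z [z0 zr zn]] := closed_walk_fun n0 wx.
  have zE i : z i \in E by case/and3P: (zr i).
  have za i : D (z i) (z i.+1) || D (z i.+1) (z i) by case/and3P: (zr i).
  have n1 : n != 1.
    by apply/eqP=> e; have := za 0; have := zn 0; rewrite e add0n => ->; rewrite D_irr.
  have n3 : n != 3.
    apply/eqP=> e; apply: (tri (z 0) (z 1) (z 2)); rewrite ?zE //; [exact: za|exact: za|].
    by have := za 2; have := zn 0; rewrite e add0n => ->.
  have n5 : 5 <= n.
    case: n on n1 n3 n0 {IHn wx zn} => [|[|[|[|[|n]]]]] //.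
  (* Such a chord closes the other [n - 3] edges to a walk of odd length [n - 2]; equality of the
     ends gives a closed walk of length three. *)
  have chord i : adj (z i) (z i.+3) \/ z i = z i.+3 -> False.
    case=> [zz|zz].
      have wk : walk r (n - 3) (z i.+3) (z i).
        have <- : z (i.+3 + (n - 3)) = z i by rewrite -(zn i); congr z; lia.
        by apply: fun_walk => j _ _; apply: zr.
      have lt : (n - 3).+1 < n by lia.
      have od : odd (n - 3).+1 by rewrite oddS oddB ?on //; lia.
      have := IHn _ lt od (z i.+3); rewrite (walkSr wk) //=.
      by rewrite !zE.
    have : walk r 3 (z i) (z (i + 3)) by apply: fun_walk => j _ _; apply: zr.
    by rewrite addn3 -zz (negPf (IHn 3 ltac:(lia) isT (z i))).
  have aa i : D (z i) (z i.+1) -> D (z i.+1) (z i.+2) -> D (z i.+2) (z i.+3).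
    move=> a1 a2; have := za i.+2; case: (D (z i.+2) _) => //= b3.
    by have := chord _ (alis a1 a2 b3).
  have bb i : D (z i.+3) (z i.+2) -> D (z i.+2) (z i.+1) -> D (z i.+1) (z i).
    move=> b3 b2; have := za i; case: (D (z i.+1) (z i)); rewrite ?orbT ?orbF // => a1.
    case: (chord i); rewrite adjC; have [] := alis b3 b2 a1; [by left|by right].
  have naa i : ~ (D (z i) (z i.+1) /\ D (z i.+1) (z i.+2)).
    move=> [a1 a2]; have al j : D (z (i + j)) (z (i + j).+1) && D (z (i + j).+1) (z (i + j).+2).
      elim: j => [|j /andP[h1 h2]]; first by rewrite addn0 a1.
      by rewrite addnS h2 (aa _ h1 h2).
    have := noodd n (z i) on; rewrite -{2}(zn i) fun_walk // => j le _.
    have := al (j - i); rewrite subnKC // => /andP[h _].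
    by rewrite /restr /= !zE.
  have nbb i : ~ (D (z i.+1) (z i) /\ D (z i.+2) (z i.+1)).
    move=> [b1 b2].
    have al j : j <= n -> D (z (i + n - j).+1) (z (i + n - j)) &&
        D (z (i + n - j).+2) (z (i + n - j).+1) && walk (restr E) j (z (i + n)) (z (i + n - j)).
      elim: j => [_|j IHj lt].
        by rewrite subn0 /= -addSn -addSn !zn b1 b2 eqxx.
      have /andP[/andP[h1 h2] h3] := IHj (ltnW lt).
      have e : i + n - j = (i + n - j.+1).+1 by lia.
      rewrite e in h1 h2 h3; have h0 := bb _ h2 h1.
      by rewrite h0 h1 (walkSr h3) // /restr /= !zE.
    have /andP[_] := al n (leqnn n); rewrite addnK zn.
    by apply/negP; apply: noodd.
  have alt i : D (z i.+1) (z i.+2) = ~~ D (z i) (z i.+1).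
    case a1: (D (z i) (z i.+1)).
      by apply/negP=> a2; apply: (naa i).
    have := za i; rewrite a1 /= => b1; have := za i.+1; case: (D (z i.+1) _) => //= b2.
    by case: (nbb i).
  have al i : D (z i) (z i.+1) = odd i (+) D (z 0) (z 1).
    by elim: i => [|i IHi] //; rewrite alt IHi /=; case: (odd i); case: (D _ _).
  have := al n; rewrite -[n.+1]add1n -[in z n](add0n n) !zn on.
  by case: (D _ _).
(* [p] is the bipartite double cover of [r]. Without odd closed walks, [(x, false)] and [(x, true)]
   are in different components, and the component of [(root r x, false)] defines the colours. *)
pose p := [rel a b : T * bool | r a.1 b.1 && (a.2 != b.2)].
have p_sym : symmetric p by move=> a b; congr (_ && _); [apply: r_sym|rewrite eq_sym].
have csym : connect_sym p := sym_connect_sym p_sym.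
have rsym : connect_sym r := sym_connect_sym r_sym.
have p_walk a b : connect p a b -> exists2 n, walk r n a.1 b.1 & odd n = (a.2 != b.2).
  move=> /connectP[l pl ->]; elim: l a pl => [|c l IHl] a /=.
    by exists 0; rewrite /= eqxx.
  move=> /andP[/andP[ac e] /IHl[n wn on]]; exists n.+1; first exact: walkSl wn.
  by rewrite oddS on; move: e; case: (a.2); case: (c.2); case: ((last c l).2).
have nop x : ~~ connect p (x, false) (x, true).
  by apply/negP=> /p_walk[n /= wn on]; have := noodd_adj n on x; rewrite wn.
have lift x y : connect r x y -> exists b, connect p (x, false) (y, b).
  move=> /connectP[l pl ->]; elim/last_ind: l pl => [|l c IHl] /=.
    by exists false; apply: connect0.
  rewrite rcons_path last_rcons => /andP[/IHl[b cb] rc]; exists (~~ b).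
  apply: connect_trans cb (connect1 _); rewrite /p /= in rc *.
  by rewrite rc; case: b.
pose col x := connect p (root r x, false) (x, true).
exists col => x y xE yE xy.
have rxy : r x y by rewrite /= xE yE.
have er : root r x = root r y by apply/eqP; rewrite root_connect //; apply: connect1.
have step b : connect p (x, b) (y, ~~ b).
  by apply: connect1; rewrite /p /= in rxy *; rewrite rxy; case: b.
rewrite /col -er; case cx: (connect p _ (x, true)).
  case cy: (connect p _ (y, true)) => //; have := nop y.
  have c1 : connect p (y, false) (root r x, false).
    by rewrite csym; apply: connect_trans cx (step true).
  by rewrite (connect_trans c1 cy).
have [b cb] := lift _ _ ltac:(by rewrite rsym; exact: connect_root r x).
case: b cb => cb; first by rewrite cb in cx.
by rewrite (connect_trans cb (step false)).
Qed.

End Criterion.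

(** * Obstructions to bipartiteness *)

Section Bad.

Variables (T : finType) (D : rel T).
Hypothesis D_irr : irreflexive D.
Hypothesis D_tt : transitive_triangle_free D.
Hypothesis D_alis : arc_locally_in_semicomplete D.

Local Notation adj := (adjacent D).
Let alis := alis D_alis.

Definition odd_at (x : T) : Prop := exists2 n, odd n & walk D n x x.

(* By bip_criterion, a set of vertices that are not bad is bipartite. *)
Definition bad (y : T) : Prop :=
  odd_at y \/ exists w z, [/\ D y w, D w y & D z y /\ D z w \/ D y z /\ D w z].

(** In terms of the condensation: the strong component of [y] is a source and contains a closed
    walk. *)
Definition initial (y : T) : Prop :=
  (exists2 p, D p y & connect D y p) /\
  (forall c p, connect D y c -> connect D c y -> D p c -> connect D y p).

Definition dominated (x u w : T) : Prop :=
  [/\ D x u, D x w, D u w, D w u & ~~ connect D u x].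

Definition pred_closed (P : {set T}) : Prop := forall a b, D a b -> b \in P -> a \in P.

Lemma pred_closed_connect (P : {set T}) x y :
  pred_closed P -> connect D x y -> y \in P -> x \in P.
Proof.
move=> Pp /connectP[p pp ->]; elim: p x pp => [|a p IHp] x //= /andP[xa pa] /(IHp _ pa).
exact: Pp.
Qed.

(** On the walk c', c1, c2, ..., c the vertex [p] dominates c2 by induction, hence is adjacent to
    c'; the edge cannot point back to [p]. Domination moves two steps at a time, whence the parity
    condition. *)
Lemma dominate_even p c n c' : D p c -> ~~ connect D c p -> walk D n c' c -> ~~ odd n ->
  connect D c c' -> D p c'.
Proof.
move=> pc ncp; elim/ltn_ind: n c' => -[|[|n]] IHn c' // wk on cc'.
  by rewrite -(eqP (wk : c' == c)) in pc.
have [c1 c'c1 wk1] := walkS_inv wk; have [c2 c1c2 wk2] := walkS_inv wk1.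
have cc2 : connect D c c2.
  by apply: connect_trans cc' _; apply: connect_trans (connect1 c'c1) (connect1 c1c2).
have pc2 : D p c2.
  by apply: (IHn n) => //; move: on; rewrite /= negbK.
have [/orP[c'p|//]|e] := alis c'c1 c1c2 pc2.
  by case/negP: ncp; apply: connect_trans cc' (connect1 c'p).
by rewrite e in cc'; case/negP: ncp.
Qed.

(** An odd closed walk through [y] corrects the parity in [dominate_even], so an outer in-neighbour
    of one vertex of the component dominates all of it. *)
Lemma odd_dominated y p c : odd_at y -> connect D y c -> connect D c y -> D p c ->
  ~~ connect D y p -> {in [pred c' | connect D y c' && connect D c' y], forall c', D p c'}.
Proof.
move=> [k ok wk] yc cy pc nyp c' /andP[yc' c'y].
have ncp : ~~ connect D c p by apply: contra nyp; apply: connect_trans.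
have [n1 w1] := connect_walk c'y; have [n2 w2] := connect_walk yc.
have cc' : connect D c c' := connect_trans cy yc'.
have [on|on] := boolP (odd (n1 + n2)).
  apply: (dominate_even pc ncp (walkD w1 (walkD wk w2))) cc'.
  by rewrite oddD oddD ok; move: on; rewrite oddD; case: (odd n1); case: (odd n2).
exact: (dominate_even pc ncp (walkD w1 w2)).
Qed.

Lemma odd_cases y : odd_at y ->
  initial y \/ exists x u w, [/\ dominated x u w, connect D u y & connect D y u].
Proof.
move=> oy; have [k ok wk] := oy.
case: k ok wk => // k ok /walkS_inv[y1 yy1 /walk_connect y1y].
have [/existsP[c /existsP[p /and4P[yc cy pc nyp]]]|] := boolP [exists c, exists p,
    [&& connect D y c, connect D c y, D p c & ~~ connect D y p]].
  right; exists p, y, y1.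
  have dom := odd_dominated oy yc cy pc nyp.
  have py : D p y by apply: dom; rewrite inE !connect0.
  have py1 : D p y1 by apply: dom; rewrite inE y1y connect1.
  split; rewrite ?connect0 //; split=> //.
  have := D_tt py yy1 py1 => /or3P[yp|//|y1p].
    by rewrite connect1 in nyp.
  by rewrite (connect_trans (connect1 yy1) (connect1 y1p)) in nyp.
move=> nex; left; split.
  have [p yp py] : exists2 p, connect D y p & D p y.
    case: oy => -[|m] om // /existsP[p /andP[/walk_connect yp py]]; by exists p.
  by exists p.
move=> c p yc cy pc; apply: contraNT nex => nyp.
by apply/existsP; exists c; apply/existsP; exists p; apply/and4P.
Qed.

(** If [y] reaches [z], returning directly or through [w] gives closed walks of both parities;
    otherwise [z] dominates the digon from outside its component. *)
Lemma digon_dominated_cases y w z : D y w -> D w y -> D z y -> D z w ->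
  initial y \/ exists x u w, [/\ dominated x u w, connect D u y & connect D y u].
Proof.
move=> yw wy zy zw; have [yz|nyz] := boolP (connect D y z); last first.
  by right; exists z, y, w; split.
have [n wk] := connect_walk yz; apply: odd_cases.
have [on|on] := boolP (odd n); last by exists n.+1; [rewrite oddS on|apply: walkSr zy].
by exists n.+2; [rewrite !oddS on|apply: walkSr wy; apply: walkSr zw].
Qed.

Lemma triangle_odd a b c : D a b -> D b c -> D c a -> odd_at a.
Proof. by move=> ab bc ca; exists 3 => //; apply: walkSl ab (walkSl bc (walk1 ca)). Qed.

(** The new case is a digon y, w dominating [z]. A further in-neighbour of [y] or [w] is adjacent to
    the other end too, which gives a dominated digon or a directed triangle. Without one, the digon
    is closed under in-neighbours, so [y] is initial. *)
Lemma bad_cases y : bad y ->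
  initial y \/ exists x u w, [/\ dominated x u w, connect D u y & connect D y u].
Proof.
case=> [|[w [z [yw wy [[zy zw]|[yz wz]]]]]]; first exact: odd_cases.
  exact: digon_dominated_cases yw wy zy zw.
have [/existsP[p /andP[py pw]]|] := boolP [exists p, D p y && (p != w)].
  have [/orP[pw'|wp]|e] := alis py yz wz; last by rewrite e eqxx in pw.
    exact: digon_dominated_cases yw wy py pw'.
  by apply: odd_cases; apply: triangle_odd yw wp py.
rewrite negb_exists => /forallP ny.
have [/existsP[p /andP[pw py]]|] := boolP [exists p, D p w && (p != y)].
  have [/orP[py'|yp]|e] := alis pw wz yz; last by rewrite e eqxx in py.
    by have := ny p; rewrite py' /= negbK => /eqP e; rewrite e D_irr in pw.
  by apply: odd_cases; apply: triangle_odd yp pw wy.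
rewrite negb_exists => /forallP nw.
have pcl : pred_closed [set y; w].
  move=> a b ab; rewrite !inE => /orP[/eqP e|/eqP e]; rewrite e in ab.
    by have := ny a; rewrite ab /= negbK => ->; rewrite orbT.
  by have := nw a; rewrite ab /= negbK => ->.
left; split; first by exists w => //; apply: connect1.
move=> c p _ cy pc; have cin : c \in [set y; w].
  by apply: pred_closed_connect cy _; rewrite ?inE ?eqxx.
by have := pcl _ _ pc cin; rewrite !inE => /orP[/eqP->|/eqP->]; rewrite ?connect0 ?connect1.
Qed.

(** The same two-step descent along the walk: it ends with [x] reaching [u], or inside the component
    of [x]. So a vertex not reached from [x] that has an edge into the reached set has an edge into
    that component. *)
Lemma reach_pred x n w u : (exists2 p, D p x & connect D x p) -> walk D n x w -> D u w ->
  connect D x u \/ exists c, [/\ D u c, connect D x c & connect D c x].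
Proof.
move=> [q qx xq]; elim/ltn_ind: n w u => -[|[|n]] IHn w u wk uw.
- by right; exists x; rewrite connect0 (eqP (wk : x == w)).
- have xw : D x w by case/existsP: wk => v /andP[/eqP->].
  have [/orP[qu|uq]|<-] := alis qx xw uw; last by left.
    by left; apply: connect_trans xq (connect1 qu).
  by right; exists q; split=> //; apply: connect1.
- case/existsP: wk => p /andP[/existsP[p' /andP[wp' p'p]] pw].
  have [/orP[p'u|up']|<-] := alis p'p pw uw; last by left; apply: walk_connect wp'.
    by left; apply: connect_trans (walk_connect wp') (connect1 p'u).
  exact: IHn wp' up'.
Qed.

Definition core (B : {set T}) : Prop := (forall y, bad y -> y \in B) /\ pred_closed B.

(** All obstructions of [bip_criterion] lie inside [B], with one exception: the vertex dominated by
    a digon of [B] may be outside. Hence only [E :&: B] has to be coloured and that exception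
    excluded. *)
Lemma core_bip (B E : {set T}) : core B ->
    (exists col : T -> bool, {in E :&: B &, forall x y, adj x y -> col x != col y}) ->
    (forall u w z, u \in E :&: B -> w \in E :&: B -> z \in E -> z \notin B ->
       D u w -> D w u -> D u z -> D w z -> False) ->
  bipartite D E.
Proof.
move=> [badB Bp] [col colP] noP; apply: bip_criterion => //.
  move=> n x on; apply/negP=> wx.
  have xB : x \in B.
    by apply: badB; left; exists n => //; apply: sub_walk wx => a b /and3P[].
  have par m a b : walk (restr D E) m a b -> b \in B -> a \in B /\ col a = col b (+) odd m.
    elim: m b => [|m IHm] b; first by move=> /eqP->; rewrite addbF.
    move=> /existsP[u /andP[wu /and3P[uE bE ub]]] bB.
    have uB := Bp _ _ ub bB; have [aB ->] := IHm u wu uB; split=> //.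
    have := colP u b; rewrite !inE uE bE uB bB /adjacent /= ub => /(_ isT isT isT).
    by case: (col u); case: (col b); case: (odd m).
  by have [_] := par _ _ _ wx xB; rewrite on; case: (col x).
move=> u w z uE wE zE uw wu.
have tri : u \in B -> w \in B -> z \in B -> adj z u -> adj z w -> False.
  move=> uB wB zB zu zw; have uw' : adj u w by rewrite /adjacent /= uw.
  have := colP z u; have := colP z w; have := colP u w.
  rewrite !inE uE wE zE uB wB zB => /(_ isT isT uw') h1 /(_ isT isT zw) h2 /(_ isT isT zu).
  by move: h1 h2; case: (col u); case: (col w); case: (col z).
apply/andP; split; apply/negP=> /andP[].
  move=> zu zw; have uB : u \in B by apply: badB; right; exists w, z; split=> //; left.
  have wB : w \in B by apply: badB; right; exists u, z; split=> //; left.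
  by apply: tri (Bp _ _ zu uB) _ _ => //; rewrite /adjacent /= ?zu ?zw.
move=> uz wz; have uB : u \in B by apply: badB; right; exists w, z; split=> //; right.
have wB : w \in B by apply: badB; right; exists u, z; split=> //; right.
have [zB|zB] := boolP (z \in B).
  by apply: tri zB _ _ => //; rewrite /adjacent /= ?uz ?wz orbT.
by apply: (noP u w z); rewrite ?inE ?uE ?wE.
Qed.

(** * Pieces separated by a predecessor-closed set *)

Section Piece.

Variables R K : {set T}.
Hypothesis Rp : pred_closed R.
Hypothesis KR : K \subset R.
Hypothesis K0 : K != set0.
Hypothesis no_digon_out : forall r m z, r \in R -> m \notin R ->
  D r m -> D r z -> D m z -> D z m -> False.
Hypothesis K_pred : forall c, c \in K ->
  exists2 k, D k c & k \in K \/ exists2 r, D r k & r \notin K.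

(* A source of clique cutsets: the piece is not adjacent to the rest of the
   complement of R (piece_nonadj), and its in-neighbours in R lie in K or are
   attached to K (piece_pred_in). *)
Definition twins := [set y | (y \notin R) && ([set p | D p y] == K)].

Definition piece := [set z | [exists y in twins, connect (restr D (~: R)) y z]].

Lemma twinsP y : y \in twins -> y \notin R /\ forall p, D p y = (p \in K).
Proof. by rewrite inE => /andP[yR /eqP e]; split=> // p; rewrite -e inE. Qed.

Lemma out_R r m : r \in R -> m \notin R -> D m r = false.
Proof. by move=> rR; apply: contraNF => /Rp; apply. Qed.

Lemma adj_out r m : r \in R -> m \notin R -> adj r m -> D r m.
Proof. by move=> rR mR; rewrite /adjacent /= (out_R rR mR) orbF. Qed.

Lemma alis_out r u v m : r \in R -> m \notin R -> D r u -> D u v -> D m v -> D r m.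
Proof.
move=> rR mR ru uv mv; have [|e] := alis ru uv mv; first exact: adj_out.
by rewrite -e rR in mR.
Qed.

(** No edge enters [R] from outside, so the only reverse edge that [D_tt] can supply is the one
    excluded by [no_digon_out]. *)
Lemma no_triangle_out r m z : r \in R -> m \notin R -> z \notin R ->
  D r m -> D m z -> D r z -> False.
Proof.
move=> rR mR zR rm mz rz; have [mr|zm|zr] := or3P (D_tt rm mz rz).
- by rewrite out_R in mr.
- exact: (no_digon_out rR mR rm rz mz).
- by rewrite out_R in zr.
Qed.

(** Through the common out-neighbour [z], the in-neighbours of [m] and [y] in [R] are transferred
    both ways. An in-neighbour of [y] outside [R] contradicts [no_triangle_out], with the help of
    [K_pred] when [m] points to it. *)
Lemma twins_succ m y z : m \in twins -> D m z -> D y z -> y \notin R -> y \in twins.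
Proof.
move=> mG mz yz yR; have [mR mP] := twinsP mG.
have Ky k : k \in K -> D k y.
  by move=> kK; apply: alis_out mz yz => //; rewrite ?mP // (subsetP KR).
have RyK r : r \in R -> D r y -> r \in K.
  by move=> rR ry; rewrite -mP; apply: alis_out yz mz.
suff nR y' : D y' y -> y' \in R.
  rewrite inE yR /=; apply/eqP/setP=> p; rewrite inE; apply/idP/idP; last exact: Ky.
  by move=> py; apply: RyK (nR _ py) py.
move=> y'y; apply: contraT => y'R.
have [c cK] := set0Pn _ K0; have cR := subsetP KR c cK.
have cm : D c m by rewrite mP.
have [/orP[y'm|my']|e] := alis y'y yz mz; last first.
- by rewrite e in y'y; case: (no_triangle_out cR mR yR cm y'y (Ky c cK)).
- have [k kc hk] := K_pred cK; have kR := Rp kc cR.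
  have ky' : D k y' := alis_out kR y'R kc (Ky c cK) y'y.
  case: hk => [kK|[r rk rK]].
    by case: (no_triangle_out kR mR y'R _ my' ky'); rewrite mP.
  by have := alis_out (Rp rk kR) mR rk ky' my'; rewrite mP (negPf rK).
- by rewrite mP in y'm; rewrite (subsetP KR _ y'm) in y'R.
Qed.

Lemma pieceP z : z \in piece ->
  exists2 y, y \in twins & exists n, walk (restr D (~: R)) n y z.
Proof. by rewrite inE => /existsP[y /andP[yG /connect_walk yz]]; exists y. Qed.

Lemma walk_piece y n z : y \in twins -> walk (restr D (~: R)) n y z -> z \in piece.
Proof. by move=> yG /walk_connect yz; rewrite inE; apply/existsP; exists y; rewrite yG. Qed.

Lemma twins_piece y : y \in twins -> y \in piece.
Proof. by move=> yG; apply: (@walk_piece _ 0 _ yG); rewrite /=. Qed.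

Lemma piece_out z : z \in piece -> z \notin R.
Proof.
move=> /pieceP[y /twinsP[yR _] [[|n]]]; first by move=> /eqP<-.
by move=> /existsP[u /andP[_ /and3P[_ + _]]]; rewrite inE.
Qed.

Lemma piece_succ z v : z \in piece -> D z v -> v \notin R -> v \in piece.
Proof.
move=> zM zv vR; have zR := piece_out zM; have [y yG [n wk]] := pieceP zM.
by apply: (walk_piece yG (walkSr wk _)); rewrite /restr /= !inE zR vR.
Qed.

(** Two-step descent along a walk from [twins]; [twins_succ] settles the walks of length one, where
    the descent stops. *)
Lemma piece_pred z v : z \in piece -> D v z -> v \notin R -> v \in piece.
Proof.
move=> /pieceP[y yG [n wk]] vz vR; elim/ltn_ind: n z v wk vz vR => -[|[|n]] IHn z v wk vz vR.
- have /eqP e : y == z := wk; have [_ mP] := twinsP yG.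
  by rewrite -e mP in vz; rewrite (subsetP KR _ vz) in vR.
- have yz : D y z by case/existsP: wk => u /andP[/eqP-> /and3P[]].
  exact: twins_piece (twins_succ yG yz vz vR).
- case/existsP: wk => m /andP[/existsP[p /andP[wp /and3P[_ _ pm]]] /and3P[_ _ mz]].
  have pM := walk_piece yG wp.
  have [/orP[pv|vp]|<-//] := alis pm mz vz; first exact: piece_succ pM pv vR.
  by apply: (IHn n) vp vR.
Qed.

Lemma piece_nonadj x y : x \in piece -> y \notin R :|: piece -> ~~ adj x y.
Proof.
rewrite in_setU negb_or => xM /andP[yR]; apply: contra => /orP[xy|yx].
  exact: piece_succ xM xy yR.
exact: piece_pred xM yx yR.
Qed.

(** By [piece_pred_in], a vertex of [R] with an edge into the piece is of this kind, unless the edge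
    goes from [K] to [twins]. *)
Definition attached c : Prop :=
  [/\ c \notin K, forall p, D p c -> p \in K & {in K, forall k, adj c k}].

Lemma succ_twins_pred y z c : y \in twins -> D y z -> c \in R -> D c z -> attached c.
Proof.
move=> yG yz cR cz; have [yR yP] := twinsP yG.
have zR : z \notin R by apply: contra yR; apply: Rp.
split.
- by apply/negP; rewrite -yP => cy; apply: no_triangle_out cR yR zR cy yz cz.
- by move=> p pc; rewrite -yP; exact: (alis_out (Rp pc cR) yR pc cz yz).
- move=> k; rewrite -yP => ky; have [|e] := alis ky yz cz; first by rewrite adjC.
  by rewrite e in ky; case: (no_triangle_out cR yR zR ky yz cz).
Qed.

Lemma piece_pred_in z c : z \in piece -> c \in R -> D c z ->
  z \in twins /\ c \in K \/ attached c.
Proof.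
move=> /pieceP[y yG [n wk]]; elim/ltn_ind: n z wk => -[|[|n]] IHn z wk cR cz.
- have /eqP e : y == z := wk; have [_ mP] := twinsP yG.
  by left; rewrite -e; split=> //; rewrite -mP e.
- have yz : D y z by case/existsP: wk => u /andP[/eqP-> /and3P[]].
  by right; apply: succ_twins_pred yG yz cR cz.
- case/existsP: wk => m /andP[/existsP[p /andP[wp /and3P[_ mR pm]]] /and3P[_ _ mz]].
  rewrite inE in mR; have pR := piece_out (walk_piece yG wp).
  have cp : D c p.
    have [|e] := alis pm mz cz; first by rewrite adjC; apply: adj_out.
    by rewrite e cR in pR.
  case: (IHn n _ p wp cR cp) => // [[pG cK]|]; last by right.
  have [k kc hk] := K_pred cK; have kR := Rp kc cR.
  have [kK kp _] := succ_twins_pred pG pm kR (alis_out kR mR kc cz mz).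
  case: hk => [|[r rk /negP[]]]; first by rewrite (negPf kK).
  exact: kp.
Qed.

End Piece.

End Bad.

(** * Minimal counterexamples *)

Section Minimal.

Variables (T : finType) (D : rel T).
Hypothesis D_irr : irreflexive D.
Hypothesis D_tt : transitive_triangle_free D.
Hypothesis D_alis : arc_locally_in_semicomplete D.
Hypothesis IH : forall W : {set T}, W \proper setT -> BEon D W.
Hypothesis nBE : ~ BEon D setT.

Local Notation adj := (adjacent D).
Let alis := alis D_alis.

Lemma no_clique_cutset (K M : {set T}) : clique D K -> M != set0 -> [disjoint K & M] ->
  (forall x y, x \in M -> y \notin K :|: M -> ~~ adj x y) -> K :|: M = setT.
Proof.
move=> clK M0 dKM na; apply/eqP; apply: contraT => nT.
by case: nBE; apply: (clique_cutset_BE IH clK M0 dKM nT na).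
Qed.

(** By [reach_pred] and initiality no edge enters the set reached from [y], so the empty clique
    would separate this set from the rest. *)
Lemma initial_king y : initial D y -> forall v, connect D y v.
Proof.
move=> [yp yini] v; pose M := [set v | connect D y v].
have M0 : M != set0 by apply/set0Pn; exists y; rewrite inE.
have : set0 :|: M = setT.
  apply: no_clique_cutset => //.
  - by move=> a b; rewrite inE.
  - by rewrite disjoints_subset sub0set.
  move=> a b; rewrite set0U !inE => ya; apply: contra => /orP[ab|ba].
    exact: connect_trans ya (connect1 ab).
  have [n wk] := connect_walk ya.
  have [//|[c [bc yc cy]]] := reach_pred D_alis yp wk ba.
  exact: yini yc cy bc.
by rewrite set0U => /setP/(_ v); rewrite !inE.
Qed.

(** The clique [R] would separate the piece from the rest, so the piece is all of the complement of
    [R]. A vertex of [R] outside [K] is attached, since without an edge leaving [R] the rest of [R]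
    would cut it off. Two attached vertices would be joined by an edge that starts outside [K], so
    there is at most one. Hence deleting [K] up to one vertex leaves at most two vertices of [R],
    and [chain_BE] applies to [K]. *)
Lemma pred_closed_clique_false (R K : {set T}) y0 :
    core D R -> clique D R -> K \subset R -> K != set0 ->
    (forall c, c \in K -> exists2 k, D k c & k \in K \/ exists2 r, D r k & r \notin K) ->
    y0 \in twins D R K -> False.
Proof.
move=> coreR clR KR K0 K_pred y0G; have [badR Rp] := coreR.
have nd r m z : r \in R -> m \notin R -> D r m -> D r z -> D m z -> D z m -> False.
  move=> rR /negP mR rm rz mz zm; apply: mR; apply: badR; right.
  by exists z, r; split=> //; left.
pose M := piece D R K.
have MR z : z \in M -> z \notin R by apply: piece_out.
have y0M : y0 \in M := twins_piece y0G.
have dRM : [disjoint R & M].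
  by rewrite disjoint_sym disjoints_subset; apply/subsetP=> z /MR; rewrite inE.
have MT z : z \notin R -> z \in M.
  move=> zR; have : R :|: M = setT.
    apply: no_clique_cutset => //; first by apply/set0Pn; exists y0.
    by move=> a b; apply: (piece_nonadj D_tt D_alis Rp KR K0 nd K_pred).
  by move/setP/(_ z); rewrite !inE (negPf zR) /= => /= ->.
have predM z c : z \notin R -> c \in R -> D c z ->
    z \in twins D R K /\ c \in K \/ attached D K c.
  by move=> /MT zM cR cz; apply: (piece_pred_in D_tt D_alis Rp nd K_pred zM cR cz).
have attR r : r \in R -> r \notin K -> attached D K r.
  move=> rR rK.
  have [/existsP[z /andP[zR rz]]|] := boolP [exists z, (z \notin R) && D r z].
    by case: (predM _ _ zR rR rz) => [[_]|//]; rewrite (negPf rK).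
  rewrite negb_exists => /forallP nz.
  have : (R :\ r) :|: [set r] = setT.
    apply: no_clique_cutset.
    - by move=> a b; rewrite !inE => /andP[_ aR] /andP[_ bR]; apply: clR.
    - by apply/set0Pn; exists r; rewrite inE.
    - by rewrite disjoint_sym disjoints1 !inE eqxx.
    move=> a b; rewrite !inE => /eqP->; rewrite negb_or negb_and negbK => /andP[/orP[->//|bR] _].
    by rewrite /adjacent /= (out_R Rp rR bR) orbF; have := nz b; rewrite bR.
  rewrite setUC setD1K // => e; have := MR _ y0M.
  by rewrite e inE.
have att_uniq e e' : e \in R -> e' \in R -> attached D K e -> attached D K e' -> e = e'.
  move=> eR e'R [eK ep _] [e'K e'p _]; apply/eqP; apply: contraT => ne.
  by have /orP[/e'p|/ep] := clR e e' eR e'R ne; rewrite ?(negPf eK) ?(negPf e'K).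
have hom k s : k \in K -> s \notin K -> adj k s -> clique D (s |: K).
  move=> kK sK ks.
  have sA c : c \in K -> adj s c.
    move=> cK; have [sR|sR] := boolP (s \in R).
      by apply: clR => //; [exact: subsetP KR _ cK|apply: contraNneq sK => ->].
    have [[sG _]|[]] := predM s k sR (subsetP KR _ kK) (adj_out Rp (subsetP KR _ kK) sR ks);
      last by rewrite kK.
    by have [_ sP] := twinsP sG; rewrite /adjacent /= sP cK orbT.
  move=> a b; rewrite !inE => /orP[/eqP->|aK] /orP[/eqP->|bK]; rewrite ?eqxx //.
  - by move=> _; apply: sA.
  - by move=> _; rewrite adjC; apply: sA.
  - by apply: clR; apply: (subsetP KR).
have clK : clique D K by move=> a b aK bK; apply: clR; apply: (subsetP KR).
apply: nBE; apply: (chain_BE D_tt clK).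
- move=> k kK; have inE' x : x \in ~: (K :\ k) :&: R -> x = k \/ attached D K x.
    rewrite !inE negb_and negbK => /andP[/orP[/eqP->|xK] xR]; [by left|right; exact: attR].
  apply: (core_bip D_irr D_tt D_alis coreR).
    exists (fun x => x == k) => x y xE yE; case: (inE' x xE) => [->|ax].
      case: (inE' y yE) => [->|[yK _ _] _]; first by rewrite adjxx.
      by rewrite eqxx (_ : (y == k) = false) //; apply: contraNF yK => /eqP->.
    case: (inE' y yE) => [-> _|ay].
      by rewrite eqxx; case: ax => xK _ _; rewrite (_ : (x == k) = false) //; apply: contraNF xK => /eqP->.
    have [xR yR] : x \in R /\ y \in R by move: xE yE; rewrite !inE => /andP[_ ?] /andP[_ ?].
    by rewrite (att_uniq x y) // adjxx.
  have key u w z : u \in R -> attached D K u -> w = k \/ attached D K w -> w \in R ->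
      z \notin R -> D u w -> D u z -> D w z -> False.
    move=> uR au [->|aw] wR zR uw uz wz; last first.
      by rewrite (att_uniq u w) // D_irr in uw.
    have [[zG _]|[]] := predM z k zR wR wz; last by rewrite kK.
    by have [_ zP] := twinsP zG; case: au; rewrite -zP uz.
  move=> u w z uE wE _ zR uw wu uz wz.
  have [uR wR] : u \in R /\ w \in R by move: uE wE; rewrite !inE => /andP[_ ?] /andP[_ ?].
  case: (inE' u uE) => [eu|au]; last exact: key uR au (inE' w wE) wR zR uw uz wz.
  case: (inE' w wE) => [ew|aw]; first by rewrite eu ew D_irr in uw.
  by apply: key wR aw (inE' u uE) uR zR wu wz uz.
- have [k kK] := set0Pn _ K0; exists k => // s sK ks.
  by apply: rooted_clique => //; [exact: hom ks|rewrite !inE eqxx].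
- move=> k kK; left; split=> [|a aK ak]; first exact: rooted_clique.
  by apply: rooted_clique => //; [apply: (hom k); rewrite // adjC|rewrite !inE kK orbT].
Qed.

End Minimal.

(** * Dominated strong components *)

Section Dominated.

Variables (T : finType) (D : rel T).
Hypothesis D_tt : transitive_triangle_free D.
Hypothesis D_alis : arc_locally_in_semicomplete D.

Local Notation adj := (adjacent D).
Let alis := alis D_alis.

Definition strong_comp (u : T) := [set c | connect D u c && connect D c u].
Definition dominators (u : T) := [set q | (q \notin strong_comp u) && [exists c in strong_comp u, D q c]].

Variables (x u w : T).
Hypothesis dom : dominated D x u w.

Local Notation C := (strong_comp u).
Local Notation Q := (dominators u).

Lemma compxx : u \in C.
Proof. by rewrite inE !connect0. Qed.

Lemma dom_no_back c : c \in C -> ~~ connect D c x.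
Proof.
have [_ _ _ _ nux] := dom; rewrite inE => /andP[uc _].
by apply: contra nux; apply: connect_trans.
Qed.

Lemma comp_connect c c' : c \in C -> c' \in C -> connect D c c'.
Proof. by rewrite !inE => /andP[_ cu] /andP[uc' _]; apply: connect_trans cu uc'. Qed.

Lemma comp_between c v c' : c \in C -> c' \in C -> connect D c v -> connect D v c' -> v \in C.
Proof.
rewrite !inE => /andP[uc _] /andP[_ c'u] cv vc'.
by rewrite (connect_trans uc cv) (connect_trans vc' c'u).
Qed.

(** The digon u, w corrects the parity, so [dominate_even] covers the whole component. *)
Lemma dom_comp c : c \in C -> D x c.
Proof.
move=> cC; have [xu xw uw wu nux] := dom; have [n wk] := connect_walk (comp_connect cC compxx).
have [on|on] := boolP (odd n); last first.
  apply: (dominate_even D_alis xu nux wk) on _.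
  by move: cC; rewrite inE => /andP[].
have wC : w \in C by rewrite inE !connect1.
apply: (dominate_even D_alis xw (dom_no_back wC) (walkSr wk uw)); first by rewrite oddS on.
exact: comp_connect.
Qed.

Lemma no_to_dom c : c \in C -> D c x = false.
Proof. by move=> /dom_no_back; apply: contraNF => /connect1. Qed.

(** [x] dominates both ends and gets no edge back, so the reverse edge promised by [D_tt] must be
    inside the component. *)
Lemma comp_digon a b : a \in C -> b \in C -> D a b -> D b a.
Proof.
move=> aC bC ab; have [ax|//|bx] := or3P (D_tt (dom_comp aC) ab (dom_comp bC)).
  by rewrite no_to_dom in ax.
by rewrite no_to_dom in bx.
Qed.

Lemma comp_adj a b : a \in C -> b \in C -> adj a b -> D a b.
Proof. by move=> aC bC /orP[//|ba]; apply: comp_digon. Qed.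

Lemma comp_nbr c : c \in C -> exists2 c', c' \in C & D c c' /\ D c' c.
Proof.
move=> cC; have [_ _ uw wu _] := dom; have wC : w \in C by rewrite inE !connect1.
have [[|n] wk] := connect_walk (comp_connect cC compxx).
  by have /eqP-> : c == u := wk; exists w.
have [c' cc' wk'] := walkS_inv wk.
have c'C : c' \in C by apply: (comp_between cC compxx (connect1 cc') (walk_connect wk')).
by exists c' => //; split=> //; apply: comp_digon.
Qed.

Lemma dominators_no_back c q : c \in C -> q \in Q -> ~~ connect D c q.
Proof.
move=> cC; rewrite inE => /andP[qC /existsP[c' /andP[c'C qc']]].
by apply: contra qC => cq; apply: (comp_between cC c'C cq (connect1 qc')).
Qed.

Lemma dominatorsP q c : q \in Q -> c \in C -> D q c.
Proof.
move=> qQ cC; have nback c' : c' \in C -> D c' q = false.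
  by move=> c'C; apply: contraNF (dominators_no_back c'C qQ) => /connect1.
have [c0 c0C qc0] : exists2 c0, c0 \in C & D q c0.
  by move: qQ; rewrite inE => /andP[_ /existsP[c0 /andP[]]]; exists c0.
have [c1 c1C [c01 c10]] := comp_nbr c0C; have [c2 c2C [cc2 c2c]] := comp_nbr cC.
have [xq|<-] := alis (dom_comp c1C) c10 qc0; last exact: dom_comp.
have qx : D q x.
  case/orP: xq => // xq; have [//|c0q|c0x] := or3P (D_tt xq qc0 (dom_comp c0C)).
    by rewrite nback in c0q.
  by rewrite no_to_dom in c0x.
have [/orP[//|cq]|e] := alis qx (dom_comp c2C) cc2; first by rewrite nback in cq.
by move: qQ; rewrite e inE cC.
Qed.

Lemma no_to_dominators q c : q \in Q -> c \in C -> D c q = false.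
Proof. by move=> qQ cC; apply: contraNF (dominators_no_back cC qQ) => /connect1. Qed.

Lemma dom_in : x \in Q.
Proof.
have [xu _ _ _ nux] := dom; rewrite inE; apply/andP; split.
  by rewrite inE (negPf nux).
by apply/existsP; exists u; rewrite compxx.
Qed.

Lemma dominators_closed : pred_closed D Q.
Proof.
move=> p q pq qQ; have uC := compxx.
have pnC c : c \in C -> ~~ connect D c p.
  move=> cC; apply: contra (dominators_no_back cC qQ) => cp.
  exact: connect_trans cp (connect1 pq).
have [c' c'C [uc' c'u]] := comp_nbr uC.
have pc' : D p c'.
  have [/orP[//|c'p]|e] := alis pq (dominatorsP qQ uC) c'u.
    by have := pnC _ c'C; rewrite connect1.
  by have := pnC _ c'C; rewrite e connect0.
rewrite inE; apply/andP; split; first by apply: contraL uC => pC; have := pnC _ pC; rewrite connect0.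
by apply/existsP; exists c'; rewrite c'C.
Qed.

Lemma dominators_digon q q' : q \in Q -> q' \in Q -> q != q' -> D q q'.
Proof.
move=> qQ q'Q ne; have uC := compxx; have [c' c'C [uc' c'u]] := comp_nbr uC.
have [/orP[//|q'q]|e] := alis (dominatorsP qQ uC) uc' (dominatorsP q'Q c'C); last by rewrite e eqxx in ne.
have [//|uq|uq'] := or3P (D_tt q'q (dominatorsP qQ uC) (dominatorsP q'Q uC)).
  by rewrite no_to_dominators in uq.
by rewrite no_to_dominators in uq'.
Qed.

Lemma dominators_comp_closed : pred_closed D (Q :|: C).
Proof.
move=> a b ab; rewrite !in_setU => /orP[bQ|bC]; first by rewrite (dominators_closed ab bQ).
have [//|aC] := boolP (a \in C); rewrite ?orbT // orbF inE aC /=.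
by apply/existsP; exists b; rewrite bC.
Qed.

(** Edges of the component are digons, so the defining condition joins or identifies the ends of any
    walk of length three; longer walks shrink. *)
Lemma comp_short_walk n a e : a \in C -> e \in C -> walk D n a e ->
  [\/ a = e, D a e | exists m, [/\ m \in C, D a m & D m e]].
Proof.
move=> aC eC; elim/ltn_ind: n => -[|[|[|n]]] IHn wk.
- exact/Or31/eqP.
- by apply: Or32; case/existsP: wk => v /andP[/eqP->].
- have [m am wk1] := walkS_inv wk; have [e' me' /eqP e'e] := walkS_inv wk1; rewrite e'e in me'.
  by apply: Or33; exists m; split=> //; apply: (comp_between aC eC); apply: connect1.
have [a1 aa1 w1] := walkS_inv wk; have [a2 a12 w2] := walkS_inv w1; have [a3 a23 w3] := walkS_inv w2.
have a1C : a1 \in C := comp_between aC eC (connect1 aa1) (walk_connect w1).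
have a2C : a2 \in C := comp_between a1C eC (connect1 a12) (walk_connect w2).
have a3C : a3 \in C := comp_between a2C eC (connect1 a23) (walk_connect w3).
have [aa3|e'] := alis aa1 a12 (comp_digon a2C a3C a23); last first.
  by apply: (IHn n); rewrite ?e' //; apply: leqW.
by apply: (IHn n.+1) => //; apply: walkSl w3; apply: comp_adj.
Qed.

(** Non-adjacent distinct vertices have a common neighbour m, and d -> a -> m <- e makes d adjacent
    to e. Thus the component is complete multipartite. *)
Lemma comp_same_nbr a e d : a \in C -> e \in C -> d \in C -> ~~ adj a e -> adj a d = adj e d.
Proof.
suff H a' e' d' : a' \in C -> e' \in C -> d' \in C -> ~~ adj a' e' -> adj a' d' -> adj e' d'.
  by move=> aC eC dC ae; apply/idP/idP; apply: H => //; rewrite adjC.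
move=> {}aC {}eC {}dC ae ad.
have [n wk] := connect_walk (comp_connect aC eC).
have [<-//|ae'|[m [mC am me]]] := comp_short_walk aC eC wk.
  by rewrite /adjacent /= ae' in ae.
have da : D d' a' by apply: comp_digon => //; apply: comp_adj.
have [|e1] := alis da am (comp_digon mC eC me); first by rewrite adjC.
by rewrite e1 (negPf ae) in ad.
Qed.

End Dominated.

Section DominatedMinimal.

Variables (T : finType) (D : rel T).
Hypothesis D_tt : transitive_triangle_free D.
Hypothesis D_alis : arc_locally_in_semicomplete D.
Hypothesis IH : forall W : {set T}, W \proper setT -> BEon D W.
Hypothesis nBE : ~ BEon D setT.

Let alis := alis D_alis.

Variables (x u w : T).
Hypothesis dom : dominated D x u w.

Local Notation C := (strong_comp D u).
Local Notation Q := (dominators D u).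
Let uC : u \in C := compxx D u.

Lemma dominators_clique : clique D Q.
Proof.
by move=> a b aQ bQ ab; rewrite /adjacent /= (dominators_digon D_tt D_alis dom aQ bQ ab).
Qed.

(** Otherwise the clique [Q] would separate the vertices reached from [u] from the remaining
    ones. *)
Lemma dominators_reach v : v \in Q \/ connect D u v.
Proof.
pose M := [set v | connect D u v].
have : Q :|: M = setT.
  apply: (no_clique_cutset IH nBE dominators_clique).
  - by apply/set0Pn; exists u; rewrite inE.
  - rewrite disjoint_sym disjoints_subset; apply/subsetP=> q; rewrite inE => uq; rewrite in_setC.
    by apply: contraL uq; apply: dominators_no_back.
  move=> a b; rewrite [a \in M]inE in_setU [b \in M]inE negb_or => ua /andP[bQ nub].
  apply: contra nub => /orP[ab|ba]; first exact: connect_trans ua (connect1 ab).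
  have [n wk] := connect_walk ua; have [_ _ uw wu _] := dom.
  have uclosed : exists2 p, D p u & connect D u p by exists w => //; apply: connect1.
  have [//|[c [bc uc cu]]] := reach_pred D_alis uclosed wk ba.
  have cC : c \in C by rewrite inE uc.
  apply: contraNT bQ => nub; rewrite inE; apply/andP; split.
    by rewrite inE (negPf nub).
  by apply/existsP; exists c; rewrite cC.
move=> e; have : v \in Q :|: M by rewrite e in_setT.
by rewrite in_setU [v \in M]inE => /orP[]; [left|right].
Qed.

End DominatedMinimal.

(** * Covers with one exceptional path *)

Section Insert.

Variables (T : finType) (D : rel T).
Hypothesis D_tt : transitive_triangle_free D.
Local Notation adj := (adjacent D).

(** [g] is a matching into [S] except possibly at [s0], whose path absorbs [Z] and everything that
    [g] sends there; all other paths have at most two vertices. *)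
Lemma insert_cover (S Z : {set T}) (s0 : T) (g : T -> T) :
    s0 \in S -> [disjoint Z & S] ->
    (forall v, v \notin S -> v \notin Z -> g v \in S /\ (g v != s0 -> adj v (g v))) ->
    (forall v v', v \notin S -> v \notin Z -> v' \notin S -> v' \notin Z ->
       g v = g v' -> g v != s0 -> v = v') ->
    rooted D [set v | [|| v == s0, v \in Z | [&& v \notin S, v \notin Z & g v == s0]]] s0 ->
  coverable D setT S.
Proof.
move=> s0S dZS gS ginj hr.
exists (fun v => if v \in S then v else if v \in Z then s0 else g v); split.
  move=> v _; case: ifP => // /negbT vS; case: ifP => // /negbT vZ.
  by have [] := gS v vS vZ.
move=> s sS; have [-> {s sS}|sk] := eqVneq s s0.
  apply: eq_rooted hr; apply/setP=> v; rewrite !inE /=.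
  case vS: (v \in S) => /=; first by rewrite (disjointFl dZS vS) /= orbF.
  have -> : (v == s0) = false by apply: contraFF vS => /eqP->.
  by case: (v \in Z) => //=; rewrite eqxx.
have inF v : v \in [set v in setT | (if v \in S then v else if v \in Z then s0 else g v) == s] ->
    v = s \/ [/\ v \notin S, v \notin Z & g v = s].
  rewrite !inE /=; case: ifP => [_ /eqP|/negbT vS]; first by left.
  case: ifP => [_ /eqP e|/negbT vZ /eqP e]; first by rewrite e eqxx in sk.
  by right.
apply: (rooted_pair D_tt).
- by rewrite !inE sS eqxx.
- move=> v /inF[->|[vS vZ e]]; [by left|right].
  by rewrite -e; have [_] := gS v vS vZ; apply; rewrite e.
- move=> v v' /inF[->|[vS vZ e]]; first by rewrite eqxx.
  move=> /inF[->|[v'S v'Z e'] _ _]; first by rewrite eqxx.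
  by apply: ginj; rewrite ?e.
Qed.

End Insert.

(** * Exclusion of dominated components *)

Section DominatedCore.

Variables (T : finType) (D : rel T).
Hypothesis D_irr : irreflexive D.
Hypothesis D_tt : transitive_triangle_free D.
Hypothesis D_alis : arc_locally_in_semicomplete D.
Hypothesis IH : forall W : {set T}, W \proper setT -> BEon D W.
Hypothesis nBE : ~ BEon D setT.

Local Notation adj := (adjacent D).
Let alis := alis D_alis.

Variables (x u w : T).
Hypothesis dom : dominated D x u w.

Local Notation C := (strong_comp D u).
Local Notation Q := (dominators D u).
Local Notation R := (Q :|: C).

Let uC : u \in C := compxx D u.
Let xQ : x \in Q := dom_in dom.
Let QC q c : q \in Q -> c \in C -> D q c := dominatorsP D_tt D_alis dom (q := q) (c := c).
Let CQ q c : q \in Q -> c \in C -> D c q = false := no_to_dominators (q := q) (c := c).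
Let Rp : pred_closed D R := dominators_comp_closed D_tt D_alis dom.
Let digonC a b : a \in C -> b \in C -> adj a b -> D a b := comp_adj D_tt D_alis dom (a := a) (b := b).

(** An initial vertex reaches [x] and so lies in [Q]. Otherwise a bad vertex outside [Q] is in a
    dominated component, reached from [u]. If that is not [C], then [u] is one of its dominators,
    and so is the in-neighbour [x] of [u]; but dominators form digons, while [u] does not reach
    [x]. *)
Lemma dominated_core : core D R.
Proof.
split=> // y /(bad_cases D_irr D_tt D_alis)[yini|[x' [u' [w' [dom' u'y yu']]]]].
  have yx := initial_king D_alis IH nBE yini x.
  by rewrite in_setU (pred_closed_connect (dominators_closed D_tt D_alis dom) yx xQ).
rewrite in_setU.
case: (dominators_reach D_tt D_alis IH nBE dom y) => [->//|uy].
have [uC'|uC'] := boolP (u \in strong_comp D u').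
  apply/orP; right; rewrite inE uy /=; apply: connect_trans yu' _.
  by move: uC'; rewrite inE => /andP[].
have yC' : y \in strong_comp D u' by rewrite inE u'y.
have uQ' : u \in dominators D u'.
  have := pred_closed_connect (dominators_comp_closed D_tt D_alis dom') uy.
  by rewrite !in_setU yC' orbT (negPf uC') orbF; apply.
have [xu _ _ _ nux] := dom.
have xQ' := dominators_closed D_tt D_alis dom' xu uQ'.
have ux : u != x by apply: contraNneq nux => ->; apply: connect0.
have := dominators_digon D_tt D_alis dom' uQ' xQ' ux => /connect1 h.
by rewrite h in nux.
Qed.

Lemma dominators_disj q : q \in Q -> q \notin C.
Proof. by rewrite [q \in Q]inE => /andP[]. Qed.

(** [R] is now a clique. If no edge goes from [C] out of [R], it is the whole digraph; otherwise the
    in-neighbours of an outer vertex [z] dominated from [C] all lie in [C] and serve as [K] in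
    [pred_closed_clique_false]. *)
Lemma dominated_clique_false : clique D C -> False.
Proof.
move=> clC; have coreR := dominated_core.
have clR : clique D R.
  move=> a b; rewrite !in_setU => /orP[aQ|aC] /orP[bQ|bC] ab.
  - exact: dominators_clique dom _ _ aQ bQ ab.
  - by rewrite /adjacent /= QC.
  - by rewrite /adjacent /= (QC bQ aC) orbT.
  - exact: clC.
have [/existsP[c /existsP[z /and3P[cC zR cz]]]|] :=
    boolP [exists c, exists z, [&& c \in C, z \notin R & D c z]]; last first.
  rewrite negb_exists => /forallP nex.
  have Csucc c v : connect D c v -> c \in C -> v \in C.
    move=> /connectP[p pp ->]; elim: p c pp => [|a p IHp] c //= /andP[ca pa] cC.
    apply: (IHp a) => //; have := nex c; rewrite negb_exists => /forallP/(_ a).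
    rewrite cC ca andbT /= negbK in_setU => /orP[aQ|//].
    by rewrite CQ in ca.
  apply: nBE; apply: (clique_BE D_irr D_tt); suff <- : R = setT by [].
  apply/setP=> v; rewrite in_setT in_setU.
  case: (dominators_reach D_tt D_alis IH nBE dom v) => [->//|/Csucc->]; by rewrite ?orbT.
pose K := [set p | D p z].
have [c' c'C [cc' c'c]] := comp_nbr D_tt D_alis dom cC.
have zRf y : y \in R -> D z y = false by move=> yR; apply: (out_R Rp).
have inR y : y \in C -> y \in R by rewrite in_setU => ->; rewrite orbT.
have inRQ y : y \in Q -> y \in R by rewrite in_setU => ->.
have KC p : p \in K -> p \in C.
  rewrite inE => pz; have [pR|pR] := boolP (p \in R).
    move: pR; rewrite in_setU => /orP[pQ|//].
    have := D_tt (QC pQ cC) cz pz; rewrite CQ // zRf ?inR // zRf ?inRQ //.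
  have xp : D x p by apply: (alis_out D_alis Rp _ pR (QC xQ cC) cz pz); apply: inRQ.
  have c'p : D c' p by apply: (alis_out D_alis Rp _ pR c'c cz pz); apply: inR.
  have [h|h|h] := or3P (D_tt (QC xQ c'C) c'p xp).
  - by rewrite CQ in h.
  - by rewrite (out_R Rp (inR _ c'C) pR) in h.
  - by rewrite (out_R Rp (inRQ _ xQ) pR) in h.
apply: (pred_closed_clique_false D_irr D_tt D_alis IH nBE coreR clR (K := K) (y0 := z)).
- by apply/subsetP=> p /KC; apply: inR.
- by apply/set0Pn; exists c; rewrite inE.
- move=> k /KC kC; have [k' k'C [kk' k'k]] := comp_nbr D_tt D_alis dom kC; exists k' => //.
  right; exists x; first exact: QC.
  by apply/negP=> /KC xC; have := dominators_disj xQ; rewrite xC.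
- by rewrite inE zR eqxx.
Qed.

(** * Complete bipartite components *)

Section Bipartite.

Variables a b : T.
Hypotheses (aC : a \in C) (bC : b \in C) (ab : a != b) (nab : ~~ adj a b).

(** [W] and [U] turn out to be the two sides of a complete bipartite graph; [a] and [b] are distinct
    vertices of [U]. *)
Let W := [set c in C | adj a c].
Let U := C :\: W.

Lemma mem_side c : (c \in W) = (c \in C) && adj a c.
Proof. by rewrite in_set. Qed.

Lemma U_nbr e c : e \in U -> c \in C -> adj e c = (c \in W).
Proof.
rewrite in_setD mem_side => /andP[+ eC] cC; rewrite eC mem_side cC /= => ae.
exact/esym/(comp_same_nbr D_tt D_alis dom).
Qed.

Lemma aU : a \in U.
Proof. by rewrite in_setD mem_side aC adjxx. Qed.

Lemma bU : b \in U.
Proof. by rewrite in_setD mem_side bC (negPf nab). Qed.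

Lemma UC e : e \in U -> e \in C.
Proof. by rewrite in_setD => /andP[]. Qed.

Lemma WC e : e \in W -> e \in C.
Proof. by rewrite mem_side => /andP[]. Qed.

Lemma UW e c : e \in U -> c \in W -> adj e c.
Proof. by move=> eU cW; rewrite U_nbr // WC. Qed.

Lemma U_stable e e' : e \in U -> e' \in U -> ~~ adj e e'.
Proof. by move=> eU e'U; rewrite U_nbr ?UC //; move: e'U; rewrite in_setD => /andP[]. Qed.

Lemma W_stable c c' : c \in W -> c' \in W -> ~~ adj c c'.
Proof.
move=> cW c'W; apply/negP=> cc'.
have [h|h] := alis (digonC aC (WC cW) (UW aU cW)) (digonC (WC cW) (WC c'W) cc')
  (digonC bC (WC c'W) (UW bU c'W)); first by have := nab; rewrite h.
by move: ab; rewrite h eqxx.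
Qed.

Lemma C_UW c : c \in C -> (c \in W) || (c \in U).
Proof. by move=> cC; rewrite [c \in U]in_setD cC andbT orbN. Qed.

Lemma UnW c : c \in U -> c \notin W.
Proof. by rewrite in_setD => /andP[]. Qed.

Lemma W_ex : exists c, c \in W.
Proof.
have [c cC [ac ca]] := comp_nbr D_tt D_alis dom aC.
by exists c; rewrite mem_side cC /adjacent /= ac.
Qed.

(** Let e in [U] and c in [W] point to z. For any e' in [U] the pattern e' -> c -> z <- e gives e' =
    e, as [U] is stable; but [U] contains both [a] and [b]. *)
Lemma no_common_succ p q z : p \in C -> q \in C -> adj p q -> D p z -> D q z -> False.
Proof.
suff H e c : e \in U -> c \in W -> D e z -> D c z -> False.
  move=> pC qC pq pz qz; case/orP: (C_UW pC) => hp; case/orP: (C_UW qC) => hq.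
  - by have := W_stable hp hq; rewrite pq.
  - exact: H hq hp qz pz.
  - exact: H hp hq pz qz.
  - by have := U_stable hp hq; rewrite pq.
move=> eU cW ez cz.
have eq e' : e' \in U -> e' = e.
  move=> e'U; have [h|//] := alis (digonC (UC e'U) (WC cW) (UW e'U cW)) cz ez.
  by have := U_stable e'U eU; rewrite h.
by move: ab; rewrite (eq a aU) (eq b bU) eqxx.
Qed.

Lemma bip_outside_dominators : bipartite D (~: Q).
Proof.
apply: (core_bip D_irr D_tt D_alis dominated_core).
  exists (fun v => v \in W) => p q; rewrite !in_setI !in_setU !in_setC.
  move=> /andP[/negPf-> /= pC] /andP[/negPf-> /= qC] pq.
  case pW: (p \in W); case qW: (q \in W) => //.
    by have := W_stable pW qW; rewrite pq.
  have pU : p \in U by rewrite in_setD pW.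
  have qU : q \in U by rewrite in_setD qW.
  by have := U_stable pU qU; rewrite pq.
move=> p q z; rewrite !in_setI !in_setU !in_setC.
move=> /andP[/negPf-> /= pC] /andP[/negPf-> /= qC] _ _ pq _ pz qz.
by apply: no_common_succ pC qC _ pz qz; rewrite /adjacent /= pq.
Qed.

Lemma bip_outside_side q : q \in Q -> bipartite D (~: (W :|: (Q :\ q))).
Proof.
move=> qQ; have inE' p : p \in ~: (W :|: (Q :\ q)) :&: R -> p = q \/ p \in U.
  rewrite in_setI in_setC !in_setU in_setD1 negb_or => /andP[/andP[pW]].
  case: eqP => [->|_] /=; first by left.
  by move=> /negPf-> /=; right; rewrite in_setD pW.
have qU p : p \in U -> (p == q) = false.
  by move=> pU; apply: contraTF (UC pU) => /eqP->; apply: dominators_disj.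
apply: (core_bip D_irr D_tt D_alis dominated_core).
  exists (fun v => v == q) => p p' /inE'[->|pU] /inE'[->|p'U] pp'.
  - by rewrite adjxx in pp'.
  - by rewrite eqxx qU.
  - by rewrite eqxx qU.
  - by have := U_stable pU p'U; rewrite pp'.
move=> p p' z /inE'[->|pU] /inE'[->|p'U] _ _ pp' p'p _ _.
- by rewrite D_irr in pp'.
- by rewrite CQ ?UC in p'p.
- by rewrite CQ ?UC in pp'.
- by have := U_stable pU p'U; rewrite /adjacent /= pp'.
Qed.

Lemma sorted_Q (L : {set T}) (x0 : T) l : L \subset Q -> sorted D l ->
  (forall q, q \in Q -> q \in L -> D q (head x0 l)) -> sorted D (enum L ++ l).
Proof.
move=> LQ sl h; apply: (@sorted_cat_all _ _ _ _ x0) => //; last first.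
  by move=> q; rewrite mem_enum => qL; apply: h => //; apply: (subsetP LQ).
have : {subset enum L <= Q} by move=> q; rewrite mem_enum; apply: (subsetP LQ).
elim: (enum L) (enum_uniq L) => //= q l' IHl' /andP[ql' ul'] sub.
have sub' : {subset l' <= Q} by move=> p pl; apply: sub; rewrite inE pl orbT.
have {IHl' sub'} := IHl' ul' sub'.
case: l' ql' sub {ul'} => //= p l' + sub ->; rewrite inE negb_or andbT => /andP[qp _].
by apply: (dominators_digon D_tt D_alis dom); rewrite ?sub ?inE ?eqxx ?orbT.
Qed.

Lemma dominated_bipartite_false : False.
Proof.
apply: nBE => S S_max; have st := S_stable S_max.
have QnC q c : q \in Q -> c \in C -> q != c.
  by move=> qQ cC; apply: contraTneq cC => <-; apply: dominators_disj.
have CnQ c : c \in C -> c \notin Q by move=> cC; apply/negP=> cQ; have := QnC _ _ cQ cC; rewrite eqxx.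
have succC c s : c \in C -> s \notin Q -> adj c s -> D c s.
  move=> cC sQ cs; case/orP: (cs) => // sc; apply: digonC => //.
  have : s \in R by apply: Rp sc _; rewrite in_setU cC orbT.
  by rewrite in_setU (negPf sQ).
have [/existsP[q /andP[qS qQ]]|] := boolP [exists q, (q \in S) && (q \in Q)]; last first.
  rewrite negb_exists => /forallP nSQ.
  have SQ v : v \in Q -> v \notin S by move=> vQ; have := nSQ v; rewrite vQ andbT.
  have sSE : S \subset ~: Q.
    by apply/subsetP=> v vS; rewrite in_setC; apply: contraL vS; apply: SQ.
  have [f [fS finj]] := bip_matching S_max bip_outside_dominators sSE.
  have inE' v : v \notin S -> v \notin Q -> v \in ~: Q :\: S by rewrite in_setD in_setC => -> ->.
  have fP v : v \notin S -> v \notin Q -> f v \in S /\ adj v (f v).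
    by move=> vS vQ; apply: fS; apply: inE'.
  (* Here [S] misses [Q]. The exceptional path lists [Q], then [c], then its partner [s0]. *)
  have [c cC cS] : exists2 c, c \in C & c \notin S.
    have [aS|aS] := boolP (a \in S); last by exists a.
    have [c cW] := W_ex; exists c; first exact: WC.
    by apply/negP=> cS; have := st a c aS cS; rewrite UW ?aU.
  have [s0S cs0] := fP c cS (CnQ c cC); set s0 := f c in s0S cs0.
  have s0Q : s0 \notin Q by apply: contraL s0S; apply: SQ.
  have ncs0 : c != s0 by apply: contraNneq cS => ->.
  apply: (insert_cover D_tt s0S (Z := Q) (g := f)).
  - by rewrite disjoints_subset; apply/subsetP=> v /SQ; rewrite in_setC.
  - by move=> v vS vQ; have [fvS fv] := fP v vS vQ.
  - by move=> v v' vS vQ v'S v'Q e _; apply: finj => //; apply: inE'.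
  exists (enum Q ++ [:: c; s0]); split.
  - rewrite cat_uniq enum_uniq /= !inE ncs0 /= !mem_enum orbF negb_or.
    by rewrite (CnQ c cC) s0Q.
  - move=> v; rewrite mem_cat mem_enum !in_cons in_nil orbF [RHS]in_set.
    case: (v == s0); first by rewrite /= !orbT.
    case vQ: (v \in Q) => //=; rewrite orbF; apply/eqP/andP=> [->|[vS /eqP e]].
      by rewrite eqxx.
    by apply: finj => //; apply: inE' => //; rewrite ?vQ ?CnQ.
  - apply: (@sorted_Q _ c) => //=; first by rewrite succC.
    by move=> q qQ _; apply: QC.
  - by right; exists (enum Q ++ [:: c]); rewrite -cats1 -catA.
have clQ := dominators_clique D_tt D_alis dom.
have SQ v : v \in S -> v \in Q -> v = q by move=> vS vQ; apply: (stable_clique_eq st clQ).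
have SC v : v \in C -> v \notin S.
  by move=> vC; apply/negP=> vS; have := st q v qS vS; rewrite /adjacent /= QC.
have aS := SC a aC; have aU' := aU.
(* Now [S] contains [q] from [Q] and misses [C]. The extra target [a] for vertices of [W] makes up
   for [q], the only vertex of [S] outside the graph of [bip_outside_dominators]. *)
pose r := [rel v t | ((t \in S) && adj v t) || ((v \in W) && (t == a))].
have [|f [fr finj]] := @hall T r (~: (S :|: Q)).
  move=> A sA; have dA : [disjoint A & S].
    rewrite disjoints_subset; apply: subset_trans sA _; by rewrite setCS subsetUl.
  have AQ v : v \in A -> v \notin Q by move/(subsetP sA); rewrite in_setC in_setU negb_or => /andP[].
  have [e|[c]] := set_0Vmem (A :&: W).
    have AE : A \subset ~: (W :|: (Q :\ q)).
      apply/subsetP=> v vA; rewrite in_setC in_setU in_setD1 (negPf (AQ v vA)) andbF orbF.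
      by apply/negP=> vW; have := in_set0 v; rewrite -e in_setI vA vW.
    have := bip_nbr S_max (bip_outside_side qQ) AE dA.
    have -> : S :\: ~: (W :|: (Q :\ q)) = set0.
      apply/eqP; rewrite setD_eq0; apply/subsetP=> v vS; rewrite in_setC in_setU in_setD1 negb_or.
      apply/andP; split; first by apply: contraL vS => /WC; apply: SC.
      by rewrite negb_and negbK; case vQ: (v \in Q); rewrite ?orbT // (SQ v) ?eqxx.
    rewrite cards0 addn0 => le; apply: leq_trans le _; apply: subset_leq_card.
    apply/subsetP=> y; rewrite !in_set => /andP[yS /existsP[v /andP[vA vy]]].
    by apply/existsP; exists v; rewrite vA /= yS vy.
  rewrite in_setI => /andP[cA cW].
  have AE : A \subset ~: Q by apply/subsetP=> v /AQ; rewrite in_setC.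
  apply: leq_trans (bip_nbr S_max bip_outside_dominators AE dA) _.
  have -> : S :\: ~: Q = [set q].
    apply/setP=> v; rewrite in_setD in_setC negbK in_set1; apply/andP/eqP=> [[vQ vS]|->//].
    exact: SQ.
  have -> : #|stable_nbrs D S A| + #|[set q]| = #|a |: stable_nbrs D S A|.
    by rewrite cardsU1 in_set (negPf aS) cards1 addnC.
  apply: subset_leq_card; apply/subsetP=> y; rewrite in_setU1 !in_set => /orP[/eqP->|].
    by apply/existsP; exists c; rewrite cA /= cW eqxx orbT.
  move=> /andP[yS /existsP[v /andP[vA vy]]].
  by apply/existsP; exists v; rewrite vA /= yS vy.
have inE' v : v \notin S -> v \notin Q -> v \in ~: (S :|: Q).
  by rewrite in_setC in_setU negb_or => -> ->.
have fP v : v \notin S -> v \notin Q -> f v \in S /\ adj v (f v) \/ v \in W /\ f v = a.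
  by move=> vS vQ; have /orP[/andP[]|/andP[vW /eqP]] := fr v (inE' v vS vQ); [left|right].
have f_inj v v' : v \notin S -> v \notin Q -> v' \notin S -> v' \notin Q -> f v = f v' -> v = v'.
  by move=> vS vQ v'S v'Q; apply: finj; apply: inE'.
have [s0S as0] : f a \in S /\ adj a (f a).
  by case: (fP a aS (CnQ a aC)) => // -[aW]; have := UnW aU'; rewrite aW.
set s0 := f a in s0S as0.
(* The vertex matched to [a], if any, accompanies [a] on the path of [s0]; below, [tl] is the list
   of this at most one vertex. *)
pose g v := if f v == a then s0 else f v.
have ZS v : v \notin S -> v \notin Q :\ q -> v \notin Q.
  move=> vS; rewrite in_setD1 negb_and negbK => /orP[/eqP e|//].
  by rewrite e qS in vS.
have [tl [utl tlP tlW]] : exists tl, [/\ uniq tl,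
    forall v, (v \in tl) = [&& v \notin S, v \notin Q & f v == a] &
    tl = [::] \/ exists2 c, c \in W & tl = [:: c]].
  case: (pickP [pred v | [&& v \notin S, v \notin Q & f v == a]]) => [c /= /and3P[cS cQ /eqP fc]|nc].
    exists [:: c]; split=> //; last first.
      by right; exists c => //; case: (fP c cS cQ) => [[]|[]//]; rewrite fc (negPf aS).
    move=> v; rewrite inE; apply/eqP/and3P=> [->|[vS vQ /eqP fv]]; first by rewrite fc.
    by apply: f_inj; rewrite ?fv.
  by exists [::]; split=> //; [move=> v; rewrite in_nil; have /= -> := nc v|left].
have tlC v : v \in tl -> v \in C.
  by case: tlW => [->|[c cW ->]] //; rewrite inE => /eqP->; apply: WC.
have tla : a \notin tl by rewrite tlP -/s0 (_ : (s0 == a) = false) ?andbF //; apply: contraNF aS => /eqP<-.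
have nas0 : a != s0 by apply: contraNneq aS => ->.
apply: (insert_cover D_tt s0S (Z := Q :\ q) (g := g)).
- rewrite disjoints_subset; apply/subsetP=> v; rewrite in_setD1 in_setC => /andP[vq vQ].
  by apply: contraNN vq => vS; rewrite (SQ v).
- move=> v vS /(ZS v vS) vQ; rewrite /g; case: eqP => [_|fva]; first by rewrite eqxx.
  by case: (fP v vS vQ) => [[]|[_ /fva]].
- move=> v v' vS /(ZS v vS) vQ v'S /(ZS v' v'S) v'Q; rewrite /g.
  case: eqP => [_ _|_]; first by rewrite eqxx.
  by case: eqP => [_ ->|_ e _]; [rewrite eqxx|apply: f_inj].
have inF v : v \in [set v | [|| v == s0, v \in Q :\ q | [&& v \notin S, v \notin Q :\ q & g v == s0]]] =
    [|| v == s0, v \in Q :\ q, v == a | v \in tl].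
  rewrite in_set; case: (v == s0) => //=; case vZ: (v \in Q :\ q) => //=; rewrite tlP.
  case vS: (v \in S) => /=.
    by rewrite orbF; apply/esym; apply: contraTF vS => /eqP->.
  have vQ := ZS v (negbT vS) (negbT vZ); rewrite vQ /= /g.
  case: (f v == a) => /=; first by rewrite orbT eqxx.
  rewrite orbF; apply/eqP/eqP=> [e|->//]; apply: f_inj => //; by rewrite ?vS ?CnQ.
have ZQ : Q :\ q \subset Q by apply: subsetDl.
have tl_adj : path D a tl /\ sorted D (tl ++ [:: a; s0]) = D a s0.
  case: tlW => [->|[c cW ->]] /=; first by rewrite andbT.
  have ac := UW aU' cW; have cC := WC cW.
  have ca : adj c a by rewrite adjC.
  by rewrite (digonC aC cC ac) (digonC cC aC ca) !andbT.
have sQtl : uniq (enum (Q :\ q) ++ tl).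
  rewrite cat_uniq enum_uniq utl andbT /=; apply/hasPn=> v /tlC vC; rewrite mem_enum.
  by apply: contraNN (CnQ v vC); apply: (subsetP ZQ).
have aQ := CnQ a aC.
(* If [a] is matched to [q], the path has to start there: [q], the rest of [Q], [a], [tl]. Otherwise
   it ends at [s0]: the rest of [Q], [tl], [a], [s0]. *)
have [es0|ns0] := eqVneq s0 q.
  exists (q :: (enum (Q :\ q) ++ a :: tl)); split.
  - have -> : uniq (q :: enum (Q :\ q) ++ a :: tl) = uniq (q :: a :: (enum (Q :\ q) ++ tl)).
      apply: perm_uniq; rewrite perm_cons perm_sym -cat1s perm_catCA /=; exact: perm_refl.
    rewrite /= sQtl andbT !inE !mem_cat !mem_enum in_setD1 eqxx /= (negPf tla) orbF.
    rewrite in_setD1 (negPf aQ) andbF /= andbT negb_or eq_sym -es0 nas0 /= es0.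
    by apply/negP=> /tlC qC; have := CnQ q qC; rewrite qQ.
  - by move=> v; rewrite inF in_cons mem_cat mem_enum in_cons es0.
  - rewrite -cat1s; apply: (@sorted_cat_all _ _ _ _ a) => //.
      apply: (@sorted_Q _ a) => //=; first by case: tl_adj.
      by move=> p pQ _; apply: QC.
    move=> p; rewrite inE => /eqP->; case E: (enum (Q :\ q)) => [|y l] /=; first exact: QC.
    have : y \in enum (Q :\ q) by rewrite E mem_head.
    rewrite mem_enum in_setD1 => /andP[yq yQ].
    by apply: (dominators_digon D_tt D_alis dom); rewrite // eq_sym.
  - by left; rewrite es0; exists (enum (Q :\ q) ++ a :: tl).
have s0Q : s0 \notin Q by apply: contra ns0 => s0Q; rewrite (SQ s0).
exists (enum (Q :\ q) ++ (tl ++ [:: a; s0])); split.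
- rewrite catA uniq_catC /= inE negb_or nas0 mem_cat !mem_enum !mem_cat !mem_enum sQtl.
  rewrite in_setD1 (negPf aQ) andbF (negPf tla) in_setD1 (negPf s0Q) andbF /= andbT.
  by apply/negP=> /tlC s0C; have := SC s0 s0C; rewrite s0S.
- move=> v; rewrite inF !mem_cat mem_enum !in_cons in_nil orbF.
  by case: (v == s0); case: (v == a); case: (v \in tl); case: (v \in Q :\ q).
- apply: (@sorted_Q _ a) => //; first by case: tl_adj => _ ->; apply: succC.
  by move=> p pQ _; apply: QC => //; case: tlW => [->|[c cW ->]] //=; apply: WC.
- by right; exists (enum (Q :\ q) ++ (tl ++ [:: a])); rewrite -cats1 -!catA.
Qed.

End Bipartite.

Lemma dominated_false : False.
Proof.
have [/forallP cl|] := boolP [forall p in C, forall p' in C, (p != p') ==> adj p p'].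
  apply: dominated_clique_false => p p' pC p'C pp'.
  by have := cl p; rewrite pC => /forallP/(_ p'); rewrite p'C pp'.
rewrite negb_forall => /existsP[p]; rewrite negb_imply negb_forall => /andP[pC /existsP[p']].
rewrite negb_imply negb_imply => /and3P[p'C pp' npp'].
exact: dominated_bipartite_false pC p'C pp' npp'.
Qed.

End DominatedCore.

(** * Kings *)

Lemma mod_offset k a b : 0 < k -> exists2 e, e < k & a + e = b %[mod k].
Proof.
move=> k0; exists ((b + (k - a %% k)) %% k); first exact: ltn_pmod.
have le : a %% k <= k by apply/ltnW/ltn_pmod.
by rewrite modnDmr addnC -modnDmr -addnA subnK // modnDr.
Qed.

Section Kings.

Variables (T : finType) (D : rel T).
Hypothesis D_irr : irreflexive D.
Hypothesis D_tt : transitive_triangle_free D.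
Hypothesis D_alis : arc_locally_in_semicomplete D.
Hypothesis IH : forall W : {set T}, W \proper setT -> BEon D W.
Hypothesis nBE : ~ BEon D setT.
Hypothesis nodom : forall x u w, ~ dominated D x u w.

Local Notation adj := (adjacent D).
Let alis := alis D_alis.

Definition kings := [set y | [forall v, connect D y v]].

Local Notation B := kings.

Lemma kingP y : reflect (forall v, connect D y v) (y \in B).
Proof. by rewrite inE; apply: forallP. Qed.

Lemma kings_closed : pred_closed D B.
Proof.
by move=> a b ab /kingP h; apply/kingP=> v; apply: connect_trans (connect1 ab) (h v).
Qed.

Lemma bad_king y : bad D y -> y \in B.
Proof.
move=> /(bad_cases D_irr D_tt D_alis)[ini|[x [u [w [/nodom]]]]] //.
by apply/kingP; apply: initial_king D_alis IH nBE y ini.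
Qed.

Lemma kings_core : core D B.
Proof. by split; [apply: bad_king|apply: kings_closed]. Qed.

(** Upper bounds on [B] come from here: each king reaches [p], and closure under in-neighbours leads
    back from [p] to it. *)
Lemma kings_sub (P : {set T}) p : p \in P -> pred_closed D P -> B \subset P.
Proof.
by move=> pP Pp; apply/subsetP=> y /kingP/(_ p) yp; apply: pred_closed_connect yp pP.
Qed.

Lemma kings_no_digon r m z : r \in B -> m \notin B ->
  D r m -> D r z -> D m z -> D z m -> False.
Proof.
move=> rB /negP mB rm rz mz zm; apply: mB; apply: bad_king; right.
by exists z, r; split=> //; left.
Qed.

Lemma out_kings b z : b \in B -> z \notin B -> D z b = false.
Proof. exact: (out_R kings_closed). Qed.

Lemma out_digon z u w : z \notin B -> u \in B -> w \in B -> adj u w -> D u z -> D w z ->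
  D u w /\ D w u.
Proof.
move=> zB; suff H a b : a \in B -> b \in B -> D a z -> D b z -> D a b -> D b a.
  move=> uB wB /orP[uw|wu] uz wz; split=> //; exact: H uw || exact: H wu.
move=> aB bB az bz ab; have [//|h|h] := or3P (D_tt ab bz az); by rewrite out_kings in h.
Qed.

(** No edge returns to [B] from outside, so by [D_tt] an edge of [B] with a common out-neighbour [z]
    outside is a digon; the defining condition spreads this to all in-neighbours of [z]. *)
Lemma common_succ z u w : z \notin B -> u \in B -> w \in B -> adj u w -> D u z -> D w z ->
  forall y, D y z -> y \in B /\ (y != u -> D y u /\ D u y).
Proof.
move=> zB uB wB uw uz wz y yz; have [uw' wu'] := out_digon zB uB wB uw uz wz.
have yB : y \in B.
  apply: contraT => yB.
  have uy := alis_out D_alis kings_closed uB yB uw' wz yz.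
  by case: (no_triangle_out D_tt kings_closed kings_no_digon uB yB zB uy yz uz).
split=> // yu; have [h|h] := alis uw' wz yz; last by rewrite h eqxx in yu.
by have [] := out_digon zB uB yB h uz yz.
Qed.

Lemma common_succ_clique z u w : z \notin B -> u \in B -> w \in B -> adj u w -> D u z -> D w z ->
  forall y y', D y z -> D y' z -> y != y' -> D y y' /\ D y' y.
Proof.
move=> zB uB wB uw uz wz y y' yz y'z ne.
have [yB hu] := common_succ zB uB wB uw uz wz yz.
have [e|/hu[yu uy]] := eqVneq y u.
  by rewrite e in ne *; have [_ []] := common_succ zB uB wB uw uz wz y'z; rewrite 1?eq_sym.
have yu' : adj y u by rewrite /adjacent /= yu.
by have [_ []] := common_succ zB yB uB yu' yz uz y'z; rewrite 1?eq_sym.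
Qed.

Lemma pair_closed p c : p \in B -> (forall a, D a p -> a = c) -> (forall a, D a c -> a = p) ->
  #|B| <= 2.
Proof.
move=> pB hp hc; have : B \subset [set p; c].
  apply: (@kings_sub _ p); first by rewrite !inE eqxx.
  move=> a b ab; rewrite !inE => /orP[/eqP e|/eqP e]; rewrite e in ab.
    by rewrite (hp a ab) eqxx orbT.
  by rewrite (hc a ab) eqxx.
by move/subset_leq_card/leq_trans; apply; rewrite cards2; case: (_ != _).
Qed.

Lemma king_pred b : b \in B -> 1 < #|B| -> exists p, D p b.
Proof.
move=> bB; rewrite (cardsD1 b) bB add1n ltnS => /card_gt0P[b']; rewrite !in_setD1 => /andP[ne b'B].
have /kingP/(_ b)/connect_walk[[|n]] := b'B.
  by move=> /eqP e; rewrite e eqxx in ne.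
by move=> /existsP[p /andP[_ pb]]; exists p.
Qed.

(** Unless no edge leaves [B], the set [K] for [pred_closed_clique_false] is the in-neighbourhood of
    an outer vertex. One with two in-neighbours in [B] serves directly. If there is none, at most
    two kings make [D] bipartite, and with three or more there is an outer vertex with exactly one
    in-neighbour in all. *)
Lemma kings_clique_false : clique D B -> False.
Proof.
move=> clB; have coreB := kings_core.
have [Pz|noP] := boolP [exists z, exists u, exists w,
    [&& z \notin B, u != w, D u z, D w z, u \in B & w \in B]].
  case/existsP: Pz => z /existsP[u /existsP[w /and5P[zB ne uz wz /andP[uB wB]]]].
  have uw := clB u w uB wB ne.
  have cs := common_succ zB uB wB uw uz wz; have cc := common_succ_clique zB uB wB uw uz wz.
  apply: (pred_closed_clique_false D_irr D_tt D_alis IH nBE coreB clB (K := [set p | D p z]) (y0 := z)).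
  - by apply/subsetP=> p; rewrite inE => /cs[].
  - by apply/set0Pn; exists u; rewrite inE.
  - move=> c; rewrite inE => cz; have [e|cu] := eqVneq c u.
      exists w; last by left; rewrite inE.
      by rewrite e; have [_] := cc _ _ uz wz ne.
    by exists u; [have [] := cc _ _ cz uz cu|left; rewrite inE].
  - by rewrite inE zB eqxx.
have uniqP z u w : z \notin B -> u \in B -> w \in B -> D u z -> D w z -> u = w.
  move=> zB uB wB uz wz; apply/eqP; apply: contraNT noP => ne.
  apply/existsP; exists z; apply/existsP; exists u; apply/existsP; exists w.
  by rewrite zB ne uz wz uB wB.
have B3 : 2 < #|B|.
  rewrite ltnNge; apply/negP=> B2; apply: nBE; apply: (bip_BE D_tt).
  apply: (core_bip D_irr D_tt D_alis coreB).
    have [e|[b bB]] := set_0Vmem B; first by exists xpredT => p q; rewrite e !inE andbF.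
    exists (fun p => p == b) => p q; rewrite !in_setI !in_setT /= => pB qB pq.
    have npq : p != q by apply: contraTneq pq => ->; rewrite adjxx.
    have [ep|nep] := eqVneq p b; first by rewrite -ep [q == p]eq_sym (negPf npq).
    have [//|neq] := eqVneq q b; have : #|[set p; q; b]| <= #|B|.
      by apply: subset_leq_card; rewrite !subUset !sub1set pB qB bB.
    by rewrite -setUA cardsU1 cards2 !inE negb_or npq nep neq /= => /leq_trans/(_ B2).
  move=> u w z; rewrite !in_setI !in_setT /= => uB wB _ zB uw _ uz wz.
  by rewrite (uniqP z u w) // D_irr in uw.
have [/existsP[c /existsP[w /and3P[cB wB cw]]]|] :=
    boolP [exists c, exists w, [&& c \in B, w \notin B & D c w]]; last first.
  rewrite negb_exists => /forallP nex.
  have [b bB] : exists b, b \in B by apply/card_gt0P; apply: leq_trans B3.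
  have Bsucc p q : connect D p q -> p \in B -> q \in B.
    move=> /connectP[l pl ->]; elim: l p pl => [|a l IHl] p //= /andP[pa al] pB.
    apply: (IHl a) => //; have := nex p; rewrite negb_exists => /forallP/(_ a).
    by rewrite pB pa andbT negbK.
  apply: nBE; apply: (clique_BE D_irr D_tt); suff <- : B = setT by [].
  by apply/setP=> v; rewrite in_setT; have /kingP bk := bB; exact: Bsucc (bk v) bB.
have [y [k [yB kB yk]]] : exists y k, [/\ y \notin B, k \in B & forall p, D p y = (p == k)].
  have sub y c' : y \notin B -> c' \in B -> D c' y -> (forall p, D p y -> p \in B) ->
      exists y k, [/\ y \notin B, k \in B & forall p, D p y = (p == k)].
    move=> yB c'B c'y h; exists y, c'; split=> // p; apply/idP/eqP=> [py|->//].
    by apply: (uniqP y) => //; apply: h.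
  have [/forallP h|] := boolP [forall p, D p w ==> (p \in B)].
    by apply: (sub w c) => // p; apply/implyP.
  rewrite negb_forall => /existsP[y]; rewrite negb_imply => /andP[yw yB].
  have toy p : D p c -> D p y.
    by move=> pc; apply: (alis_out D_alis kings_closed (kings_closed pc cB) yB pc cw yw).
  have [p pc] := king_pred cB (ltnW B3); have pB := kings_closed pc cB; have py := toy p pc.
  apply: (sub y p) => // y' y'y; apply: contraT => y'B.
  have cy' : D c y'.
    have [|e] := alis y'y yw cw; first by rewrite adjC; exact: (adj_out kings_closed cB y'B).
    by rewrite e cB in y'B.
  have le : #|B| <= 2; last by move: (leq_trans B3 le).
  apply: (pair_closed pB) => q qp.
    have qB := kings_closed qp pB.
    exact: (uniqP y' q c y'B qB cB (alis_out D_alis kings_closed qB y'B qp py y'y) cy').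
  by apply: (uniqP y) => //; [apply: kings_closed qp cB|apply: toy].
apply: (pred_closed_clique_false D_irr D_tt D_alis IH nBE coreB clB (K := [set k]) (y0 := y)).
- by rewrite sub1set.
- by apply/set0Pn; exists k; rewrite inE.
- move=> c'; rewrite inE => /eqP-> {c'}.
  have [/existsP[k2 /andP[k2k /existsP[r /andP[rk2 rk]]]]|nex] :=
      boolP [exists k2, D k2 k && [exists r, D r k2 && (r != k)]].
    by exists k2 => //; right; exists r => //; rewrite inE.
  have hk k2 r : D k2 k -> D r k2 -> r = k.
    move=> k2k rk2; apply/eqP; apply: contraNT nex => rk.
    by apply/existsP; exists k2; rewrite k2k /=; apply/existsP; exists r; rewrite rk2.
  have [k2 k2k] := king_pred kB (ltnW B3).
  have le : #|B| <= 2; last by move: (leq_trans B3 le).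
  apply: (pair_closed kB (c := k2)) => q qk; last exact: hk k2k qk.
  apply/eqP; apply: contraT => ne.
  have := clB q k2 (kings_closed qk kB) (kings_closed k2k kB) ne.
  by move=> /orP[/(hk _ _ k2k) e|/(hk _ _ qk) e]; [rewrite e D_irr in qk|rewrite e D_irr in k2k].
- by rewrite inE yB; apply/eqP/setP=> p; rewrite !inE yk.
Qed.

(** A digon dominated by z consists of kings, so it reaches z, which gives closed walks of both
    parities. A digon dominating z has no further in-neighbours, so it contains [B], which is then a
    clique. Without either, [D] is bipartite. *)
Lemma no_odd_false : (forall x, ~ odd_at D x) -> False.
Proof.
move=> noodd; apply: nBE; apply: (bip_BE D_tt); apply: (bip_criterion D_irr D_tt D_alis).
  move=> n x on; apply/negP=> wk; apply: (noodd x); exists n => //.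
  by apply: sub_walk wk => a b /and3P[].
have par y n : walk D n y y -> walk D n.+1 y y -> False.
  move=> w1 w2; apply: (noodd y); have [on|on] := boolP (odd n); first by exists n.
  by exists n.+1.
have dom z u w : D u w -> D w u -> D z u -> D z w -> False.
  move=> uw wu zu zw; have uB : u \in B by apply: bad_king; right; exists w, z; split=> //; left.
  have /kingP/(_ z)/connect_walk[n uz] := uB.
  by apply: (par u n.+1); [apply: walkSr uz zu|apply: walkSr (walkSr uz zw) wu].
move=> u w z _ _ _ uw wu; apply/andP; split; apply/negP=> /andP[].
  exact: dom uw wu.
move=> uz wz; have uB : u \in B by apply: bad_king; right; exists w, z; split=> //; right.
have wB := kings_closed wu uB.
have zB : z \notin B.
  apply/negP=> /kingP/(_ u)/connect_walk[n zu].
  by apply: (par u n.+1); [apply: walkSl uz zu|apply: walkSl uw (walkSl wz zu)].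
have only a b p : D a b -> D b a -> D a z -> D b z -> D p a -> p = b.
  move=> ab ba az bz pa; have [/orP[pb|bp]|//] := alis pa az bz.
    by case: (dom p a b).
  by case: (noodd b); exists 3 => //; apply: walkSl bp (walkSl pa (walk1 ab)).
have sub : B \subset [set u; w].
  apply: (@kings_sub _ u); first by rewrite !inE eqxx.
  move=> a b ab; rewrite !inE => /orP[/eqP e|/eqP e]; rewrite e in ab.
    by rewrite (only u w a) // eqxx orbT.
  by rewrite (only w u a) // eqxx.
apply: kings_clique_false => a b /(subsetP sub) + /(subsetP sub).
rewrite !inE => /orP[/eqP->|/eqP->] /orP[/eqP->|/eqP->]; by rewrite ?eqxx // /adjacent /= uw ?orbT.
Qed.

(** * Cyclic blow-ups of odd length *)

Section Blowup.

Variables (k : nat) (X : nat -> {set T}).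
Hypotheses (k_odd : odd k) (k_gt1 : 1 < k).
Hypothesis X_per : forall i, X (i + k) = X i.
Hypothesis XX : forall i, {in X i & X i.+1, forall x y, D x y}.
Hypothesis X_adj : forall i j x y, x \in X i -> y \in X j -> D x y ->
  j = i.+1 %[mod k] \/ i = j.+1 %[mod k].
Hypothesis X_uniq : forall i j x, x \in X i -> x \in X j -> i = j %[mod k].
Hypothesis XsubB : forall i x, x \in X i -> x \in B.
Hypothesis BX : forall x, x \in B -> exists i, x \in X i.
Hypothesis noP : forall u w z, u \in B -> w \in B -> z \notin B ->
  D u w -> D w u -> D u z -> D w z -> False.

Let k_gt0 : 0 < k := ltnW k_gt1.

Lemma X_mod i j : i = j %[mod k] -> X i = X j.
Proof.
have XM n m : X (n + m * k) = X n.
  by elim: m => [|m IHm]; [rewrite mul0n addn0|rewrite mulSn addnCA addnC X_per].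
by move=> e; rewrite (divn_eq i k) (divn_eq j k) -e ![_ * k + _]addnC !XM.
Qed.

(** Without one class the cyclic order of classes becomes linear, and the parity of the offset from
    [i] is a colouring, whatever the direction of the edges. *)
Lemma bip_outside_class i : bipartite D (~: X i).
Proof.
apply: (core_bip D_irr D_tt D_alis kings_core); last first.
  move=> u w z; rewrite !in_setI => /andP[_ uB] /andP[_ wB] _; exact: noP.
pose col x := if [pick o : 'I_k | x \in X (i + o)] is Some o then odd o else false.
have colP x : x \in ~: X i :&: B ->
    exists o, [/\ 0 < o, o < k, x \in X (i + o) & col x = odd o].
  rewrite in_setI in_setC => /andP[xi xB]; have [j xj] := BX xB.
  have [o lt /X_mod e] := mod_offset i j k_gt0.
  rewrite /col; case: pickP => [o' xo'|/(_ (Ordinal lt))] /=; last by rewrite e xj.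
  exists o'; split=> //; rewrite lt0n; apply: contraNneq xi => e0.
  by rewrite e0 addn0 in xo'.
have key a b : 0 < a -> a < k -> 0 < b -> b < k -> i + b = (i + a).+1 %[mod k] -> b = a.+1.
  move=> a0 ak b0 bk /eqP; rewrite -addnS eqn_modDl (modn_small bk).
  have [lt|] := ltnP a.+1 k; first by rewrite modn_small // => /eqP.
  move=> le; have -> : a.+1 = k by apply/eqP; rewrite eqn_leq ak le.
  by rewrite modnn (gtn_eqF b0).
exists col => x y /colP[a [a0 ak xa ->]] /colP[b [b0 bk yb ->]] /orP[] xy.
  by case: (X_adj xa yb xy) => /key-> //=; case: (odd _).
by case: (X_adj yb xa xy) => /key-> //=; case: (odd _).
Qed.

(* As k is odd, two consecutive classes avoid the stable set S. *)
Lemma blowup_false : False.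
Proof.
apply: nBE => S S_max; have st := S_stable S_max.
pose f i := X i :&: S == set0.
have [/existsP[[i /= ik] /andP[fi fi1]]|nex] := boolP [exists i : 'I_k, f i && f i.+1].
  have ne : i <> i.+1 %[mod k].
    by apply/eqP; rewrite -addn1 -[X in X == _ %[mod _]]addn0 eqn_modDl mod0n modn_small.
  have dS j : f j -> [disjoint X j & S] by rewrite -setI_eq0.
  apply: (two_level_cover D_tt S_max (dS _ fi) (dS _ fi1)).
  - rewrite -setI_eq0; apply/eqP/setP=> x; rewrite in_setI in_set0; apply/negP=> /andP[xi xi1].
    exact: ne (X_uniq xi xi1).
  - exact: XX.
  (* An in-neighbour [s] of [y] lies in a class next to that of [y]. Class [i] avoids [S], so it is
     the following class, and the edge from [y] to [s] is present too. *)
  - move=> y s yX sS /orP[//|sy].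
    have yB := XsubB yX.
    have [j sj] := BX (kings_closed sy yB).
    have [e|e] := X_adj sj yX sy.
      have : s \in X i :&: S.
        rewrite in_setI sS andbT; suff <- : X j = X i by [].
        apply: X_mod; move/eqP: e; rewrite -addn1 -[j.+1]addn1 eqn_modDr => /eqP->.
        by [].
      by rewrite (eqP fi) in_set0.
    by apply: (XX yX); rewrite -(X_mod e).
  - exact: bip_outside_class.
  - exact: bip_outside_class.
have alt i : i < k -> f i.+1 = ~~ f i.
  move=> ik; case fi: (f i) => /=.
    by apply: contraNF nex => fi1; apply/existsP; exists (Ordinal ik); rewrite fi.
  apply/negPn/negP=> fi1; move/negbT/set0Pn: fi => [x]; move/set0Pn: fi1 => [y].
  rewrite !in_setI => /andP[yX yS] /andP[xX xS].
  by have := st x y xS yS; rewrite /adjacent /= (XX xX yX).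
have al i : i <= k -> f i = odd i (+) f 0.
  by elim: i => [|i IHi] // ik; rewrite alt // IHi 1?ltnW //=; case: (odd i); case: (f 0).
by have := al k (leqnn k); rewrite {1}/f -[k]add0n X_per -/(f 0) add0n k_odd; case: (f 0).
Qed.

End Blowup.

End Kings.

(** * Shortest odd closed walk of length at least five *)

Section LongOddCycle.

Variables (T : finType) (D : rel T).
Hypothesis D_irr : irreflexive D.
Hypothesis D_tt : transitive_triangle_free D.
Hypothesis D_alis : arc_locally_in_semicomplete D.

Let alis := alis D_alis.

Variable k : nat.
Hypotheses (k_odd : odd k) (k_ge5 : 5 <= k).
Hypothesis k_min : forall j x, odd j -> j < k -> ~~ walk D j x x.

Definition min_cycle (z : nat -> T) : Prop :=
  (forall i, D (z i) (z i.+1)) /\ (forall i, z (i + k) = z i).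

Lemma periodic_mod (z : nat -> T) i j : (forall i, z (i + k) = z i) ->
  i = j %[mod k] -> z i = z j.
Proof.
move=> per; have XM n m : z (n + m * k) = z n.
  by elim: m => [|m IHm]; [rewrite mul0n addn0|rewrite mulSn addnCA addnC per].
by move=> e; rewrite (divn_eq i k) (divn_eq j k) -e ![_ * k + _]addnC !XM.
Qed.

Section OneCycle.

Variable z : nat -> T.
Hypothesis zC : min_cycle z.

Let step i : D (z i) (z i.+1) := zC.1 i.
Let per i : z (i + k) = z i := zC.2 i.

Lemma cycle_walk i m : walk D m (z i) (z (i + m)).
Proof. by apply: fun_walk => j _ _; apply: step. Qed.

Lemma cycle_walk_back i e : e <= k -> walk D (k - e) (z (i + e)) (z i).
Proof. by move=> le; rewrite -[in z i](per i) -{2}(subnKC le) addnA; apply: cycle_walk. Qed.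

Lemma cycle_inj i e : e < k -> z i = z (i + e) -> e = 0.
Proof.
move=> lt e_eq; have [oe|oe] := boolP (odd e).
  by have := k_min (z i) oe lt; rewrite {2}e_eq cycle_walk.
have ok : odd (k - e) by rewrite (oddB (ltnW lt)) k_odd (negPf oe).
have [//|e0] := posnP e; have lt' : k - e < k by rewrite ltn_subrL e0; lia.
by have := k_min (z i) ok lt'; rewrite {1}e_eq cycle_walk_back // ltnW.
Qed.

(** The chord and [k - e] edges of the cycle form a closed walk of odd length [(k - e).+1], which
    cannot be less than [k]. *)
Lemma chord_odd m e : e < k -> odd e -> D (z m) (z (m + e)) -> e = 1.
Proof.
move=> lt oe ze; apply/eqP; rewrite eqn_leq odd_gt0 // andbT leqNgt; apply/negP=> e1.
have := @k_min (k - e).+1 (z m); rewrite oddS (oddB (ltnW lt)) k_odd oe => /(_ isT).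
rewrite (walkSl ze (cycle_walk_back m (ltnW lt))) => h.
have lt' : (k - e).+1 < k by lia.
by have := h lt'.
Qed.

(** The defining condition joins [z m] to [z (m + e)]; pointing the other way, the edge would be an
    odd chord of offset [k - e], contradicting [chord_odd]. *)
Lemma chord_down m e : e.+2 < k -> 0 < e -> ~~ odd e -> D (z m) (z (m + e.+2)) ->
  D (z m) (z (m + e)).
Proof.
rewrite !addnS => lt e0 oe ze.
have [/orP[zm|//]|e_eq] := alis (step (m + e)) (step (m + e).+1) ze; last first.
  by have := cycle_inj (ltac:(lia) : e < k) (esym e_eq); lia.
have : k - e = 1; last by lia.
apply: (@chord_odd (m + e)); rewrite ?oddB ?k_odd //; try lia.
by rewrite (_ : m + e + (k - e) = m + k) ?per //; lia.
Qed.

Lemma chord_even m f t : ~~ odd f -> 0 < f -> f + t.*2 < k -> D (z m) (z (m + (f + t.*2))) ->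
  D (z m) (z (m + f)).
Proof.
move=> of_ f0; elim: t => [|t IHt]; first by rewrite addn0.
rewrite doubleS !addnS => lt ze; apply: IHt; first by lia.
apply: chord_down; rewrite ?oddD ?odd_double ?addbF ?addnS //; lia.
Qed.

Lemma back_chord m f : D (z m.+1) (z m) -> ~~ odd f -> 0 < f -> f < k ->
  D (z m.+1) (z (m.+1 + f)).
Proof.
move=> zm of_ f0 fk; have [t e] : exists t, k.-1 = f + t.*2.
  exists (k.-1 - f)./2; rewrite -[RHS]addn0 even_halfK; first by lia.
  by rewrite oddB; [case: (k) k_odd k_ge5 => //= n /negPf-> _; rewrite (negPf of_)|lia].
apply: (chord_even of_ f0 (t := t)); first by lia.
by rewrite -e; rewrite (_ : m.+1 + k.-1 = m + k) ?per //; lia.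
Qed.

Lemma no_triangle a b c : D a b -> D b c -> D c a -> False.
Proof.
move=> ab bc ca; have := @k_min 3 a isT ltac:(lia).
by rewrite (walkSl ab (walkSl bc (walk1 ca))).
Qed.

(** A reverse edge is a chord of even offset [k - 1], so it entails chords of all smaller even
    offsets. The one of offset two forces by [D_tt] a reverse edge one or two places further on, and
    two reverse edges at distance two create a directed triangle. *)
Lemma no_digon_step m : D (z m.+1) (z m) = false.
Proof.
have next n : D (z n.+1) (z n) -> D (z n.+2) (z n.+1) \/ D (z n.+3) (z n.+2).
  move=> zn; have c2 : D (z n.+1) (z n.+3).
    by have := back_chord zn (f := 2) isT isT ltac:(lia); rewrite addn2.
  have [h|h|h] := or3P (D_tt (step n.+1) (step n.+2) c2); [by left|by right|].
  by case: (no_triangle (step n.+1) (step n.+2) h).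
have gap n : D (z n.+1) (z n) -> D (z n.+3) (z n.+2) -> False.
  move=> zn zn2; have c2 : D (z n.+1) (z n.+3).
    by have := back_chord zn (f := 2) isT isT ltac:(lia); rewrite addn2.
  have ok : ~~ odd (k - 3) by rewrite oddB ?k_odd //; lia.
  have := back_chord zn2 ok ltac:(lia) ltac:(lia).
  rewrite (_ : n.+3 + (k - 3) = n + k) ?per; last by lia.
  by move=> h; apply: no_triangle c2 h (step n).
apply/negP=> zm; have [h1|h1] := next _ zm; last exact: gap zm h1.
by have [h2|h2] := next _ h1; [exact: gap zm h2|exact: gap h1 h2].
Qed.

Lemma chord_off m e : e < k -> D (z m) (z (m + e)) -> e = 1.
Proof.
move=> lt ze; have [oe|oe] := boolP (odd e); first exact: chord_odd ze.
have [e0|e0] := posnP e; first by rewrite e0 addn0 D_irr in ze.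
have c2 : D (z m) (z m.+2).
  have [t et] : exists t, e = 2 + t.*2.
    exists (e - 2)./2; rewrite even_halfK ?oddB // ?(negPf oe) //; move: oe e0; case: (e) => [|[|n]] //; lia.
  rewrite -addn2; apply: (chord_even _ _ (t := t)) => //; rewrite -et //.
have [h|h|h] := or3P (D_tt (step m) (step m.+1) c2).
- by rewrite no_digon_step in h.
- by rewrite no_digon_step in h.
- by case: (no_triangle (step m) (step m.+1) h).
Qed.

Lemma chord a b : D (z a) (z b) -> b = a.+1 %[mod k].
Proof.
have [e lt ab] := mod_offset a b (ltac:(lia) : 0 < k).
by rewrite -(periodic_mod per ab) -ab => /(chord_off lt) ->; rewrite addn1.
Qed.

(** Going one step back from one in-neighbour gives a vertex adjacent or equal to the other, so
    offsets between the two are 0, -1 or -2 modulo [k], in either order. As [k] is at least five,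
    only 0 remains. *)
Lemma pred_uniq y a b : D (z a) y -> D (z b) y -> a = b %[mod k].
Proof.
have k0 : 0 < k by lia.
have half c d : d < k -> D (z c) y -> D (z (c + d)) y -> [\/ d = 0, d = k - 2 | d = k.-1].
  move=> lt zc zd; have zc' : D (z (c + k.-1).+1) y.
    by rewrite (_ : (c + k.-1).+1 = c + k) ?per //; lia.
  have ed : z (c + d) = z ((c + k.-1) + d.+1).
    by rewrite (_ : c + k.-1 + d.+1 = c + d + k) ?per //; lia.
  rewrite ed in zd; have [/orP[h|h]|h] := alis (step (c + k.-1)) zc' zd.
  - have [lt1|ge1] := ltnP d.+1 k; last by apply: Or33; lia.
    by have := chord_off lt1 h; constructor 1; lia.
  - have [lt1|ge1] := ltnP d.+1 k; last by apply: Or33; lia.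
    have : k - d.+1 = 1; last by move=> e; constructor 2; lia.
    apply: (@chord_off (c + k.-1 + d.+1)); first by lia.
    by rewrite (_ : c + k.-1 + d.+1 + (k - d.+1) = c + k.-1 + k) ?per //; lia.
  - have [lt1|ge1] := ltnP d.+1 k; last by apply: Or33; lia.
    by have := cycle_inj lt1 h.
have [d lt ab] := mod_offset a b k0; rewrite -ab.
move=> za; rewrite -(periodic_mod per ab) => zb.
have [->|d0] := posnP d; first by rewrite addn0.
have za' : D (z (a + d + (k - d))) y.
  by rewrite (_ : a + d + (k - d) = a + k) ?per //; lia.
have := half _ _ (ltac:(lia) : k - d < k) zb za'; have := half _ _ lt za zb.
by move=> h1 h2; move: h1 h2 lt d0 k_ge5; clear; case=> ?; case=> ?; lia.
Qed.

(** An edge from [y] to [z j.+2] entails an edge between [y] and [z j]. If some [z m] points to [y],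
    it is unique, and descent in steps of two together with minimality of [k] leaves only the offset
    two. If none does, [y] dominates the entire cycle because [k] is odd, and y, z 0, z 1 violate
    [D_tt]. *)
Lemma attach y i : (forall j, y <> z j) -> D y (z i) ->
  exists2 m, D (z m) y & i = m.+2 %[mod k].
Proof.
move=> yZ yi; have k0 : 0 < k by lia.
have back j : D y (z j.+2) -> D y (z j) \/ D (z j) y.
  move=> yj; have [/orP[|]|] := alis (step j) (step j.+1) yj; [by right|by left|].
  by move=> /esym/yZ.
have [[m my]|noI] : (exists m, D (z m) y) \/ (forall m, ~~ D (z m) y).
  have [/existsP[[m _] /= my]|] := boolP [exists m : 'I_k, D (z m) y]; first by left; exists m.
  rewrite negb_exists => /forallP h; right=> m; have := h (Ordinal (ltn_pmod m k0)) => /=.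
  by rewrite (periodic_mod per (modn_mod m k)).
exists m => //.
  have par e : e < k -> D y (z (m + e)) -> ~~ odd e -> e <= 2.
    move=> lt ye oe; rewrite leqNgt; apply/negP=> e2.
    have wk := walkSl ye (cycle_walk_back m (ltnW lt)).
    have := @k_min (k - e).+2 y; rewrite (walkSr wk my) oddS oddS negbK (oddB (ltnW lt)) k_odd (negPf oe).
    by move=> /(_ isT ltac:(lia)).
  have nI d : 0 < d -> d < k -> D (z (m + d)) y = false.
    move=> d0 dk; apply/negP=> /(pred_uniq my)/eqP.
    by rewrite -[X in X == _ %[mod _]]addn0 eqn_modDl mod0n modn_small // eq_sym eqn0Ngt d0.
  have odd_no e : e < k -> odd e -> D y (z (m + e)) -> False.
    elim/ltn_ind: e => -[|[|e]] IHe // lt oe ye.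
      have ye' : D y (z (m + k.-1).+2).
        by rewrite (_ : (m + k.-1).+2 = (m + 1) + k) ?per //; lia.
      have [h|h] := back _ ye'; last by rewrite nI in h; lia.
      have := par _ (ltac:(lia) : k.-1 < k) h; case: (k) k_odd k_ge5 => //= n /negPf-> ? /(_ isT); lia.
    rewrite !addnS in ye; have [h|h] := back _ ye.
      by apply: (IHe e) h; [lia|lia|move: oe; rewrite /= negbK].
    have [e0|e0] := posnP e; first by rewrite e0 in oe.
    by rewrite nI in h; lia.
  have [e lt ie] := mod_offset m i k0; rewrite -(periodic_mod per ie) in yi.
  have [oe|oe] := boolP (odd e); first by case: (odd_no e lt oe yi).
  have le2 := par e lt yi oe; rewrite -ie; move: le2 oe yi; case: (e) => [|[|[|]]] //.
    rewrite addn0 => _ _ ym; have ym' : D y (z (m + (k - 2)).+2).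
      by rewrite (_ : (m + (k - 2)).+2 = m + k) ?per //; lia.
    have [h|h] := back _ ym'; last by rewrite nI in h; lia.
    have ok : odd (k - 2) by rewrite oddB ?k_odd //; lia.
    by case: (odd_no (k - 2) ltac:(lia) ok h).
  by rewrite addn2.
have all t j : D y (z (j + t.*2)) -> D y (z j).
  elim: t => [|t IHt]; first by rewrite addn0.
  rewrite doubleS !addnS => /back[/IHt//|h]; by have := noI (j + t.*2); rewrite h.
have allj j : D y (z j).
  have [t e] : exists t, j + t.*2 = i + (i + j) * k.
    have le : j <= i + (i + j) * k by nia.
    exists (i + (i + j) * k - j)./2; rewrite even_halfK ?subnKC //.
    by rewrite oddB // oddD oddM k_odd andbT oddD; case: (odd i); case: (odd j).
  apply: (all t); rewrite e (periodic_mod per (_ : _ = i %[mod k])) //.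
  by rewrite addnC modnMDl.
have [h|h|h] := or3P (D_tt (allj 0) (step 0) (allj 1)).
- by have := noI 0; rewrite h.
- by rewrite no_digon_step in h.
- by have := noI 1; rewrite h.
Qed.

End OneCycle.

Definition replace (z : nat -> T) i y j := if j == i %[mod k] then y else z j.

Lemma replace_cycle z i y : min_cycle z -> D (z i) y -> D y (z i.+2) ->
  min_cycle (replace z i.+1 y).
Proof.
move=> [step per] zy yz.
have pm a b := @periodic_mod z a b per.
split=> j; rewrite /replace; last by rewrite modnDr per.
have [e1|n1] := eqVneq (j %% k) (i.+1 %% k).
  have e2 : j.+1 = i.+2 %[mod k] by rewrite -addn1 -(addn1 i.+1) -modnDml e1 modnDml.
  have -> : (j.+1 == i.+1 %[mod k]) = false.
    apply/eqP=> e3; move/eqP: e2; rewrite e3 -(addn1 i.+1) -[X in X == _ %[mod _]]addn0.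
    by rewrite eqn_modDl mod0n modn_small //; lia.
  by rewrite (pm _ _ e2).
have [e2|n2] := eqVneq (j.+1 %% k) (i.+1 %% k); last exact: step.
suff /pm -> : j = i %[mod k] by [].
by apply/eqP; rewrite -(eqn_modDr 1) !addn1; apply/eqP.
Qed.

Lemma mod_ne i d : 0 < d -> d < k -> i + d = i %[mod k] -> False.
Proof.
move=> d0 dk /eqP; rewrite -[X in _ == X %[mod _]]addn0 eqn_modDl mod0n modn_small //.
by rewrite eqn0Ngt d0.
Qed.

Lemma mod_succ i j : i.+1 = j.+1 %[mod k] -> i = j %[mod k].
Proof. by move=> /eqP; rewrite -(addn1 i) -(addn1 j) eqn_modDr => /eqP. Qed.

(** With [y] in place of [z i.+2] the cycle is again a shortest one, and its in-neighbours are
    located by [chord] if on the cycle and by [attach] if off it. *)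
Lemma replace_pred z i y p : min_cycle z -> D (z i.+1) y -> D y (z i.+3) -> D p y ->
  D (z i) p /\ D p (z i.+2).
Proof.
move=> zC zy yz py; have z'C := replace_cycle zC zy yz; have [step per] := zC.
set z' := replace z i.+2 y in z'C; have z'i : z' i.+2 = y by rewrite /z' /replace eqxx.
have z'E j : j <> i.+2 %[mod k] -> z' j = z j by move=> /eqP/negPf; rewrite /z' /replace => ->.
rewrite -z'i in py; have k0 : 0 < k by lia.
have n1 : i.+1 <> i.+2 %[mod k].
  by move=> /esym; rewrite -(addn1 i.+1); apply: mod_ne; lia.
have n2 : i <> i.+2 %[mod k] by move=> /esym; rewrite -(addn2 i); apply: mod_ne; lia.
have [/existsP[[j jk] /= /eqP pj]|] := boolP [exists j : 'I_k, p == z' j].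
  rewrite pj in py *; have := chord z'C py => /mod_succ/esym e.
  by rewrite (periodic_mod z'C.2 e) z'E.
rewrite negb_exists => /forallP nj.
have pZ j : p <> z' j.
  move=> e; have /negP := nj (Ordinal (ltn_pmod j k0)); rewrite e /=; apply.
  by rewrite (periodic_mod z'C.2 (modn_mod j k)).
have [m mp e] := attach z'C pZ py; have {}e : i = m %[mod k] by do 2 apply: mod_succ.
rewrite -(periodic_mod z'C.2 e) z'E // in mp; split=> //.
rewrite z'i in py; have [/orP[//|zp]|pe] := alis py yz (step i.+2).
  by case: n2; apply: (pred_uniq zC mp zp).
by rewrite pe in mp; case: n1; exact: esym (chord zC mp).
Qed.

End LongOddCycle.

Section LongOddFalse.

Variables (T : finType) (D : rel T).
Hypothesis D_irr : irreflexive D.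
Hypothesis D_tt : transitive_triangle_free D.
Hypothesis D_alis : arc_locally_in_semicomplete D.
Hypothesis IH : forall W : {set T}, W \proper setT -> BEon D W.
Hypothesis nBE : ~ BEon D setT.
Hypothesis nodom : forall x u w, ~ dominated D x u w.

Local Notation B := (kings D).
Let alis := alis D_alis.

Lemma long_odd_false k z : odd k -> 5 <= k ->
  (forall j x, odd j -> j < k -> ~~ walk D j x x) -> min_cycle D k z -> False.
Proof.
move=> k_odd k5 k_min zC; have [step per] := zC; have k0 : 0 < k by lia.
have pu := pred_uniq D_irr D_tt D_alis k_odd k5 k_min zC.
have rp := replace_pred D_irr D_tt D_alis k_odd k5 k_min zC.
(* These are the vertices that can replace [z i.+1], so class indices are shifted by one against the
   cycle. *)
pose X i := [set y | D (z i) y && D y (z i.+2)].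
have inX i y : (y \in X i) = D (z i) y && D y (z i.+2) by rewrite in_set.
have zB i : z i \in B.
  apply: (bad_king D_irr D_tt D_alis IH nBE nodom); left; exists k => //.
  by rewrite -[in X in walk _ _ _ X](per i); apply: (cycle_walk zC).
have Xper i : X (i + k) = X i.
  by apply/setP=> y; rewrite !inX per -!addSn per.
have XsubB i y : y \in X i -> y \in B.
  by rewrite inX => /andP[_ yz]; apply: kings_closed yz (zB _).
have predX i y p : y \in X i.+1 -> D p y -> p \in X i.
  by rewrite !inX => /andP[zy yz] py; apply/andP; apply: rp zy yz py.
have predX' i y p : y \in X i -> D p y -> exists j, p \in X j /\ i = j.+1 %[mod k].
  move=> yX py; exists (i + k.-1); have e : (i + k.-1).+1 = i + k by lia.
  by split; [apply: predX py; rewrite e Xper|rewrite e modnDr].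
have uX i j y : y \in X i -> y \in X j -> i = j %[mod k].
  by rewrite !inX => /andP[zi _] /andP[zj _]; apply: pu zi zj.
have BX x : x \in B -> exists i, x \in X i.
  move=> xB; pose P := [set y | [exists i : 'I_k, y \in X i]].
  have XP i y : y \in X i -> y \in P.
    rewrite [y \in P]in_set => yX; apply/existsP; exists (Ordinal (ltn_pmod i k0)) => /=.
    move: yX; rewrite !inX (periodic_mod per (modn_mod i k)).
    suff -> : z (i %% k).+2 = z i.+2 by [].
    by apply: (periodic_mod per); rewrite -(addn2 i) -(addn2 (i %% k)) modnDml.
  have Pp : pred_closed D P.
    move=> a b ab; rewrite [b \in P]in_set => /existsP[i bX].
    by have [j [aX _]] := predX' _ _ _ bX ab; apply: XP aX.
  have z1P : z 1 \in P by apply: (XP 0); rewrite inX !step.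
  have := subsetP (kings_sub z1P Pp) x xB; rewrite [x \in P]in_set => /existsP[i xX].
  by exists i.
have Xadj i j x y : x \in X i -> y \in X j -> D x y -> j = i.+1 %[mod k].
  move=> xX yX xy; have [l [xl ->]] := predX' _ _ _ yX xy.
  by have e := uX _ _ _ xl xX; rewrite -(addn1 l) -modnDml e modnDml addn1.
apply: (blowup_false D_irr D_tt D_alis IH nBE nodom k_odd _ Xper _ _ uX XsubB).
- by lia.
- move=> i x y xX yX; have := xX; have := yX; rewrite !inX => /andP[zy yz] /andP[zx xz].
  have n2 : i.+2 <> i %[mod k] by rewrite -(addn2 i); apply: mod_ne; lia.
  have [/orP[//|yx]|e] := alis xz (step i.+2) yz.
    have [j [yj e]] := predX' _ _ _ xX yx; case: n2; rewrite e.
    by have e' := uX _ _ _ yX yj; rewrite -(addn1 i.+1) -modnDml e' modnDml addn1.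
  by rewrite e in xX; have := uX _ _ _ xX yX => /esym; rewrite -(addn1 i) => /mod_ne[]; lia.
- by move=> i j x y xX yX xy; left; apply: Xadj xX yX xy.
- exact: BX.
- move=> u w v uB wB _ uw wu _ _; have [i ui] := BX u uB; have [j wj] := BX w wB.
  have e1 := Xadj _ _ _ _ ui wj uw; have := Xadj _ _ _ _ wj ui wu.
  by rewrite -(addn1 j) -modnDml e1 modnDml addn1 -(addn2 i) => /esym /mod_ne[]; lia.
Qed.

End LongOddFalse.

(** * Maximal strong cliques *)

Section Append.

Variables (T : finType) (D : rel T).

(** Take a maximal path of [K] ending at [k]. The set of vertices it misses has no edge to the path,
    so by the condition on [A] it is empty, and [s] is appended after [k]. *)
Lemma rooted_append (K : {set T}) k s : clique D K -> k \in K ->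
    (forall A : {set T}, A \subset K -> k \notin A -> A != set0 ->
       exists a b, [/\ a \in A, b \in K :\: A & D a b]) ->
    s \notin K -> D k s -> rooted D (s |: K) s.
Proof.
move=> clK kK hA sK ks.
have [|p [pp up sp mp]] := @maximal_path _ (fun x y => D y x) K k kK.
  by move=> x y xK yK xy; rewrite orbC; apply: clK.
have pK v : (v \in k :: p) = (v \in K).
  pose A := [set a in K | a \notin k :: p].
  have A0 : A = set0.
    apply/eqP; apply: contraT => A0; have [||a [b [aA bA ab]]] := hA A _ _ A0.
    - by apply/subsetP=> a; rewrite inE => /andP[].
    - by rewrite !inE eqxx andbF.
    move: aA bA; rewrite !inE => /andP[aK ap] /andP[+ bK].
    rewrite bK /= negbK => bp; have := mp b _ a aK _; rewrite ab !inE; by apply.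
  apply/idP/idP=> [/sp//|vK]; have := in_set0 v; rewrite -A0 in_set vK /=.
  by move/negbT; rewrite negbK.
exists (rcons (rev (k :: p)) s); split.
- by rewrite rcons_uniq rev_uniq up mem_rev pK sK.
- by move=> v; rewrite mem_rcons in_cons mem_rev pK in_setU1.
- have : sorted D (rev (k :: p)) by rewrite rev_sorted.
  by rewrite rev_cons; case: (rev p) => [|a l] /=; rewrite ?andbT ?rcons_path ?last_rcons ks ?andbT.
- by right; exists (rev (k :: p)).
Qed.

End Append.

(** * Strong cliques and clones of their vertices *)

Section Clones.

Variables (T : finType) (D : rel T).
Hypothesis D_irr : irreflexive D.
Hypothesis D_tt : transitive_triangle_free D.
Hypothesis D_alis : arc_locally_in_semicomplete D.

Local Notation adj := (adjacent D).
Local Notation B := (kings D).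
Let alis := alis D_alis.

(** The last clause is strong connectivity of the subdigraph induced by [K]. Being boolean, the
    notion admits the choice of a largest instance. *)
Definition strong_clique (K : {set T}) : bool :=
  [&& [forall a in K, forall b in K, (a != b) ==> adj a b], 2 < #|K|, K \subset B &
    [forall P : {set T}, (P \proper K) && (P != set0) ==>
       [exists a in P, exists b in K :\: P, D a b]]].

Definition max_strong_clique (K : {set T}) : Prop :=
  strong_clique K /\ forall K', strong_clique K' -> #|K'| <= #|K|.

Lemma strong_cliqueP K : reflect [/\ clique D K, 2 < #|K|, K \subset B &
    forall P : {set T}, P \proper K -> P != set0 -> exists a b, [/\ a \in P, b \in K :\: P & D a b]]
  (strong_clique K).
Proof.
apply: (iffP and4P) => [[/forall_inP cl c3 KB /forallP st]|[cl c3 KB st]]; split=> //.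
- by move=> a b aK bK; have /forall_inP/(_ b bK)/implyP := cl a aK.
- move=> P PK P0; have := st P; rewrite PK P0 /= => /exists_inP[a aP /exists_inP[b bP ab]].
  by exists a, b.
- by apply/forall_inP=> a aK; apply/forall_inP=> b bK; apply/implyP; apply: cl.
- apply/forallP=> P; apply/implyP=> /andP[PK P0]; have [a [b [aP bP ab]]] := st P PK P0.
  by apply/exists_inP; exists a => //; apply/exists_inP; exists b.
Qed.

(* The vertex y can replace n in K (clone_replace); v is the only out-neighbour
   of n in K (clone_succ). *)
Definition clone (K : {set T}) y n v : Prop :=
  [/\ [/\ n \in K, v \in K & n != v], ~~ adj y n, D y v, D n v &
    forall i, i \in K -> i != n -> i != v ->
      [/\ D i n, D n i = false, D i y & D y i = false]].

Lemma clone_adj K y n v i : clone K y n v -> i \in K -> i != n -> adj y i.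
Proof.
move=> [_ _ yv _ h] iK ni; have [->|iv] := eqVneq i v; first by rewrite /adjacent /= yv.
by have [_ _ iy _] := h i iK ni iv; rewrite /adjacent /= iy orbT.
Qed.

Lemma clone_succ K y n v i : clone K y n v -> i \in K -> D n i -> i = v.
Proof.
move=> [[_ _ _] _ _ _ h] iK ni; apply/eqP; apply: contraT => iv.
have [e|ne] := eqVneq i n; first by rewrite e D_irr in ni.
by have [_] := h i iK ne iv; rewrite ni.
Qed.

(** The ear k, p, y, k' preserves strong connectivity; with [p = y] a single vertex is added. *)
Lemma strong_clique_add K p y k k' : strong_clique K -> p \in B -> y \in B -> p \notin K ->
    {in K, forall i, adj p i} -> {in K, forall i, i != y -> adj y i} -> (p != y -> adj p y) ->
    k \in K -> D k p -> k' \in K -> D y k' -> (p != y -> D p y) -> y \notin K ->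
  strong_clique (p |: (y |: K)).
Proof.
move=> /strong_cliqueP[cl c3 KB st] pB yB pK pa ya pya kK kp k'K yk' py yK.
apply/strong_cliqueP; split.
- move=> a b; rewrite !inE => /or3P[/eqP->|/eqP->|aK] /or3P[/eqP->|/eqP->|bK] ab.
  + by rewrite eqxx in ab.
  + exact: pya.
  + exact: pa.
  + by rewrite adjC; apply: pya; rewrite eq_sym.
  + by rewrite eqxx in ab.
  + by apply: ya => //; rewrite eq_sym.
  + by rewrite adjC; apply: pa.
  + by rewrite adjC; apply: ya.
  + exact: cl.
- by apply: leq_trans c3 (subset_leq_card _); apply/subsetP=> a aK; rewrite !inE aK !orbT.
- by apply/subsetP=> a; rewrite !in_setU1 => /or3P[/eqP->|/eqP->|/(subsetP KB)].
move=> P /properP[sP [b bK bP]] P0.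
have [e|[a]] := set_0Vmem (P :&: K).
  have nPK i : i \in K -> i \notin P.
    by move=> iK; apply/negP=> iP; have := in_set0 i; rewrite -e inE iP iK.
  have [yP|yP] := boolP (y \in P).
    by exists y, k'; split=> //; rewrite !inE k'K nPK // !orbT.
  have [a aP] := set0Pn _ P0; have := subsetP sP a aP; rewrite !inE => /or3P[/eqP ap|/eqP ay|aK].
  + rewrite ap in aP; exists p, y; rewrite !inE eqxx yP orbT; split=> //.
    by apply: py; apply: contraNneq yP => <-.
  + by rewrite -ay aP in yP.
  + by have := nPK a aK; rewrite aP.
rewrite inE => /andP[aP aK].
have [KP|KP] := boolP (K \subset P).
  have [pP|pP] := boolP (p \in P); last first.
    by exists k, p; rewrite (subsetP KP) // !inE eqxx pP.
  have yP : y \notin P.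
    apply: contra bP => yP; move: bK; rewrite !inE => /or3P[/eqP->|/eqP->|/(subsetP KP)] //.
  exists p, y; rewrite !inE eqxx yP orbT pP; split=> //; apply: py.
  by apply: contraNneq yP => <-.
have [||a' [b' [a'P b'P ab']]] := st (P :&: K).
- rewrite properE subsetIr /=; apply: contra KP => KP.
  by apply: subset_trans KP (subsetIl _ _).
- by apply/set0Pn; exists a; rewrite inE aP.
move: a'P b'P; rewrite !inE negb_and => /andP[a'P _] /andP[+ b'K]; rewrite b'K orbF => b'P.
by exists a', b'; rewrite !inE b'K b'P !orbT.
Qed.

(** If [y] is adjacent to all of [K], either [y] enlarges [K], or the vertices dominating [K]
    without edges back are closed under in-neighbours and would contain [B]. So some n in [K] is not
    adjacent to [y]. Distinct out-neighbours of [y] and n in [K] would be joined by an edge, which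
    makes [y] and n adjacent; hence both have the same single out-neighbour v there. *)
Lemma clone_exists K y k0 : max_strong_clique K -> y \in B -> y \notin K -> k0 \in K -> D y k0 ->
  exists n v, clone K y n v.
Proof.
move=> [scK maxK] yB yK k0K yk0; have /strong_cliqueP[cl c3 KB st] := scK.
have [allA|] := boolP [forall k in K, adj y k].
  move/forall_inP: allA => ya; exfalso.
  have [/exists_inP[k kK ky]|] := boolP [exists k in K, D k y].
    suff /maxK : strong_clique (y |: K) by rewrite cardsU1 yK ltnn.
    rewrite -[y |: K](setUid) -setUA [K :|: _]setUC -setUA setUid.
    by apply: (@strong_clique_add K y y k k0); rewrite ?eqxx // => i /ya.
  rewrite negb_exists => /forallP ny.
  pose Y := [set y | (y \notin K) && [forall k in K, D y k && ~~ D k y]].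
  have YP a : a \in Y -> a \notin K /\ forall k, k \in K -> D a k /\ D k a = false.
    by rewrite inE => /andP[aK /forall_inP h]; split=> // k /h/andP[-> /negPf].
  have yY : y \in Y.
    rewrite inE yK /=; apply/forall_inP=> k kK; have := ny k; rewrite kK /= => nky.
    by rewrite nky andbT; have := ya k kK; rewrite /adjacent /= (negPf nky) orbF.
  have Yp : pred_closed D Y.
    move=> a b ab bY; have [bK bP] := YP b bY.
    have aK : a \notin K by apply/negP=> aK; have [_] := bP a aK; rewrite ab.
    have dig i j : i \in K -> j \in K -> i != j -> D i j.
      move=> iK jK ij; case/orP: (cl i j iK jK ij) => // ji.
      have [bi ib] := bP i iK; have [bj jb] := bP j jK.
      by have := D_tt bj ji bi; rewrite ib jb orbF.
    have aadj i : i \in K -> adj a i.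
      move=> iK; have [j jK ij] : exists2 j, j \in K & i != j.
        have : 0 < #|K :\ i| by move: c3; rewrite (cardsD1 i) iK => /ltnW.
        by case/card_gt0P=> j; rewrite !inE eq_sym => /andP[ij jK]; exists j.
      have [bj _] := bP j jK; have [//|e] := alis ab bj (dig i j iK jK ij).
      by rewrite e iK in aK.
    rewrite inE aK; apply/forall_inP=> i iK.
    have nia : D i a = false.
      apply/negP=> ia; suff /maxK : strong_clique (a |: (b |: K)).
        have nab : a != b by apply: contraTneq ab => ->; rewrite D_irr.
        by rewrite !cardsU1 !inE negb_or nab aK bK /= !add1n => /ltnW; rewrite ltnn.
      have [bi _] := bP i iK; have bB := kings_closed bi (subsetP KB i iK).
      apply: (@strong_clique_add K a b i i) => //.
      - exact: kings_closed ab bB.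
      - move=> j jK _; have [bj _] := bP j jK; by rewrite /adjacent /= bj.
      - by move=> _; rewrite /adjacent /= ab.
    by rewrite nia andbT; have := aadj i iK; rewrite /adjacent /= nia orbF.
  have k0Y := subsetP (kings_sub yY Yp) k0 (subsetP KB _ k0K).
  by have [] := YP _ k0Y; rewrite k0K.
rewrite negb_forall => /existsP[n]; rewrite negb_imply => /andP[nK yn].
have key n' v u : n' \in K -> ~~ adj y n' -> v \in K -> D y v -> u \in K -> D n' u -> u = v.
  move=> n'K yn' vK yv uK n'u; apply/eqP; apply: contraT => uv.
  have yn2 : y <> n' by move=> e; rewrite e n'K in yK.
  case/orP: (cl u v uK vK uv) => [uv'|vu].
    by have [h|/esym//] := alis n'u uv' yv; rewrite adjC h in yn'.
  by have [h|//] := alis yv vu n'u; rewrite h in yn'.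
have [||a [v [aP vP av]]] := st [set n].
- by rewrite properE sub1set nK /=; apply: contraTN c3 => /subset_leq_card; rewrite cards1 -leqNgt => /leq_trans->.
- by apply/set0Pn; exists n; rewrite inE.
move: aP vP; rewrite !inE => /eqP ea /andP[vn vK]; rewrite {}ea in av.
have yv : D y v by rewrite (key n k0 v nK yn k0K yk0 vK av).
exists n, v; split=> //; first by split=> //; rewrite eq_sym.
move=> i iK ni iv.
have nni : D n i = false by apply: contraNF iv => h; rewrite (key n v i).
have yi : D y i = false by apply: contraNF iv => h; rewrite (key n i v) // eqxx.
have iadj : adj y i.
  apply: contraT => nyi; case/orP: (cl i n iK nK ni) => [h|]; last by rewrite nni.
  by have e := key i v n iK nyi vK yv nK h; rewrite e eqxx in vn.
split=> //; first by have := cl i n iK nK ni; rewrite /adjacent /= nni orbF.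
by move: iadj; rewrite /adjacent /= yi.
Qed.

Lemma strong_clique_digon K y n v i j : clique D K -> clone K y n v ->
  i \in K -> j \in K -> i != n -> i != v -> j != n -> j != v -> i != j -> D i j.
Proof.
move=> cl [_ _ _ _ h] iK jK ni iv nj jv ij; case/orP: (cl i j iK jK ij) => // ji.
have [i_n ni' _ _] := h i iK ni iv; have [jn nj' _ _] := h j jK nj jv.
by have := D_tt ji i_n jn; rewrite ni' nj' !orbF.
Qed.

(* Some edge of K leaves {n, v}, and v is the only out-neighbour of n in K. *)
Lemma clone_return K y n v : strong_clique K -> clone K y n v ->
  exists i, [/\ i \in K, i != n, i != v & D v i].
Proof.
move=> /strong_cliqueP[cl c3 KB st] c; have [[nK vK nv] _ _ _ _] := c.
have [||a [b [aP bP ab]]] := st [set n; v].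
- rewrite properE subUset !sub1set nK vK /=; apply: contraTN c3 => /subset_leq_card.
  by rewrite cards2 nv -leqNgt.
- by apply/set0Pn; exists n; rewrite !inE eqxx.
move: aP bP; rewrite !inE negb_or => /orP[/eqP ea|/eqP ea] /andP[/andP[bn bv] bK]; rewrite {}ea in ab.
  by rewrite (clone_succ c bK ab) eqxx in bv.
by exists b.
Qed.

(** [y] and [n] have the same edges to the rest of [K], except possibly edges from [v]; there
    [clone_return] supplies an edge from [v] to another vertex. *)
Lemma clone_replace K y n v : max_strong_clique K -> y \in B -> y \notin K -> clone K y n v ->
  max_strong_clique (y |: (K :\ n)) /\ clone (y |: (K :\ n)) n y v.
Proof.
move=> [scK maxK] yB yK c; have /strong_cliqueP[cl c3 KB st] := scK.
have [[nK vK nv] yn yv nvD h] := c.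
have ny : y != n by apply: contraNneq yK => ->.
have vy : v != y by apply: contraNneq yK => <-.
have card : #|y |: (K :\ n)| = #|K|.
  by rewrite cardsU1 !inE (negPf yK) andbF (cardsD1 n K) nK.
have vn : v != n by rewrite eq_sym.
have [i0 [i0K i0n i0v vi0]] := clone_return scK c.
split; last first.
  split=> //; first by rewrite !inE eqxx vK vn orbT; split=> //; rewrite eq_sym.
    by rewrite adjC.
  move=> i; rewrite !inE => /orP[/eqP->|/andP[ni iK]]; first by rewrite eqxx.
  by move=> _ iv; have [h1 h2 h3 h4] := h i iK ni iv.
split; last by move=> K' /maxK; rewrite card.
apply/strong_cliqueP; split.
- move=> a b; rewrite !inE => /orP[/eqP->|/andP[an aK]] /orP[/eqP->|/andP[bn bK]].
  + by rewrite eqxx.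
  + by move=> _; apply: clone_adj c bK bn.
  + by move=> _; rewrite adjC; apply: clone_adj c aK an.
  + exact: cl.
- by rewrite card.
- apply/subsetP=> a; rewrite in_setU1 in_setD1 => /orP[/eqP->//|/andP[_ /(subsetP KB)]]//.
move=> P /properP[sP [w wK wP]] P0.
have inK' a : a \in P -> a != y -> a \in K /\ a != n.
  by move=> /(subsetP sP); rewrite !inE => /orP[->//|/andP[-> ->]].
(* The set is pulled back to [K] by writing [n] for [y], so that strength of [K] provides an
   edge. *)
pose P' := if y \in P then n |: (P :\ y) else P.
have sP' : P' \subset K.
  apply/subsetP=> a; rewrite /P'; case: ifP => yP.
    by rewrite !inE => /orP[/eqP->//|/andP[ay aP]]; have [] := inK' a aP ay.
  by move=> aP; have [] := inK' a aP ltac:(by apply: contraFneq yP => <-).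
have [||a [b [aP bP ab]]] := st P'.
- rewrite properE sP' /=; apply/subsetPn.
  have [ew|nw] := eqVneq w y.
    exists n => //; rewrite /P'; case: ifP => yP; first by rewrite ew yP in wP.
    by apply/negP=> nP; have [_] := inK' n nP ltac:(by rewrite eq_sym); rewrite eqxx.
  move: wK; rewrite !inE (negPf nw) /= => /andP[wn wK]; exists w => //.
  by rewrite /P'; case: ifP => _; rewrite ?inE ?(negPf wn) ?(negPf wP) ?andbF.
- have [a aP] := set0Pn _ P0; apply/set0Pn; rewrite /P'; case: ifP => _; last by exists a.
  by exists n; rewrite !inE eqxx.
move: bP; rewrite in_setD => /andP[bP' bK].
have [ean|an] := eqVneq a n.
  rewrite ean in ab aP; have bv := clone_succ c bK ab.
  have yP : y \in P.
    by apply: contraT => yP; move: aP; rewrite /P' (negPf yP) => /inK'[]; rewrite ?eqxx // eq_sym.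
  exists y, v; split=> //; rewrite !inE vK vn orbT andbT.
  by move: bP'; rewrite /P' yP bv !inE (negPf vn) vy.
have aP2 : a \in P by move: aP; rewrite /P'; case: ifP => // _; rewrite !inE (negPf an) => /andP[].
have aK := subsetP sP' a aP.
have [ebn|bn] := eqVneq b n; last first.
  exists a, b; split=> //; rewrite !inE bK bn orbT andbT.
  move: bP'; rewrite /P'; case: ifP => // _; rewrite !inE (negPf bn) /= negb_and negbK => /orP[/eqP eb|//].
  by rewrite -eb bK in yK.
have yP : y \notin P.
  by apply: contra bP' => yP; rewrite /P' yP ebn !inE eqxx.
have to_y i : i \in P -> i != v -> exists a' b', [/\ a' \in P, b' \in (y |: K :\ n) :\: P & D a' b'].
  move=> iP iv; have iy : i != y by apply: contraNneq yP => <-.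
  have [iK ni] := inK' i iP iy; have [_ _ iyD _] := h i iK ni iv.
  by exists i, y; split=> //; rewrite !inE eqxx yP.
have [/exists_inP[i iP iv]|] := boolP [exists i in P, i != v]; first exact: to_y iP iv.
rewrite negb_exists => /forallP onlyv; exists v, i0.
have Pv i : i \in P -> i = v by move=> iP; have := onlyv i; rewrite iP /= negbK => /eqP.
rewrite -{1}(Pv a aP2) aP2 !inE i0K i0n orbT andbT; split=> //.
by apply: contra i0v => /Pv ->.
Qed.

(** If [n] and [n'] differed, one of them would have a second out-neighbour in [K], or a fourth
    vertex would form with them a transitive triangle without reverse edges. *)
Lemma clone_uniq_vertex K y n v y' n' v' : strong_clique K -> 3 < #|K| ->
  clone K y n v -> clone K y' n' v' -> n = n'.
Proof.
move=> scK c4 c c'; have /strong_cliqueP[cl c3 KB st] := scK.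
have [[nK vK nv] yn yv nvD h] := c; have [[n'K v'K nv'] yn' yv' nvD' h'] := c'.
apply/eqP; apply: contraT => nn'.
have avoid a b d : exists i, [/\ i \in K, i != a, i != b & i != d].
  have : 0 < #|K :\: [set a; b; d]|.
    have le : #|[set a; b; d]| <= 3.
      by rewrite -setUA cardsU1 cards2; case: (_ \notin _); case: (_ != _).
    rewrite cardsD subn_gt0; apply: leq_ltn_trans (subset_leq_card (subsetIr _ _)) _.
    exact: leq_ltn_trans le c4.
  case/card_gt0P=> i; rewrite !inE !negb_or => /andP[/andP[/andP[ia ib] id] iK].
  by exists i.
have [e|n'v] := eqVneq n' v.
  have [i1 [i1K i1n i1v vi1]] := clone_return scK c.
  have [ev|nv2] := eqVneq n v'.
    by have := clone_succ c' i1K; rewrite e -ev => /(_ vi1) e1; rewrite e1 eqxx in i1n.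
  have [i [iK ni iv iv']] := avoid n v v'.
  have ni' : D n i.
    by apply: (strong_clique_digon cl c' nK iK); rewrite ?e // 1?eq_sym.
  by have ev := clone_succ c iK ni'; rewrite ev eqxx in iv.
have n'n : n' != n by rewrite eq_sym.
have [n'_n nn'_ _ _] := h n' n'K n'n n'v.
have ev' : n = v' := clone_succ c' nK n'_n.
have [i [iK ni iv in']] := avoid n v n'.
have [i_n n_i _ _] := h i iK ni iv.
have [i_n' n'_i _ _] := h' i iK in' ltac:(by rewrite -ev').
by have := D_tt i_n' n'_n i_n; rewrite n'_i nn'_ n_i.
Qed.

End Clones.

(** * Strong cliques with more than three vertices *)

Section Multipartite.

Variables (T : finType) (D : rel T).
Hypothesis D_irr : irreflexive D.
Hypothesis D_tt : transitive_triangle_free D.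
Hypothesis D_alis : arc_locally_in_semicomplete D.
Hypothesis IH : forall W : {set T}, W \proper setT -> BEon D W.
Hypothesis nBE : ~ BEon D setT.
Hypothesis nodom : forall x u w, ~ dominated D x u w.

Local Notation adj := (adjacent D).
Local Notation B := (kings D).
Let alis := alis D_alis.

(** [X] collects [n] and its clones. Any other in-neighbour in [B] of an element of [X] would, after
    exchanging that element for [n], be a clone of it and hence not adjacent to it. So [X] is
    stable, [B] is [K' :|: X], and [chain_BE] applies to [K']. *)
Lemma large_strong_clique_false K y0 n v : max_strong_clique D K -> 3 < #|K| ->
  y0 \in B -> y0 \notin K -> clone D K y0 n v -> False.
Proof.
move=> mK c4 y0B y0K c0; have [scK maxK] := mK.
have /(strong_cliqueP)[clK c3 KB _] := scK.
have [[nK vK nv] y0n y0v nvD h0] := c0; have vn : v != n by rewrite eq_sym.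
have [k1 [k1K k1n k1v vk1]] := clone_return D_irr scK c0.
pose K' := K :\ n.
pose X := n |: [set x in B | (x \notin K) && [exists k in K, D x k]].
have inK' i : (i \in K') = (i != n) && (i \in K) by rewrite in_setD1.
have cloneX x k : x \in B -> x \notin K -> k \in K -> D x k -> clone D K x n v.
  move=> xB xK kK xk; have [n' [v' c]] := clone_exists D_irr D_tt D_alis mK xB xK kK xk.
  have en := clone_uniq_vertex D_irr D_tt scK c4 c0 c; have [_ nvD' _ nvD2 _] := c.
  have [[_ v'K _] _ _ _ _] := c.
  by have ev : v' = v := clone_succ D_irr c0 v'K ltac:(by rewrite en); rewrite en -ev.
have Xcases x : x \in X -> x = n \/ [/\ x \in B, x \notin K & clone D K x n v].
  rewrite in_setU1 in_set => /orP[/eqP|/and3P[xB xK /exists_inP[k kK xk]]]; first by left.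
  by right; split=> //; apply: cloneX xk.
have nX : n \in X by rewrite in_setU1 eqxx.
have y0X : y0 \in X.
  by rewrite in_setU1 in_set y0B y0K /=; apply/orP; right; apply/exists_inP; exists v.
have y0nn : y0 != n by apply: contraNneq y0K => ->.
have KX i x : i \in K' -> i != v -> x \in X -> D i x /\ D x i = false.
  rewrite inK' => /andP[ni iK] iv /Xcases[->|[_ _ [_ _ _ _ h]]].
    by have [? ? _ _] := h0 i iK ni iv.
  by have [_ _ ? ?] := h i iK ni iv.
have Xv x : x \in X -> D x v by move=> /Xcases[->|[_ _ []]].
have XK' x : x \in X -> x \notin K'.
  by rewrite inK' negb_and negbK => /Xcases[->|[_ -> _]]; rewrite ?eqxx ?orbT.
have XB x : x \in X -> x \in B by move=> /Xcases[->|[]] //; apply: (subsetP KB).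
have predX x p : x \in X -> D p x -> p \in K'.
  move=> xX px; have pB := kings_closed px (XB x xX).
  case: (Xcases x xX) => [ex|[xB xK c]].
    rewrite ex in px; rewrite inK'; have [pK|pK] := boolP (p \in K).
      by rewrite andbT; apply: contraTneq px => ->; rewrite D_irr.
    by have [_] := cloneX p n pB pK nK px; rewrite /adjacent /= px.
  have [mKx cx] := clone_replace D_irr mK xB xK c.
  have [pK|pK] := boolP (p \in x |: K :\ n).
    move: pK; rewrite in_setU1 => /orP[/eqP e|//]; by rewrite e D_irr in px.
  have xKx : x \in x |: K :\ n by rewrite in_setU1 eqxx.
  have [n' [v' c']] := clone_exists D_irr D_tt D_alis mKx pB pK xKx px.
  have cardx : 3 < #|x |: K :\ n|.
    by apply: leq_trans c4 _; apply: mKx.2 scK.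
  have e := clone_uniq_vertex D_irr D_tt mKx.1 cardx cx c'.
  by have [_] := c'; rewrite -e /adjacent /= px.
have BKX : B \subset K' :|: X.
  apply: (@kings_sub _ _ _ n); first by rewrite in_setU nX orbT.
  move=> a b ab; rewrite ![_ \in K' :|: X]in_setU => /orP[bK|bX]; last by rewrite (predX b a bX ab).
  have aB : a \in B by apply: kings_closed ab (subsetP KB _ _); move: bK; rewrite inK' => /andP[].
  have [aK|aK] := boolP (a \in K).
    by rewrite inK' in_setU1 aK andbT orbA orNb.
  rewrite [a \in X]in_setU1 in_set aB aK /=; apply/orP; right; apply/orP; right.
  by apply/exists_inP; exists b => //; move: bK; rewrite inK' => /andP[].
have clK' : clique D K' by move=> a b; rewrite !inK' => /andP[_ ?] /andP[_ ?]; apply: clK.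
have vK' : v \in K' by rewrite inK' vn.
have k1K' : k1 \in K' by rewrite inK' k1n.
have dig i j : i \in K' -> j \in K' -> i != v -> j != v -> i != j -> D i j.
  rewrite !inK' => /andP[ni iK] /andP[nj jK] iv jv; exact: (strong_clique_digon D_tt clK c0).
have coreB := kings_core D_irr D_tt D_alis IH nBE nodom.
have Xstab x x' : x \in X -> x' \in X -> D x x' = false.
  by move=> xX x'X; apply/negP=> /(predX _ _ x'X); apply/negP/XK'.
apply: nBE; apply: (chain_BE D_tt clK').
- move=> k kK'; have inE' p : p \in ~: (K' :\ k) :&: B -> p = k \/ p \in X.
    rewrite in_setI in_setC in_setD1 negb_and negbK => /andP[+ /(subsetP BKX)].
    by rewrite in_setU => /orP[/eqP->|/negPf->]; [left|right].
  have Xk x : x \in X -> (x == k) = false.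
    by move=> xX; apply: contraTF kK' => /eqP<-; apply: XK'.
  apply: (core_bip D_irr D_tt D_alis coreB).
    exists (fun p => p == k) => p q /inE'[->|pX] /inE'[->|qX] pq.
    + by rewrite adjxx in pq.
    + by rewrite eqxx Xk.
    + by rewrite eqxx Xk.
    + by rewrite /adjacent /= !Xstab in pq.
  have key x z : x \in X -> z \notin B -> D x k -> D k x -> D x z -> D k z -> False.
    move=> xX zB xk kx xz kz; have [ekv|kv] := eqVneq k v; last first.
      by have [_] := KX k x kK' kv xX; rewrite xk.
    rewrite {}ekv in xk kx xz kz.
    (* [X] has at least two vertices, and x' -> v -> z <- x would make two of them adjacent. *)
    have [x' x'X ne] : exists2 x', x' \in X & x' != x.
      by have [->|nx] := eqVneq x n; [exists y0|exists n; rewrite // eq_sym].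
    have [|e] := alis (Xv x' x'X) kz xz; last by rewrite e eqxx in ne.
    by rewrite /adjacent /= !Xstab.
  move=> p q z /inE'[->|pX] /inE'[->|qX] _ zB pq qp pz qz.
  + by rewrite D_irr in pq.
  + exact: key qX zB qp pq qz pz.
  + exact: key pX zB pq qp pz qz.
  + by rewrite Xstab in pq.
- exists k1 => // s sK' adjs.
  have ks : D k1 s.
    case/orP: adjs => // sk; have sB := kings_closed sk (subsetP KB _ k1K).
    have := subsetP BKX s sB; rewrite in_setU (negPf sK') /= => sX.
    by have [] := KX k1 s k1K' k1v sX.
  apply: rooted_append ks => // A sA k1A A0.
  have [a aA] := set0Pn _ A0; have aK' := subsetP sA a aA.
  have ak : a != k1 by apply: contraNneq k1A => <-.
  have [ev|av] := eqVneq a v; first by exists v, k1; rewrite -{1}ev aA in_setD k1A k1K'.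
  by exists a, k1; rewrite aA in_setD k1A k1K' dig.
(* Taking [n] for t restores the whole clique [K], and [K' :\ k0] can be traversed before [n]. *)
move=> k0 k0K'; right; exists n; split.
- exact: XK'.
- have [->|k0v] := eqVneq k0 v; first by rewrite /adjacent /= nvD.
  by have [nk _] := KX k0 n k0K' k0v nX; rewrite /adjacent /= nk orbT.
- by rewrite /K' setD1K //; apply: rooted_clique; rewrite // -/K'; move: k0K'; rewrite inK' => /andP[].
move=> s sK' ns.
have nsD : D n s by case/orP: ns => // /(predX _ _ nX); rewrite (negPf sK').
have snK : s \notin n |: (K' :\ k0).
  rewrite in_setU1 in_setD1 negb_or (negPf sK') andbF andbT.
  by apply: contraTneq nsD => ->; rewrite D_irr.
apply: rooted_append nsD => //.
- move=> a b; rewrite !in_setU1 !in_setD1 => aK bK; apply: clK.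
    by move: aK => /orP[/eqP->|/and3P[]].
  by move: bK => /orP[/eqP->|/and3P[]].
- by rewrite in_setU1 eqxx.
move=> A sA nA A0.
have inA a : a \in A -> [/\ a \in K', a != k0 & a != n].
  move=> aA; have an : a != n by apply: contraNneq nA => <-.
  by have := subsetP sA a aA; rewrite in_setU1 in_setD1 (negPf an) => /andP[].
have nout : n \in (n |: K' :\ k0) :\: A by rewrite in_setD nA in_setU1 eqxx.
have [/exists_inP[a aA av]|] := boolP [exists a in A, a != v].
  by have [aK' _ _] := inA a aA; exists a, n; have [? _] := KX a n aK' av nX.
rewrite negb_exists => /forallP onlyv.
have Av a : a \in A -> a = v by move=> aA; have := onlyv a; rewrite aA /= negbK => /eqP.
have vA : v \in A by have [a aA] := set0Pn _ A0; rewrite -(Av a aA).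
have [_ vk0 _] := inA v vA.
(* The critical set is the singleton of [v]. A vertex [k] beyond n, v, k0 exists because [K] has
   more than three; [D_tt] then gives an edge from [v] to [k] or to [n]. *)
have [k [kK' kv kk0]] : exists k, [/\ k \in K', k != v & k != k0].
  have : 0 < #|K :\: [set n; v; k0]|.
    rewrite cardsD subn_gt0; apply: leq_ltn_trans (subset_leq_card (subsetIr _ _)) _.
    by apply: leq_ltn_trans c4; rewrite -setUA cardsU1 cards2; case: (_ \notin _); case: (_ != _).
  case/card_gt0P=> k; rewrite !inE !negb_or => /andP[/andP[/andP[kn kv] kk0] kK].
  by exists k; rewrite inK' kn.
have kout : k \in (n |: K' :\ k0) :\: A.
  by rewrite in_setD in_setU1 in_setD1 kk0 kK' orbT andbT; apply: contra kv => /Av->.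
have [nk nkf] := KX k n kK' kv nX.
have kvadj : adj k v by apply: clK'.
case/orP: kvadj => [kv'|vk]; last by exists v, k.
have /or3P[h|h|h] := D_tt nk nvD kv'.
- by rewrite h in nkf.
- by exists v, n.
- by exists v, k.
Qed.

End Multipartite.

(** * Maximal strong cliques of size three *)

Section Tripartite.

Variables (T : finType) (D : rel T).
Hypothesis D_irr : irreflexive D.
Hypothesis D_tt : transitive_triangle_free D.
Hypothesis D_alis : arc_locally_in_semicomplete D.

Local Notation adj := (adjacent D).
Local Notation B := (kings D).
Let alis := alis D_alis.

Definition max_triangle (a b c : T) : Prop :=
  [/\ D a b, D b c, D c a & max_strong_clique D [set a; b; c]].

(** This is [clone] for the triangle, with [a] as the copied vertex and [b] as its out-neighbour.
    The last conjunct concerns the triangle alone: if [D a c] holds, then [a] has no copies. *)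
Definition copy (a b c p : T) : bool :=
  [&& ~~ adj p a, D c p, D p b, ~~ D p c & ~~ D a c].

(* The vertices p such that p, b, c is still a maximal triangle (copy_replace). *)
Definition class (a b c : T) : {set T} :=
  a |: [set p in B | (p \notin [set a; b; c]) && copy a b c p].

Lemma in_set3 (a b c x : T) : (x \in [set a; b; c]) = [|| x == a, x == b | x == c].
Proof. by rewrite !inE orbA. Qed.

Lemma set3_rot (a b c : T) : [set b; c; a] = [set a; b; c].
Proof. by apply/setP=> x; rewrite !in_set3 orbA orbC. Qed.

Lemma max_triangle_rot a b c : max_triangle a b c -> max_triangle b c a.
Proof. by case=> ab bc ca m; split=> //; rewrite set3_rot. Qed.

Lemma max_triangle_neq a b c : max_triangle a b c -> [/\ a != b, b != c & c != a].
Proof. by case=> ab bc ca _; split; [move: ab|move: bc|move: ca]; apply: contraTneq => ->; rewrite D_irr. Qed.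

Lemma max_triangle_sub a b c : max_triangle a b c -> [set a; b; c] \subset B.
Proof. by case=> _ _ _ [/strong_cliqueP[]]. Qed.

Lemma classP a b c p : max_triangle a b c -> p \in class a b c ->
  p = a \/ [/\ p \in B, p \notin [set a; b; c] & copy a b c p].
Proof.
by move=> t; rewrite in_setU1 in_set => /orP[/eqP->|/and3P[pB ps r]]; [left|right].
Qed.

Lemma class_base a b c : a \in class a b c.
Proof. by rewrite in_setU1 eqxx. Qed.

Lemma class_sub a b c p : max_triangle a b c -> p \in class a b c -> p \in B.
Proof.
move=> t /(classP t)[->|[]] //; apply: (subsetP (max_triangle_sub t)).
by rewrite in_set3 eqxx.
Qed.

Lemma copy_replace a b c p : max_triangle a b c -> p \in B -> p \notin [set a; b; c] ->
  copy a b c p -> max_triangle p b c.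
Proof.
move=> t pB ps /and5P[pa cp pb /negPf npc /negPf nac]; have [ab bc ca m] := t.
have [neab nebc neca] := max_triangle_neq t.
have cl : clone D [set a; b; c] p a b.
  split=> //; first by rewrite !in_set3 !eqxx orbT neab.
  by move=> i; rewrite in_set3 => /or3P[]/eqP-> //; rewrite eqxx.
have [m' _] := clone_replace D_irr m pB ps cl.
split=> //; suff <- : p |: ([set a; b; c] :\ a) = [set p; b; c] by [].
apply/setP=> x; rewrite in_setU1 in_setD1 !in_set3; case: (eqVneq x p) => //= _.
by case: (eqVneq x a) => //= ->; rewrite (negPf neab) eq_sym (negPf neca).
Qed.

Lemma copy_exists a b c p x : max_triangle a b c -> p \in B -> p \notin [set a; b; c] ->
  x \in [set a; b; c] -> D p x -> [\/ copy a b c p, copy b c a p | copy c a b p].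
Proof.
move=> t pB ps xs px; have [ab bc ca m] := t.
have [n [v [[nK vK nv] pn pv nv' h]]] := clone_exists D_irr D_tt D_alis m pB ps xs px.
have H a' b' c' : max_triangle a' b' c' -> [set a'; b'; c'] = [set a; b; c] -> n = a' ->
    copy a' b' c' p.
  move=> t' e en; subst n; have [ab' bc' ca' _] := t'.
  have [neab nebc neca] := max_triangle_neq t'.
  move: vK h; rewrite -e in_set3 eq_sym (negPf nv) /= => /orP[]/eqP ev h; subst v.
    have [|||_ h2 h3 h4] := h c'; rewrite ?in_set3 ?eqxx ?orbT //; first by rewrite eq_sym.
    by rewrite /copy pn h3 pv h4 h2.
  have b3 : b' \in [set a'; b'; c'] by rewrite in_set3 eqxx orbT.
  by have := h b' b3; rewrite eq_sym neab nebc ab' => /(_ isT isT)[].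
have tb := max_triangle_rot t; have tc := max_triangle_rot tb.
move: nK; rewrite in_set3 => /or3P[]/eqP en.
- by constructor 1; apply: H.
- by constructor 2; apply: (H b c a) => //; apply: set3_rot.
- by constructor 3; apply: (H c a b) => //; rewrite (set3_rot b c a); apply: set3_rot.
Qed.

(** When both are proper copies, replace [a] by [p]. Since [q] points to [c], it is a copy of a
    vertex of the triangle p, b, c; only [b] is possible, and this includes the edge from [p] to
    [q]. *)
Lemma class_complete a b c p q : max_triangle a b c -> p \in class a b c -> q \in class b c a ->
  D p q.
Proof.
move=> t pX qX; have tb := max_triangle_rot t; have [ab bc ca _] := t.
case: (classP t pX) => [->|[pB ps rp]]; case: (classP tb qX) => [->|[qB qs rq]] //.
- by case/and5P: rq.
- by case/and5P: rp.
have tp := copy_replace t pB ps rp.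
case/and5P: (rp) => pa cp pb npc nac; case/and5P: (rq) => qb aq qc nqa nba.
have qs' : q \notin [set p; b; c].
  move: qs; rewrite !in_set3 !negb_or => /and3P[-> -> _]; rewrite !andbT.
  by apply: contraNneq npc => <-.
case: (copy_exists (x := c) tp qB qs' _ qc); first by rewrite in_set3 eqxx !orbT.
- by case/and5P => _ _ _; rewrite qc.
- by case/and5P.
- by case/and5P; rewrite /adjacent /= qc.
Qed.

(** For p outside the triangle y, b, c, the edge from [p] to [y] rules out copies of [y] and of [b],
    so [copy_exists] gives a copy of [c]; the defining condition carries this over from [y] to [a].
    The exception [p = b] is the possible reverse edge. *)
Lemma class_pred a b c p y : max_triangle a b c -> y \in class a b c -> p \in B -> D p y ->
  p \in class c a b \/ p = b.
Proof.
move=> t yX pB py.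
have H y' : max_triangle y' b c -> D p y' -> [\/ p = b, p = c |
    p \notin [set y'; b; c] /\ copy c y' b p].
  move=> t' py'; have [ps|ps] := boolP (p \in [set y'; b; c]).
    move: ps; rewrite in_set3 => /or3P[]/eqP e; last by constructor 2.
      by rewrite e D_irr in py'.
    by constructor 1.
  have x3 : y' \in [set y'; b; c] by rewrite in_set3 eqxx.
  have [r|r|r] := copy_exists t' pB ps x3 py'.
  - by case/and5P: r; rewrite /adjacent /= py'.
  - by case/and5P: r; rewrite py'.
  - by constructor 3.
have [ab bc ca _] := t.
have fin : p \notin [set a; b; c] -> copy c a b p -> p \in class c a b.
  by move=> ps r; rewrite in_setU1 in_set pB r (set3_rot b c a) (set3_rot a b c) ps orbT.
case: (classP t yX) => [ey|[yB ys ry]].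
  by rewrite ey in py; case: (H a t py) => [->|->|[]]; auto using class_base.
have ty := copy_replace t yB ys ry.
case: (H y ty py) => [->|->|[ps r]]; auto using class_base.
case/and5P: (r) => pc bp _ npb ncb; case/and5P: (ry) => ya cy yb nyc nac.
have pa : p != a by apply: contraNneq pc => ->; rewrite /adjacent /= ca orbT.
left; apply: fin.
  by move: ps; rewrite !in_set3 !negb_or pa => /andP[_].
rewrite /copy pc bp npb ncb !andbT /=.
have [/orP[//|ap]|e] := alis py yb ab; last by rewrite e eqxx in pa.
have [h|e] := alis yb bp ap; first by rewrite h in ya.
by rewrite -e in_set3 eqxx in ys.
Qed.

Lemma class_disjoint a b c p : max_triangle a b c -> p \in class a b c -> p \in class b c a ->
  False.
Proof.
move=> t pX pX'; have tb := max_triangle_rot t; have [ab nebc ca] := max_triangle_neq t.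
case: (classP t pX) => [ep|[pB ps rp]]; case: (classP tb pX') => [ep'|[_ ps' rp']].
- by rewrite -ep ep' eqxx in ab.
- by rewrite ep in_set3 eqxx !orbT in ps'.
- by rewrite ep' in_set3 eqxx !orbT in ps.
- by case/and5P: rp => _ _ _ /negP[]; case/and5P: rp'.
Qed.

Lemma class_nonadj a b c p q : max_triangle a b c -> p \in class a b c -> q \in class a b c ->
  D p q = false.
Proof.
move=> t pX qX; apply/negP=> pq; have tb := max_triangle_rot t; have tc := max_triangle_rot tb.
case: (class_pred t qX (class_sub t pX) pq) => [pc|e].
  exact: class_disjoint tc pc pX.
by apply: (class_disjoint t pX); rewrite e class_base.
Qed.

Lemma class_cover a b c p : max_triangle a b c -> p \in B ->
  [|| p \in class a b c, p \in class b c a | p \in class c a b].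
Proof.
move=> t; pose P := class a b c :|: class b c a :|: class c a b.
have inP y : (y \in P) = [|| y \in class a b c, y \in class b c a | y \in class c a b].
  by rewrite [LHS]in_setU [y \in class a b c :|: _]in_setU orbA.
suff /subsetP BP : B \subset P by move=> /BP; rewrite inP.
have tb := max_triangle_rot t; have tc := max_triangle_rot tb.
apply: (@kings_sub _ _ _ a); first by rewrite inP class_base.
move=> x y xy; rewrite !inP => /or3P[]yX.
- have xB := kings_closed xy (class_sub t yX).
  by case: (class_pred t yX xB xy) => [->|->]; rewrite ?class_base ?orbT.
- have xB := kings_closed xy (class_sub tb yX).
  by case: (class_pred tb yX xB xy) => [->|->]; rewrite ?class_base ?orbT.
- have xB := kings_closed xy (class_sub tc yX).
  by case: (class_pred tc yX xB xy) => [->|->]; rewrite ?class_base ?orbT.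
Qed.

End Tripartite.

(** * Exclusion of triangle blow-ups *)

Section TripartiteFalse.

Variables (T : finType) (D : rel T).
Hypothesis D_irr : irreflexive D.
Hypothesis D_tt : transitive_triangle_free D.
Hypothesis D_alis : arc_locally_in_semicomplete D.
Hypothesis IH : forall W : {set T}, W \proper setT -> BEon D W.
Hypothesis nBE : ~ BEon D setT.
Hypothesis nodom : forall x u w, ~ dominated D x u w.

Local Notation adj := (adjacent D).
Local Notation B := (kings D).
Local Notation mtri := (max_triangle D).
Local Notation cl := (class D).
Let alis := alis D_alis.
Let cb := class_base D.
Let clsub := class_sub (D := D).
Let disj := class_disjoint (D := D) D_irr.
Let nonadj := class_nonadj D_irr D_tt D_alis.
Let pred := class_pred D_irr D_tt D_alis.
Let cover := class_cover D_irr D_tt D_alis.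
Let complete := class_complete D_irr D_tt D_alis.

Lemma max_triangle_proper a b c : mtri a b c -> ~ (B \subset [set a; b; c]).
Proof.
move=> t /subsetP BK; have [_ _ _ [/strong_cliqueP[clK _ _ _] _]] := t.
apply: (kings_clique_false D_irr D_tt D_alis IH nBE nodom) => x y xB yB.
exact: clK (BK x xB) (BK y yB).
Qed.

(** An edge against the cyclic order starts at [b] itself. Then p -> b -> z <- u merges the stable
    class of [a] into [u], and the digon on a, b leaves [b] without copies. *)
Lemma digon_class a b c z u w : mtri a b c -> z \notin B -> u \in cl a b c ->
  w \in cl b c a -> D w u -> D u z -> D w z ->
  [/\ u = a, w = b, forall p, p \in cl a b c -> p = a & forall p, p \in cl b c a -> p = b].
Proof.
move=> t zB uX wX wu uz wz; have tb := max_triangle_rot t.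
have [ab bc ca _] := t.
have wb : w = b.
  case: (pred t uX (clsub tb wX) wu) => [wX'|//]; by case: (disj tb wX wX').
subst w.
have Xu p : p \in cl a b c -> p = u.
  move=> pX; have pb := complete t pX wX.
  have [/orP[]|//] := alis pb wz uz; by rewrite (nonadj t).
have ua : a = u by apply: Xu.
subst u; split=> // p pX; case: (classP tb pX) => // -[_ _ /and5P[_ _ _ _]].
by rewrite wu.
Qed.

(** [B] is now {a, b} and the stable class of [c], which has a second vertex because [B] does not
    lie in the triangle. [chain_BE] applies to {a, b}. *)
Lemma digon_class_false a b c z u w : mtri a b c -> z \notin B -> u \in cl a b c ->
  w \in cl b c a -> D w u -> D u z -> D w z -> False.
Proof.
move=> t zB uX wX wu uz wz; have [ab bc ca _] := t.
have tb := max_triangle_rot t; have tc := max_triangle_rot tb.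
have [eu ew Xa Xb] := digon_class t zB uX wX wu uz wz; subst u w.
have [neab nebc neca] := max_triangle_neq D_irr t.
have [aB bB cB] : [/\ a \in B, b \in B & c \in B].
  by split; apply: (subsetP (max_triangle_sub t)); rewrite in_set3 eqxx ?orbT.
have nB := max_triangle_proper t.
have Bcases x : x \in B -> [\/ x = a, x = b | x \in cl c a b].
  by move=> /(cover t)/or3P[/Xa|/Xb|]; [constructor 1|constructor 2|constructor 3].
have nXc : exists2 x, x \in cl c a b & x != c.
  apply/exists_inP; apply: contraT; rewrite negb_exists => /forallP h; case: nB.
  apply/subsetP=> x /Bcases[->|->|xX]; rewrite in_set3 ?eqxx ?orbT //.
  by have := h x; rewrite xX negbK /= => ->; rewrite !orbT.
have Xne x : x \in cl c a b -> x != a /\ x != b.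
  move=> xX; split; apply/eqP=> e; subst x.
    exact: disj tc xX (cb _ _ _).
  exact: disj tb (cb _ _ _) xX.
have zpred y : D y z -> y = a \/ y = b.
  move=> yz; have uw : adj a b by rewrite /adjacent /= ab.
  have [yB ha] := common_succ D_irr D_tt D_alis IH nBE nodom zB aB bB uw uz wz yz.
  case: (Bcases y yB) => [->|->|yX]; [by left|by right|exfalso].
  have [ya yb] := Xne y yX; have [_ ay] := ha ya.
  have [yb' by'] := common_succ_clique D_irr D_tt D_alis IH nBE nodom zB aB bB uw uz wz yz wz yb.
  case: (pred tb (cb _ _ _) yB yb') => [yX'|ey]; first by case: (disj tc yX yX').
  subst y; case: nXc => x xX nx; case: (classP tc xX) => [e|[_ _ /and5P[_ _ _ _]]].
    by rewrite e eqxx in nx.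
  by rewrite yb'.
have clab : clique D [set a; b].
  by move=> x y; rewrite !in_set2 => /orP[]/eqP-> /orP[]/eqP->; rewrite ?eqxx // /adjacent /= ab ?orbT.
have zne x : x \in B -> z != x by move=> xB; apply: contraNneq zB => ->.
have coreB := kings_core D_irr D_tt D_alis IH nBE nodom.
have outb s : s \notin [set a; b] -> adj b s -> D b s.
  rewrite in_set2 negb_or => /andP[sa sb] /orP[//|sb'].
  have sB := kings_closed sb' bB.
  by case: (pred tb (cb _ _ _) sB sb') => [/Xa e|->//]; rewrite e eqxx in sa.
have clab3 t' : adj t' a -> adj t' b -> clique D (t' |: [set a; b]).
  move=> ta tb' x y; rewrite ![_ \in t' |: _]in_setU1 => /orP[/eqP->|xK] /orP[/eqP->|yK]; rewrite ?eqxx //.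
  - by case/set2P: yK => ->.
  - by case/set2P: xK => ->; rewrite adjC.
  - exact: clab.
have pairA x y (A : {set T}) : D y x -> A \subset [set x; y] -> x \notin A -> A != set0 ->
    exists p q, [/\ p \in A, q \in [set x; y] :\: A & D p q].
  move=> yx /subsetP sA xA /set0Pn[p pA]; exists p, x; rewrite in_setD xA in_set2 eqxx.
  by case/set2P: (sA p pA) => e; rewrite e in pA *; rewrite ?pA // (negPf xA) in pA.
have setab : [set a; b] :\ a = [set b].
  by apply/setP=> x; rewrite in_setD1 in_set2 in_set1; case: (eqVneq x a) => //= ->; rewrite (negPf neab).
have setba : [set a; b] :\ b = [set a].
  by apply/setP=> x; rewrite in_setD1 in_set2 in_set1; case: (eqVneq x b) => [->|]; rewrite ?orbF //= eq_sym (negPf neab).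
apply: nBE; apply: (chain_BE D_tt clab).
- move=> k kK; have inE' p : p \in ~: ([set a; b] :\ k) :&: B -> p = k \/ p \in cl c a b.
    rewrite in_setI in_setC in_setD1 negb_and negbK => /andP[h /Bcases[e|e|]]; last by right.
      by move: h; rewrite e in_set2 eqxx /= orbF => /eqP->; left.
    by move: h; rewrite e in_set2 eqxx orbT /= orbF => /eqP->; left.
  have Xk x : x \in cl c a b -> (x == k) = false.
    by move=> /Xne[xa xb]; case/set2P: kK => ->; apply/negbTE.
  apply: (core_bip D_irr D_tt D_alis coreB).
    exists (fun p => p == k) => p q /inE'[->|pX] /inE'[->|qX] pq.
    + by rewrite adjxx in pq.
    + by rewrite eqxx Xk.
    + by rewrite eqxx Xk.
    + by rewrite /adjacent /= !(nonadj tc) in pq.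
  have key x z' : x \in cl c a b -> z' \notin B -> D x k -> D k x -> D x z' -> D k z' -> False.
    move=> xX zB' xk kx xz kz; have [x' x'X nx'] := nXc.
    case/set2P: kK => ek; subst k.
      have [_ _ h _] := digon_class tc zB' xX (cb _ _ _) kx xz kz.
      by rewrite (h x' x'X) eqxx in nx'.
    have [_ _ _ h] := digon_class tb zB' (cb _ _ _) xX xk kz xz.
    by rewrite (h x' x'X) eqxx in nx'.
  move=> p q z' /inE'[->|pX] /inE'[->|qX] _ zB' pq qp pz qz.
  + by rewrite D_irr in pq.
  + exact: key qX zB' qp pq qz pz.
  + exact: key pX zB' pq qp pz qz.
  + by rewrite (nonadj tc) in pq.
- exists b; first by rewrite in_set2 eqxx orbT.
  move=> s sK bs; apply: rooted_append (outb s sK bs) => //.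
    by rewrite in_set2 eqxx orbT.
  by move=> A; rewrite setUC; apply: pairA.
(* The vertex t is [c] for [k0 = a] and [z] for [k0 = b]: each time the other vertex of {a, b}
   points to t. *)
move=> k0 /set2P[]->; right.
  exists c; split.
  - by rewrite in_set2 negb_or neca eq_sym nebc.
  - by rewrite /adjacent /= ca.
  - apply: rooted_clique => //; last by rewrite !inE eqxx !orbT.
    by apply: clab3; rewrite /adjacent /= ?ca ?bc ?orbT.
  rewrite setab => s sK cs.
  have scD : D c s.
    case/orP: cs => // sc; have sB := kings_closed sc cB.
    case: (Bcases s sB) => [e|e|sX]; last by rewrite (nonadj tc) in sc.
      by rewrite e in_set2 eqxx in sK.
    by rewrite e in_set2 eqxx orbT in sK.
  have snK : s \notin [set c; b].
    rewrite in_set2 negb_or; apply/andP; split; first by apply: contraTneq scD => ->; rewrite D_irr.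
    by apply: contraNneq sK => ->; rewrite in_set2 eqxx orbT.
  apply: rooted_append scD => //.
  - move=> x y; rewrite !in_set2 => /orP[]/eqP-> /orP[]/eqP->; rewrite ?eqxx // /adjacent /= bc ?orbT //.
  - by rewrite in_set2 eqxx.
  - by move=> A; apply: pairA.
exists z; split.
- by rewrite in_set2 negb_or !zne.
- by rewrite /adjacent /= wz orbT.
- apply: rooted_clique => //; last by rewrite !inE eqxx !orbT.
  by apply: clab3; rewrite /adjacent /= ?uz ?wz ?orbT.
rewrite setba => s sK zs.
have zsD : D z s.
  by case/orP: zs => // /zpred[] e; rewrite e in_set2 eqxx ?orbT in sK.
have snK : s \notin [set z; a].
  rewrite in_set2 negb_or; apply/andP; split; first by apply: contraTneq zsD => ->; rewrite D_irr.
  by apply: contraNneq sK => ->; rewrite in_set2 eqxx.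
apply: rooted_append zsD => //.
- move=> x y; rewrite !in_set2 => /orP[]/eqP-> /orP[]/eqP->; rewrite ?eqxx // /adjacent /= uz ?orbT //.
- by rewrite in_set2 eqxx.
- by move=> A; apply: pairA.
Qed.

Lemma max_triangle_false a0 b0 c0 : mtri a0 b0 c0 -> False.
Proof.
(* Rotating the triple turns the three classes into a sequence of period three, the form required by
   [blowup_false]. *)
move=> t0; pose rot (s : T * T * T) := (s.1.2, s.2, s.1.1).
pose z i := iter i rot (a0, b0, c0).
pose cls (s : T * T * T) := cl s.1.1 s.1.2 s.2.
pose X i := cls (z i).
have zt i : mtri (z i).1.1 (z i).1.2 (z i).2.
  by elim: i => [|i IHi] //=; apply: max_triangle_rot.
have X3 i : X (i + 3) = X i by rewrite /X /z addnC iterD; case: (iter i _ _) => [[]].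
have X1 i : X i.+1 = cl (z i).1.2 (z i).2 (z i).1.1 by [].
have X2 i : X i.+2 = cl (z i).2 (z i).1.1 (z i).1.2 by [].
have Xmod i j : i = j %[mod 3] -> X i = X j by apply: (X_mod (k := 3)).
have Xdisj i p : p \in X i -> p \in X i.+1 -> False by apply: disj (zt i).
have Xuniq i j p : p \in X i -> p \in X j -> i = j %[mod 3].
  move=> pi pj; have [e e3 eij] := mod_offset i j (isT : 0 < 3).
  rewrite -(Xmod _ _ eij) in pj; case: e e3 pj eij => [|[|[|//]]] _ pj; rewrite ?addn0 //.
    by rewrite addn1 in pj; case: (Xdisj _ _ pi pj).
  by rewrite addn2 in pj; case: (Xdisj i.+2 p pj); rewrite -addn3 X3.
have Xpred i p y : y \in X i -> D p y -> p \in X i.+1 \/ p \in X i.+2.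
  move=> yX py; have pB := kings_closed py (clsub (zt i) yX).
  case: (pred (zt i) yX pB py) => [h|->]; first by right; rewrite X2.
  by left; rewrite X1 class_base.
have Xcover p : p \in B -> exists i, p \in X i.
  by move=> /(cover t0)/or3P[h|h|h]; [exists 0|exists 1|exists 2].
have XX i : {in X i & X i.+1, forall x y, D x y}.
  by move=> x y xi yi; apply: (complete (zt i)).
have XB i x : x \in X i -> x \in B by apply: clsub (zt i).
apply: (blowup_false D_irr D_tt D_alis IH nBE nodom (k := 3) (X := X)) => //.
- move=> i j x y xi yj xy; case: (Xpred j x y yj xy) => xj.
    by right; apply: Xuniq xi xj.
  left; have e := Xuniq _ _ _ xi xj; apply: (Xuniq _ _ y yj).
  suff -> : X i.+1 = X j by [].
  apply: Xmod; lia.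
move=> u w v uB wB vB uw wu uv wv.
have [i ui] := Xcover u uB; case: (Xpred i w u ui wu) => wi.
  exact: digon_class_false (zt i) vB ui wi wu uv wv.
apply: (digon_class_false (zt i.+2) vB wi _ uw wv uv); rewrite -/(cls (z i.+3)) -/(X i.+3).
by rewrite -addn3 X3.
Qed.

End TripartiteFalse.

(** * The theorem *)

Section Assembly.

Variables (T : finType) (D : rel T).
Hypothesis D_irr : irreflexive D.
Hypothesis D_tt : transitive_triangle_free D.
Hypothesis D_alis : arc_locally_in_semicomplete D.
Hypothesis IH : forall W : {set T}, W \proper setT -> BEon D W.
Hypothesis nBE : ~ BEon D setT.

Local Notation B := (kings D).

Let nodom x u w : ~ dominated D x u w := @dominated_false T D D_irr D_tt D_alis IH nBE x u w.

Lemma triangle_strong_clique a b c : D a b -> D b c -> D c a -> strong_clique D [set a; b; c].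
Proof.
move=> ab bc ca; have H x y z : D x y -> D y z -> D z x -> x \in B.
  move=> xy yz zx; apply: (bad_king D_irr D_tt D_alis IH nBE nodom); left.
  exact: triangle_odd xy yz zx.
have ne x y : D x y -> x != y by apply: contraTneq => ->; rewrite D_irr.
apply/strong_cliqueP; split.
- move=> x y; rewrite !in_set3 => /or3P[]/eqP-> /or3P[]/eqP->;
    by rewrite ?eqxx // /adjacent /= ?ab ?bc ?ca ?orbT.
- by rewrite setUC cardsU1 cards2 in_set2 negb_or (ne _ _ ca) (ne _ _ ab) eq_sym (ne _ _ bc).
- by apply/subsetP=> x; rewrite in_set3 => /or3P[]/eqP->; [apply: H ab bc ca|apply: H bc ca ab|apply: H ca ab bc].
move=> P /properP[/subsetP PK [e eK eP]] /set0Pn[p pP].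
have out x y : x \in P -> y \notin P -> y \in [set a; b; c] -> D x y ->
    exists x y, [/\ x \in P, y \in [set a; b; c] :\: P & D x y].
  by move=> xP yP yK xy; exists x, y; rewrite in_setD yP.
have [a3 b3 c3] : [/\ a \in [set a; b; c], b \in [set a; b; c] & c \in [set a; b; c]].
  by split; rewrite in_set3 eqxx ?orbT.
case aP: (a \in P); case bP: (b \in P); case cP: (c \in P).
- by move: eK eP; rewrite in_set3 => /or3P[]/eqP->; rewrite ?aP ?bP ?cP.
- by apply: out bP _ c3 bc; rewrite cP.
- by apply: out aP _ b3 ab; rewrite bP.
- by apply: out aP _ b3 ab; rewrite bP.
- by apply: out cP _ a3 ca; rewrite aP.
- by apply: out bP _ c3 bc; rewrite cP.
- by apply: out cP _ a3 ca; rewrite aP.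
- by have := PK p pP; move: pP; rewrite in_set3 => + /or3P[]/eqP ep; rewrite ep ?aP ?bP ?cP.
Qed.

Lemma strong_clique_false K : strong_clique D K -> False.
Proof.
move=> scK0; case: (arg_maxnP (fun K : {set T} => #|K|) scK0) => {scK0} {}K scK maxK.
have mK : max_strong_clique D K by split.
have /(strong_cliqueP)[clK c3 KB _] := scK.
have [/exists_inP[y yB /andP[yK /exists_inP[k kK yk]]]|] :=
    boolP [exists y in B, (y \notin K) && [exists k in K, D y k]]; last first.
  rewrite negb_exists => /forallP noy.
  have [k kK] : exists k, k \in K by apply/card_gt0P; lia.
  have /subsetP BK : B \subset K.
    apply: (kings_sub kK) => x y xy yK; apply: contraT => xK.
    have := noy x; rewrite xK (kings_closed xy (subsetP KB _ yK)) /= => /negP[].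
    by apply/exists_inP; exists y.
  apply: (kings_clique_false D_irr D_tt D_alis IH nBE nodom) => x y xB yB.
  exact: clK (BK x xB) (BK y yB).
have [n [v c]] := clone_exists D_irr D_tt D_alis mK yB yK kK yk.
have [c4|c4] := ltnP 3 #|K|.
  exact: (large_strong_clique_false D_irr D_tt D_alis IH nBE nodom mK c4 yB yK c).
have [[nK vK nv] _ _ nvD h] := c.
have [i [iK i_n iv vi]] := clone_return D_irr scK c.
have [i_nD _ _ _] := h i iK i_n iv.
have eK : [set n; v; i] = K.
  apply/eqP; rewrite eqEcard; apply/andP; split.
    by apply/subsetP=> x; rewrite in_set3 => /or3P[]/eqP->.
  apply: leq_trans c4 _; rewrite setUC cardsU1 cards2 in_set2 negb_or.
  by rewrite i_n iv nv.
apply: (@max_triangle_false T D D_irr D_tt D_alis IH nBE nodom n v i).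
by split=> //; rewrite eK.
Qed.

Lemma minimal_counterexample_false : False.
Proof.
apply: (no_odd_false D_irr D_tt D_alis IH nBE nodom) => x0 [n0 on0 wk0].
pose P n := odd n && [exists x, walk D n x x].
have exP : exists n, P n by exists n0; rewrite /P on0; apply/existsP; exists x0.
case: (ex_minnP exP) => k /andP[ok /existsP[x wk]] kmin.
have k_min j y : odd j -> j < k -> ~~ walk D j y y.
  move=> oj; apply: contraL => wj; rewrite -leqNgt; apply: kmin.
  by rewrite /P oj; apply/existsP; exists y.
have [k5|k5] := ltnP 4 k.
  have [z [_ zs zp]] := closed_walk_fun (ltn_trans (isT : 0 < 4) k5) wk.
  exact: (long_odd_false D_irr D_tt D_alis IH nBE nodom ok k5 k_min (conj zs zp)).
case: k ok wk {kmin k_min} k5 => [|[|[|[|[|//]]]]] // _ wk _.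
  by case/existsP: wk => u /andP[/eqP->]; rewrite D_irr.
have [a xa /walkS_inv[b ab /walkS_inv[x' bx /eqP ex]]] := walkS_inv wk.
by subst x'; apply: (strong_clique_false (triangle_strong_clique xa ab bx)).
Qed.

End Assembly.

(** * Induced subdigraphs, blocking triangles and path partitions *)

Lemma rooted_imset (T1 T2 : finType) (D1 : rel T1) (D2 : rel T2) (f : T1 -> T2) F s :
  injective f -> (forall x y, D2 (f x) (f y) = D1 x y) -> rooted D1 F s ->
  rooted D2 (f @: F) (f s).
Proof.
move=> fI fD [l [ul mem_l sl el]]; exists (map f l); split.
- by rewrite map_inj_uniq.
- move=> y; apply/mapP/imsetP=> -[x xl ->]; exists x => //; by rewrite ?mem_l // -mem_l.
- by rewrite sorted_map; apply: sub_sorted sl => x y; rewrite /= fD.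
- case: el => -[q ->]; [left|right]; exists (map f q); by rewrite ?map_rcons.
Qed.

Lemma stable_imset (T1 T2 : finType) (D1 : rel T1) (D2 : rel T2) (f : T1 -> T2) (S : {set T1}) :
  (forall x y, D2 (f x) (f y) = D1 x y) -> stable D1 S -> stable D2 (f @: S).
Proof.
move=> fD st _ _ /imsetP[x xS ->] /imsetP[y yS ->]; rewrite /adjacent /= !fD; exact: st.
Qed.

(** A minimal counterexample is studied through subsets of one vertex type, whereas induction on the
    order changes the type; this lemma connects the two. *)
Lemma BEon_induced (T : finType) (D : rel T) (W : {set T}) :
  BEon (induced D W) setT -> BEon D W.
Proof.
move=> BE S /and3P[SW /stablebP st /eqP cS].
pose S' : {set {x : T | x \in W}} := [set u | val u \in S].
have vS' : val @: S' = S.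
  apply/setP=> x; apply/imsetP/idP=> [[u uS ->]|xS]; first by rewrite inE in uS.
  by exists (Sub x (subsetP SW x xS)); rewrite ?inE ?SubK.
have cvS (A : {set {x : T | x \in W}}) : #|val @: A| = #|A| by apply: card_imset val_inj.
have sub_val (A : {set {x : T | x \in W}}) : val @: A \subset W.
  by apply/subsetP=> _ /imsetP[u _ ->]; apply: valP.
have st' : stable (induced D W) S'.
  by move=> u w; rewrite !inE => uS wS; apply: (st _ _ uS wS).
have mS' : max_stable (induced D W) setT S'.
  apply/and3P; split; [exact: subsetT|exact/stablebP|].
  rewrite eqn_leq alpha_ge ?subsetT //=; apply: alpha_le => A _ stA.
  rewrite -(cvS S') vS' cS -cvS; apply: alpha_ge (sub_val A) _.
  exact: stable_imset stA.
have [h [hS hr]] := BE S' mS'.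
exists (fun v => if insub v is Some u then val (h u) else v); split.
  move=> v vW; rewrite insubT /= ; have := hS (Sub v vW) (in_setT _); by rewrite inE.
move=> s sS; have sW := subsetP SW s sS.
have s'S : (Sub s sW : {x : T | x \in W}) \in S' by rewrite inE SubK.
have := rooted_imset (f := val) val_inj (fun x y => erefl (D (val x) (val y))) (hr _ s'S).
rewrite SubK; apply: eq_rooted; apply/setP=> v; rewrite in_set.
apply/imsetP/andP=> [[u + ->]|[vW]].
  by rewrite !inE valK => /eqP->; rewrite SubK (valP u).
rewrite insubT => /eqP e; exists (Sub v vW); rewrite ?SubK // !inE.
by apply/eqP/val_inj; rewrite SubK.
Qed.

Lemma BEon_setT (T : finType) (D : rel T) : irreflexive D -> transitive_triangle_free D ->
  arc_locally_in_semicomplete D -> BEon D setT.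
Proof.
have [n] := ubnP #|T|; elim: n T D => // n IHn T D lt D_irr D_tt D_alis.
apply: NNPP; apply: (minimal_counterexample_false D_irr D_tt D_alis) => W pW.
apply: BEon_induced; apply: IHn.
- by rewrite card_sig; apply: leq_trans (proper_card pW) _; rewrite cardsT.
- by move=> x; apply: D_irr.
- by move=> a b c; apply: D_tt.
move=> u v uv x y xu yv; have [h|/val_inj] := D_alis _ _ uv _ _ xu yv; by [left|right].
Qed.

Lemma no_blocking_triangle_free (T : finType) (D : rel T) : irreflexive D ->
  ~ contains_induced_blocking_odd_cycle D -> transitive_triangle_free D.
Proof.
move=> D_irr nb a b c ab bc ac; apply: contraT; rewrite !negb_or => /and3P[nba ncb nca].
case: nb; pose A := [set a; b; c]; exists A.
have [aA bA cA] : [/\ a \in A, b \in A & c \in A] by split; rewrite in_set3 eqxx ?orbT.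
pose a' : {x | x \in A} := exist _ a aA; pose b' : {x | x \in A} := exist _ b bA.
pose c' : {x | x \in A} := exist _ c cA.
(* The order puts the source [a] first and the sink [c] second, as a blocking odd cycle demands. *)
pose x (i : 'I_3) := nth a' [:: a'; c'; b'] i.
have nD y z : D y z -> (y == z) = false by move=> yz; apply: contraTF yz => /eqP->; rewrite D_irr.
have xE (i : 'I_3) : val (x i) = nth a [:: a; c; b] i by case: i => [[|[|[|]]]].
have AE (u : {x | x \in A}) : [\/ val u = a, val u = b | val u = c].
  by have := valP u; rewrite in_set3 => /or3P[]/eqP; [constructor 1|constructor 2|constructor 3].
exists 1, x; split=> //.
- apply: inj_card_bij.
    have [[nab nbc] nac] := (nD _ _ ab, nD _ _ bc, nD _ _ ac).
    move=> i j /(congr1 val); rewrite !xE => e; apply: val_inj.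
    case: i j e => [[|[|[|//]]] ?] [[|[|[|//]]] ?] //= /eqP; by rewrite ?nab ?nbc ?nac // eq_sym ?nab ?nbc ?nac.
  rewrite card_sig card_ord; apply: leq_trans (leq_card_setU _ _) _.
  by rewrite cards1 cards2; case: (_ != _).
- move=> i j; rewrite /adjacent /= /induced !xE -!val_eqE.
  by case: i j => [[|[|[|//]]] ?] [[|[|[|//]]] ?]; rewrite /= ?D_irr ?ab ?bc ?ac ?orbT // (negPf nba).
- by move=> u; rewrite /induced xE /=; case: (AE u) => ->; rewrite ?D_irr.
- by move=> u; rewrite /induced xE /=; case: (AE u) => ->; rewrite ?D_irr.
Qed.

Lemma coverable_partition (T : finType) (D : rel T) (S : {set T}) :
  coverable D setT S -> exists P, BE_path_partition D S P.
Proof.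
move=> [h [hS hr]].
(* The paths are chosen as a function on all vertices, with an irrelevant empty list outside [S];
   only the lists of [S] enter the partition. *)
have /fin_all_exists[L LP] s : exists l, s \in S -> [/\ uniq l,
    l =i [set v in setT | h v == s], sorted D l & starts_or_ends s l].
  have [sS|sS] := boolP (s \in S); last by exists [::].
  by have [l lP] := hr s sS; exists l.
have mL s v : s \in S -> (v \in L s) = (h v == s).
  by move=> sS; have [_ m _ _] := LP s sS; rewrite m !inE.
have sL s : s \in S -> s \in L s.
  move=> sS; have [_ _ _ [[q ->]|[q ->]]] := LP s sS; by rewrite ?mem_rcons inE eqxx.
exists [seq L s | s <- enum S]; split.
- split=> [p /mapP[s + ->]|v].
    rewrite mem_enum => sS; have [u _ so _] := LP s sS; split=> // e.
    by have := sL s sS; rewrite e.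
  rewrite count_map (@eq_in_count _ _ (pred1 (h v))) => [|s]; last first.
    by rewrite mem_enum /= => sS; rewrite mL // eq_sym.
  by rewrite count_uniq_mem ?enum_uniq // mem_enum hS ?in_setT.
- move=> p /mapP[s + ->]; rewrite mem_enum => sS; apply/eqP/cards1P; exists s.
  apply/setP=> v; rewrite in_setI !inE; apply/andP/eqP=> [[vL vS]|->]; last by rewrite sL.
  have := sL v vS; rewrite mL // => /eqP <-; by move: vL; rewrite mL // => /eqP.
- move=> s sS; exists (L s); first by apply/map_f; rewrite mem_enum.
  by have [] := LP s sS.
Qed.

Theorem theorem29 (T : finType) (D : rel T)
    (D_loopless : irreflexive D)
    (D_alis : arc_locally_in_semicomplete D)
    (D_no_blocking : ~ contains_induced_blocking_odd_cycle D) :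
  BE_diperfect D.
Proof.
have D_tt := no_blocking_triangle_free D_loopless D_no_blocking.
move=> A S [st maxS]; apply: coverable_partition.
have BE : BEon (induced D A) setT.
  apply: BEon_setT.
  - by move=> x; apply: D_loopless.
  - by move=> a b c; apply: D_tt.
  move=> u v uv x y xu yv; have [h|/val_inj] := D_alis _ _ uv _ _ xu yv; by [left|right].
apply: BE; apply/and3P; split; [exact: subsetT|exact/stablebP|].
by rewrite eqn_leq alpha_ge ?subsetT //=; apply: alpha_le => S' _; apply: maxS.
Qed.
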